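(* Let $D\in\mathrm{End}(\mathbb R^{2n-1})$. The almost abelian Lie algebra $\mathfrak g=\mathbb R^{2n-1}\rtimes_D\mathbb R$ admits both a complex structure and a symplectic structure but not a pseudo-Kähler structure if and only if $$j(D)\in 2J_m(-c)+J_m(c)+J_{m+1}(c)+\mathcal Q\quad\text{for some }c\in\mathbb R\setminus\{0\},\ m\ge0.$$
   Context: $\mathbb R^{2n-1}\rtimes_D\mathbb R$ is the Lie algebra $\mathbb R^{2n-1}\oplus\mathbb R e$ with $\mathbb R^{2n-1}$ an abelian ideal and $[e,X]=DX$ for $X\in\mathbb R^{2n-1}$. A complex structure on a Lie algebra $\mathfrak g$ is $J\in\mathrm{End}(\mathfrak g)$ with $J^2=-\mathrm{Id}$ and $[X,Y]+J[JX,Y]+J[X,JY]-[JX,JY]=0$ for all $X,Y$. A symplectic structure is a nondegenerate alternating bilinear form $\omega$ with $\omega([X,Y],Z)+\omega([Y,Z],X)+\omega([Z,X],Y)=0$ for all $X,Y,Z$. A pseudo-Kähler structure is a pair $(J,g)$ with $J$ a complex structure and $g$ a nondegenerate symmetric bilinear form of arbitrary signature such that $g(JX,JY)=g(X,Y)$ and $\omega=g(J\cdot,\cdot)$ is a symplectic structure. Jordan types. For $\alpha\in\mathbb R$, $m\ge0$, let $J_m(\alpha)$ be a symbol representing the real Jordan block of size $m+1$ with eigenvalue $\alpha$. For $\zeta\in\mathbb C\setminus\mathbb R$, $m\ge 0$, let $C_m(\zeta)=C_m(\overline\zeta)$ be a symbol representing the real matrix of size $2m+2$ obtained from the complex Jordan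 block of size $m+1$ with eigenvalue $\zeta$ via $\mathbb C^{m+1}\cong\mathbb R^{2m+2}$. Let $\mathcal{GL}$ be the free abelian semigroup generated by these symbols. The Jordan type $j(X)\in\mathcal{GL}$ of a real square matrix $X$ is the formal sum, with multiplicities, of the $J_m(\alpha)$ and $C_m(\zeta)$ appearing in its real Jordan form. $\mathcal Q\subset\mathcal{GL}$ is the subsemigroup (containing $0$) generated by $$2J_m(0),\qquad 2J_m(x)+2J_m(-x)\ (x\in\mathbb R\setminus\{0\}),\qquad C_m(\zeta)\ (\zeta\in i\mathbb R\setminus\{0\}),\qquad C_m(\zeta)+C_m(-\overline\zeta)\ (\zeta\in\mathbb C\setminus(\mathbb R\cup i\mathbb R)),$$ with $m\geq 0$. *)

(* Defs.v *)
From HB Require Import structures.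
From mathcomp Require Import all_boot all_order all_algebra.
From mathcomp Require Import finmap multiset complex.
From mathcomp Require Export reals.

Set Implicit Arguments.
Unset Strict Implicit.
Unset Printing Implicit Defensive.

Import Order.TTheory GRing.Theory Num.Theory.

Local Open Scope ring_scope.
Local Open Scope mset_scope.
Local Open Scope complex_scope.

Record lieAlgebra (R : fieldType) := LieAlgebra {
  lie_sort :> vectType R;
  lie_bracket : lie_sort -> lie_sort -> lie_sort;
  lie_bilinear : bilinear_for *:%R *:%R lie_bracket;
  lie_alternating : forall x, lie_bracket x x = 0;
  lie_jacobi : forall x y z,
    lie_bracket x (lie_bracket y z) + lie_bracket y (lie_bracket z x)
    + lie_bracket z (lie_bracket x y) = 0
}.

Notation "[ 'lie' x , y ]" := (lie_bracket x y)
  (at level 0, x, y at level 99, format "[ 'lie'  x ,  y ]") : ring_scope.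

Section AlmostAbelian.
Variables (R : fieldType) (k : nat) (D : 'M[R]_k).

(* (u, s) stands for u + s e *)
Definition almost_abelian_bracket (x y : 'cV[R]_k * R^o) : 'cV[R]_k * R^o :=
  (x.2 *: (D *m y.1) - y.2 *: (D *m x.1), 0).

Fact almost_abelian_bilinear :
  bilinear_for *:%R *:%R almost_abelian_bracket.
Proof.
split=> [[v t] a [u s] [u' s']|[u s] a [v t] [v' t']];
  (congr (_, _); last by rewrite /= scaler0 addr0);
  rewrite /= mulmxDr -scalemxAr scalerDl scalerDr scalerBr !scalerA.
- by rewrite [t * a]mulrC opprD addrACA.
- by rewrite [s * a]mulrC opprD addrACA.
Qed.

Fact almost_abelian_alternating x : almost_abelian_bracket x x = 0.
Proof. by rewrite /almost_abelian_bracket subrr. Qed.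

Fact almost_abelian_jacobi x y z :
  almost_abelian_bracket x (almost_abelian_bracket y z)
  + almost_abelian_bracket y (almost_abelian_bracket z x)
  + almost_abelian_bracket z (almost_abelian_bracket x y) = 0.
Proof.
congr (_, _) => /=; rewrite ?addr0 // !scale0r !subr0.
rewrite !mulmxBr -!scalemxAr !scalerBr !scalerA.
rewrite [y.2 * x.2]mulrC [z.2 * x.2]mulrC [z.2 * y.2]mulrC.
by rewrite [_ - _ + (_ - _)]addrC subrKA subrKA subrr.
Qed.

Definition almost_abelian : lieAlgebra R :=
  LieAlgebra almost_abelian_bilinear almost_abelian_alternating
    almost_abelian_jacobi.

End AlmostAbelian.

Section Structures.
Variables (R : fieldType) (g : lieAlgebra R).

Definition complex_structure (J : 'End(g)) : Prop :=
  (forall x, J (J x) = - x) /\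
  (forall x y, [lie x, y] + J [lie J x, y] + J [lie x, J y] - [lie J x, J y] = 0).

Definition nondegenerate_form (f : g -> g -> R) : Prop :=
  forall x, (forall y, f x y = 0) -> x = 0.

Definition symplectic_structure (w : g -> g -> R) : Prop :=
  [/\ bilinear_for *%R *%R w,
      forall x, w x x = 0,
      nondegenerate_form w &
      forall x y z, w [lie x, y] z + w [lie y, z] x + w [lie z, x] y = 0].

Definition pseudo_Kahler_structure (J : 'End(g)) (h : g -> g -> R) : Prop :=
  complex_structure J /\
  [/\ bilinear_for *%R *%R h,
      forall x y, h x y = h y x,
      nondegenerate_form h,
      forall x y, h (J x) (J y) = h x y &
      symplectic_structure (fun x y => h (J x) y)].

End Structures.

Definition jordan_block (F : nzRingType) (m : nat) (a : F) : 'M[F]_m.+1 :=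
  \matrix_(i, j) (a *+ (i == j) + (j == i.+1 :> nat)%:R).

(* matrix of A in the identification C^p = R^(p + p), z |-> (Re z, Im z) *)
Definition realify (R : rcfType) (p : nat) (A : 'M[R[i]]_p) : 'M[R]_(p + p) :=
  block_mx (map_mx (@complex.Re R) A) (- map_mx (@complex.Im R) A)
           (map_mx (@complex.Im R) A) (map_mx (@complex.Re R) A).

Section JordanType.
Variable R : rcfType.

(* The class of zeta modulo complex conjugation is represented by its element
   in the upper half-plane. *)
Definition jsymbol : choiceType :=
  (nat * R + nat * {z : R[i] | 0 < complex.Im z})%type.

Definition Jsym (m : nat) (a : R) : jsymbol := inl (m, a).

Fact Csym_subproof (z : R[i]) :
  complex.Im z != 0 -> 0 < complex.Im (complex.Re z +i* `|complex.Im z|).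
Proof. by move=> z_n0; rewrite /= normr_gt0. Qed.

Definition Csym (m : nat) (z : R[i]) (z_nonreal : complex.Im z != 0) :
  jsymbol :=
  inr (m, exist _ (complex.Re z +i* `|complex.Im z|) (Csym_subproof z_nonreal)).

Lemma Csym_conj m (z : R[i]) (hz : complex.Im z != 0)
  (hz' : complex.Im z^* != 0) : Csym m hz = Csym m hz'.
Proof.
congr (inr (_, _)); apply: val_inj => /=.
by case: z {hz hz'} => a b /=; rewrite normrN.
Qed.

Definition jsymbol_size (s : jsymbol) : nat :=
  match s with inl (m, _) => m.+1 | inr (m, _) => (m.+1 + m.+1)%N end.

Definition jsymbol_mx (s : jsymbol) : 'M[R]_(jsymbol_size s) :=
  match s with
  | inl (m, a) => jordan_block m a
  | inr (m, z) => realify (jordan_block m (val z))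
  end.

Definition jordan_mx (t : seq jsymbol) :
  'M[R]_(\sum_(i < size t) jsymbol_size (tnth (in_tuple t) i)) :=
  \mxdiag_(i < size t) jsymbol_mx (tnth (in_tuple t) i).

(* j(X) = T, where finite multisets of symbols play the role of GL *)
Definition has_jordan_type (k : nat) (X : 'M[R]_k) (T : {mset jsymbol}) :
  Prop :=
  exists2 t : seq jsymbol, seq_mset t = T &
  (* the two matrix sizes coincide, but not definitionally *)
  exists P, exists Q, [/\ P *m Q = 1%:M, Q *m P = 1%:M &
                          Q *m X *m P = jordan_mx t].

Fact oppconj_nonreal (z : R[i]) :
  complex.Im z != 0 -> complex.Im (- z^*) != 0.
Proof. by case: z => a b /=; rewrite opprK. Qed.

Inductive Q_generator : {mset jsymbol} -> Prop :=
| Qgen_zero m : Q_generator (msetn 2%N (Jsym m 0))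
| Qgen_real m (x : R) :
    x != 0 -> Q_generator (msetn 2%N (Jsym m x) `+` msetn 2%N (Jsym m (- x)))
| Qgen_imag m (z : R[i]) (hz : complex.Im z != 0) :
    complex.Re z = 0 -> Q_generator [mset Csym m hz]
| Qgen_cplx m (z : R[i]) (hz : complex.Im z != 0) :
    complex.Re z != 0 ->
    Q_generator ([mset Csym m hz] `+` [mset Csym m (oppconj_nonreal hz)]).

Inductive in_Q : {mset jsymbol} -> Prop :=
| Q_0 : in_Q mset0
| Q_gen T : Q_generator T -> in_Q T
| Q_add T U : in_Q T -> in_Q U -> in_Q (T `+` U).

End JordanType.

(* Main.v *)
Require Import Defs.
From HB Require Import structures.
From mathcomp Require Import all_boot all_order all_algebra.
From mathcomp Require Import finmap multiset complex reals.
From mathcomp Require Import zify ring.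

Set Implicit Arguments.
Unset Strict Implicit.
Unset Printing Implicit Defensive.

Import Order.TTheory GRing.Theory Num.Theory.

Local Open Scope ring_scope.

(** Let [V] be the abelian ideal, [D] the matrix acting on it and [d x j] the
    dimension of the kernel of [(D - x)^j].

    Each structure on the Lie algebra amounts to linear algebra on [V]. A complex
    structure amounts to a [D]-invariant hyperplane [W] with a complex structure
    [J] on [W] commuting with [D]: [W] is the largest [J]-invariant subspace of
    [V]. A symplectic structure amounts to a [D]-skew alternating form [B] on [V]
    whose kernel is a line. A pseudo-Kahler structure amounts to both, with [B]
    invariant under [J] on [W]; the metric on the rest is determined up to one
    scalar ([complex_structure_hyperplane], [complex_structure_ext],
    [symplectic_corank1], [form_ext_symplectic], [pseudo_Kahler_on_ideal],
    [pseudo_Kahler_of_ideal]).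

    Both kinds of data constrain the Jordan type of [D]. Let [a] be the eigenvalue
    of [D] on [V / W]. As [J] acts on the part inside [W] of any kernel of a
    polynomial in [D], the numbers [d x j] are even, except that [d a j] is odd
    for all [j] beyond some [k] ([complex_parity]). Let [b] be the eigenvalue of
    [D] on the kernel of [B]. As [B] intertwines [D] and [- D^T], the number
    [d x j] is at most [d (- x) j], plus one if [x = b]
    ([symplectic_inequality]). The multiplicities of the Jordan blocks are second
    differences of [d] ([mult_Jsym]), so that up to a summand in [Q] three kinds
    of types remain ([jordan_type_classification]):
    - blocks of sizes [k] and [k + 1] at [a], where [a = 0] or [k = 0];
    - these blocks and two of size [k + 1] at [- a];
    - blocks of sizes [k] and [k + 1] at [a] and two of size [k] at [- a], where
      [a <> 0] and [k > 0].

    A matrix with Jordan type in [Q] preserves a complex structure and a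
    pseudo-Hermitian form ([unitary_jordan_mx]), so such a summand can be added
    to any of the structures. The first two kinds carry explicit pseudo-Kahler
    data ([pseudo_Kahler_steps], [pseudo_Kahler_steps_dual]). The third kind
    carries complex and symplectic data ([complex_exceptional],
    [symplectic_exceptional]), but no compatible ones
    ([exceptional_not_pseudo_Kahler]): its kernel dimensions force both [a] and
    [b] to be the given eigenvalue [c]. If the kernel [z] of [B] lies in [W],
    then [B (J z)] is a multiple of the equation of [W], whence [a = - b], which
    contradicts [c <> 0]. If it does not, then [z] is an eigenvector outside [W],
    so [d c 1] is odd, whereas there are evenly many blocks at [c].

    The existence of the real Jordan form ([real_jordan_form]) is proved by
    splitting off one block at a time: a chain of maximal length and a chain of
    the transpose that is dual to it span an invariant subspace and cut out an
    invariant complement. *)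

(** * Direct sums and similarity of matrices of arbitrary sizes *)

Section Similarity.
Variable F : fieldType.

Definition dsum m n (A : 'M[F]_m) (B : 'M[F]_n) : 'M[F]_(m + n) :=
  block_mx A 0 0 B.

(** Sizes of direct sums and of Jordan matrices are rarely convertible, so that
    similarity has to relate matrices of different sizes. *)
Definition simmx m n (A : 'M[F]_m) (B : 'M[F]_n) : Prop :=
  exists P : 'M_(m, n), exists Q : 'M_(n, m),
    [/\ P *m Q = 1%:M, Q *m P = 1%:M & Q *m A *m P = B].

Lemma simmx_refl m (A : 'M[F]_m) : simmx A A.
Proof. by exists 1%:M, 1%:M; rewrite !mulmx1 mul1mx. Qed.

Lemma simmx_sym m n (A : 'M[F]_m) (B : 'M[F]_n) : simmx A B -> simmx B A.
Proof.
move=> [P [Q [PQ QP <-]]]; exists Q, P; split=> //.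
by rewrite !mulmxA PQ mul1mx -mulmxA PQ mulmx1.
Qed.

Lemma simmx_trans m n p (A : 'M[F]_m) (B : 'M[F]_n) (C : 'M[F]_p) :
  simmx A B -> simmx B C -> simmx A C.
Proof.
move=> [P [Q [PQ QP <-]]] [P' [Q' [PQ' QP' <-]]].
exists (P *m P'), (Q' *m Q); split; last by rewrite !mulmxA.
- by rewrite mulmxA -(mulmxA P) PQ' mulmx1.
- by rewrite mulmxA -(mulmxA Q') QP mulmx1.
Qed.

Lemma simmx_size m n (A : 'M[F]_m) (B : 'M[F]_n) : simmx A B -> m = n.
Proof.
move=> [P [Q [PQ QP _]]]; apply/eqP; rewrite eqn_leq.
have /mxrankS := submxMl P Q; rewrite PQ mxrank1 => /leq_trans -> /=; last first.
  exact: rank_leq_row.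
by have /mxrankS := submxMl Q P; rewrite QP mxrank1 => /leq_trans ->; last
  exact: rank_leq_row.
Qed.

Lemma simmx_dsum m n m' n' (A : 'M[F]_m) (B : 'M[F]_n)
    (A' : 'M[F]_m') (B' : 'M[F]_n') :
  simmx A A' -> simmx B B' -> simmx (dsum A B) (dsum A' B').
Proof.
move=> [P [Q [PQ QP <-]]] [P' [Q' [PQ' QP' <-]]].
exists (block_mx P 0 0 P'), (block_mx Q 0 0 Q'); rewrite /dsum.
by split; rewrite !mulmx_block ?(mul0mx, mulmx0, addr0, add0r) ?PQ ?QP ?PQ' ?QP'
  -?scalar_mx_block.
Qed.

Lemma simmx_dsumC m n (A : 'M[F]_m) (B : 'M[F]_n) :
  simmx (dsum A B) (dsum B A).
Proof.
exists (block_mx 0 1%:M 1%:M 0), (block_mx 0 1%:M 1%:M 0); rewrite /dsum.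
by split; rewrite !mulmx_block
  ?(mul0mx, mulmx0, addr0, add0r, mulmx1, mul1mx) -?scalar_mx_block.
Qed.

Lemma simmx_cast m n (e : m = n) (A : 'M[F]_m) : simmx A (castmx (e, e) A).
Proof. by case: n / e; rewrite castmx_id; apply: simmx_refl. Qed.

Lemma simmx_dsumA m n p (A : 'M[F]_m) (B : 'M[F]_n) (C : 'M[F]_p) :
  simmx (dsum A (dsum B C)) (dsum (dsum A B) C).
Proof.
rewrite /dsum -[X in block_mx A X]row_mx0 -[X in block_mx A _ X]col_mx0.
by rewrite block_mxA col_mx0 row_mx0; apply/simmx_sym/simmx_cast.
Qed.

Lemma simmx_dsum0 m (A : 'M[F]_0) (B : 'M[F]_m) : simmx (dsum A B) B.
Proof.
exists (col_mx 0 1%:M), (row_mx 0 1%:M); rewrite /dsum; split.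
- rewrite mul_col_row !mulmx0 !mulmx1 [RHS]scalar_mx_block.
  by congr block_mx; apply/matrixP => - [] // i Hi j; case: j Hi.
- by rewrite mul_row_col mul0mx add0r mulmx1.
- by rewrite mul_row_block mul_row_col !(mulmx0, mul0mx, add0r, mul1mx, mulmx1).
Qed.

Lemma simmx_dsumCA m n p (A : 'M[F]_m) (B : 'M[F]_n) (C : 'M[F]_p) :
  simmx (dsum A (dsum B C)) (dsum B (dsum A C)).
Proof.
apply: simmx_trans (simmx_dsumA _ _ _) _.
apply: simmx_trans (simmx_sym (simmx_dsumA _ _ _)).
by apply: simmx_dsum; [apply: simmx_dsumC | apply: simmx_refl].
Qed.

End Similarity.

Section JordanSum.
Variable R : rcfType.
Implicit Types (s : jsymbol R) (t : seq (jsymbol R)).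

Lemma simmx_tcast s s' : s = s' -> simmx (jsymbol_mx s) (jsymbol_mx s').
Proof. by move=> ->; apply: simmx_refl. Qed.

Lemma simmx_mxdiag_eq n (p q : 'I_n -> nat) (A : forall i, 'M[R]_(p i))
    (B : forall i, 'M[R]_(q i)) :
  (forall i, simmx (A i) (B i)) ->
  simmx (\mxdiag_i A i) (\mxdiag_i B i).
Proof.
elim: n p q A B => [|n IH] p q A B AB.
  exists 0, 0; have e0 (r : 'I_0 -> nat) : (\sum_i r i = 0)%N by rewrite big_ord0.
  by split; apply/matrixP=> i; case: (cast_ord (e0 _) i).
rewrite !mxdiag_recl.
apply: simmx_trans (simmx_sym (simmx_cast _ _)) _.
apply: simmx_trans (simmx_cast _ _).
by apply: simmx_dsum => //; apply: IH.
Qed.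

Lemma jordan_mx_nil (A : 'M[R]_0) : simmx A (jordan_mx [::]).
Proof.
have e0 : (\sum_(i < size ([::] : seq (jsymbol R)))
    jsymbol_size (tnth (in_tuple ([::] : seq (jsymbol R))) i) = 0)%N
  by rewrite big_ord0.
apply/simmx_sym; apply: simmx_trans (simmx_cast e0 _) _.
by rewrite [castmx _ _]flatmx0 [A]flatmx0; apply: simmx_refl.
Qed.

Lemma jordan_mx_cons s t :
  simmx (jordan_mx (s :: t)) (dsum (jsymbol_mx s) (jordan_mx t)).
Proof.
rewrite /jordan_mx /= mxdiag_recl.
apply: simmx_trans (simmx_sym (simmx_cast _ _)) _.
apply: simmx_dsum; first exact: simmx_refl.
apply: simmx_mxdiag_eq => i; apply: simmx_tcast.
by rewrite !(tnth_nth s).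
Qed.

Lemma jordan_mx_cat t1 t2 :
  simmx (jordan_mx (t1 ++ t2)) (dsum (jordan_mx t1) (jordan_mx t2)).
Proof.
elim: t1 => [|s t1 IH] /=.
  apply/simmx_sym; apply: simmx_trans (simmx_dsum0 0 _).
  by apply: simmx_dsum; [apply/simmx_sym/jordan_mx_nil | apply: simmx_refl].
apply: simmx_trans (jordan_mx_cons _ _) _.
apply: simmx_trans (simmx_dsum (simmx_refl _) IH) _.
apply: simmx_trans (simmx_dsumA _ _ _) _.
by apply: simmx_dsum; [apply/simmx_sym/jordan_mx_cons | apply: simmx_refl].
Qed.

Lemma perm_jordan_mx t1 t2 :
  perm_eq t1 t2 -> simmx (jordan_mx t1) (jordan_mx t2).
Proof.
elim: t1 t2 => [|s t1 IH] t2.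
  by rewrite perm_sym => /perm_nilP ->; apply: simmx_refl.
move=> p12; have st2 : s \in t2 by rewrite -(perm_mem p12) mem_head.
case/splitPr: st2 p12 => u v p12.
have {}p12 : perm_eq t1 (u ++ v).
  by rewrite -(perm_cons s) (perm_trans p12) // -cat1s perm_catCA.
apply: simmx_trans (jordan_mx_cons _ _) _.
apply: simmx_trans (simmx_dsum (simmx_refl _) (IH _ p12)) _.
apply: simmx_trans (simmx_dsum (simmx_refl _) (jordan_mx_cat _ _)) _.
apply: simmx_trans (simmx_dsumCA _ _ _) _.
apply: simmx_trans (simmx_sym (jordan_mx_cat _ _)).
by apply: simmx_dsum; [apply: simmx_refl | apply/simmx_sym/jordan_mx_cons].
Qed.

Lemma jordan_mx1 s : simmx (jordan_mx [:: s]) (jsymbol_mx s).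
Proof.
apply: simmx_trans (jordan_mx_cons _ _) _.
apply: simmx_trans (simmx_dsumC _ _) _.
apply: simmx_trans (simmx_dsum0 0 _).
by apply: simmx_dsum; [apply/simmx_sym/jordan_mx_nil | apply: simmx_refl].
Qed.

End JordanSum.

(** * Polynomials in a matrix and the dimensions of their kernels *)

Section PolyEval.
Variable F : fieldType.
Implicit Types (p q : {poly F}).

(** [horner_mx] extended to the size 0, so that sizes such as [m + n] are
    covered as well. *)
Definition mxev n : 'M[F]_n -> {poly F} -> 'M[F]_n :=
  match n with
  | 0 => fun _ _ => 0
  | n'.+1 => fun A p => horner_mx A p
  end.

Lemma mxevD n (A : 'M_n) p q : mxev A (p + q) = mxev A p + mxev A q.
Proof. by case: n A => [|n] A /=; rewrite ?addr0 // rmorphD. Qed.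

Lemma mxevB n (A : 'M_n) p q : mxev A (p - q) = mxev A p - mxev A q.
Proof. by case: n A => [|n] A /=; rewrite ?subr0 // rmorphB. Qed.

Lemma mxevM n (A : 'M_n) p q : mxev A (p * q) = mxev A p *m mxev A q.
Proof. by case: n A => [|n] A /=; rewrite ?mul0mx // rmorphM. Qed.

Lemma mxevC n (A : 'M_n) c : mxev A c%:P = c%:M.
Proof. by case: n A => [|n] A /=; [apply/matrixP=> - [] | rewrite horner_mx_C]. Qed.

Lemma mxevX n (A : 'M_n) : mxev A 'X = A.
Proof. by case: n A => [|n] A /=; [apply/matrixP=> - [] | rewrite horner_mx_X]. Qed.

Lemma mxev0 n (A : 'M_n) : mxev A 0 = 0.
Proof. by rewrite -[0 in LHS]/(0%:P) mxevC raddf0. Qed.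

Lemma mxevMC n (A : 'M_n) p q : mxev A p *m mxev A q = mxev A q *m mxev A p.
Proof. by rewrite -!mxevM mulrC. Qed.

Lemma mxev_inter m n (A : 'M_m) (B : 'M_n) (X : 'M_(m, n)) p :
  A *m X = X *m B -> mxev A p *m X = X *m mxev B p.
Proof.
move=> AX; elim/poly_ind: p => [|p c IH].
  by rewrite !mxev0 mul0mx mulmx0.
rewrite !mxevD !mxevM !mxevX !mxevC mulmxDl mulmxDr scalar_mxC.
by rewrite -mulmxA AX mulmxA IH mulmxA.
Qed.

Lemma mxev_comm n (A : 'M_n) p : A *m mxev A p = mxev A p *m A.
Proof. by have := mxevMC A 'X p; rewrite mxevX. Qed.

Lemma mxev_tr n (A : 'M_n) p : mxev A^T p = (mxev A p)^T.
Proof.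
elim/poly_ind: p => [|p c IH].
  by rewrite !mxev0 trmx0.
rewrite !mxevD !mxevM !mxevX !mxevC linearD /= trmx_mul tr_scalar_mx IH.
by rewrite -!trmx_mul mxev_comm.
Qed.

Lemma mxevN n (A : 'M_n) p : mxev (- A) p = mxev A (p \Po (- 'X)).
Proof.
elim/poly_ind: p => [|p c IH].
  by rewrite comp_poly0 !mxev0.
rewrite comp_polyD comp_polyM comp_polyX comp_polyC !mxevD !mxevM !mxevX !mxevC.
by rewrite IH; congr (_ *m _ + _); rewrite -[in RHS]sub0r mxevB mxevX mxevC
  raddf0 sub0r.
Qed.

Lemma mxev_dsum m n (A : 'M_m) (B : 'M_n) p :
  mxev (dsum A B) p = dsum (mxev A p) (mxev B p).
Proof.
elim/poly_ind: p => [|p c IH]; rewrite /dsum.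
  by rewrite !mxev0 block_mx_const.
rewrite !mxevD !mxevM !mxevX !mxevC IH /dsum mulmx_block scalar_mx_block.
by rewrite add_block_mx !(mulmx0, mul0mx, addr0, add0r).
Qed.

Lemma mxev_char n (A : 'M_n) : mxev A (char_poly A) = 0.
Proof. by case: n A => [|n] A //=; apply: Cayley_Hamilton. Qed.

Definition kdim n (A : 'M[F]_n) p := (n - \rank (mxev A p))%N.

Lemma kdimE n (A : 'M_n) p : kdim A p = \rank (kermx (mxev A p)^T).
Proof. by rewrite mxrank_ker mxrank_tr. Qed.

Lemma kdim_sim m n (A : 'M_m) (B : 'M_n) p : simmx A B -> kdim A p = kdim B p.
Proof.
move=> AB; have emn := simmx_size AB; case: n / emn B AB => B [P [Q [PQ QP def_B]]].
rewrite /kdim; congr (_ - _)%N.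
have BQ : Q *m A = B *m Q by rewrite -def_B -!mulmxA PQ mulmx1.
have /esym eB := @mxev_inter _ _ _ _ _ p (esym BQ).
have [uP uQ] := mulmx1_unit PQ.
have frQ : row_free Q by rewrite row_free_unit.
have fuQ : row_full Q by rewrite row_full_unit.
by rewrite -(mxrankMfree (mxev B p) frQ) -eB (eqmxMfull _ fuQ).
Qed.

Lemma kdim_dsum m n (A : 'M_m) (B : 'M_n) p :
  kdim (dsum A B) p = (kdim A p + kdim B p)%N.
Proof.
rewrite /kdim mxev_dsum rank_diag_block_mx.
by have := rank_leq_row (mxev A p); have := rank_leq_row (mxev B p); lia.
Qed.

Lemma kdim_tr n (A : 'M_n) p : kdim A^T p = kdim A p.
Proof. by rewrite /kdim mxev_tr mxrank_tr. Qed.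

Lemma kdimN n (A : 'M_n) p : kdim (- A) p = kdim A (p \Po (- 'X)).
Proof. by rewrite /kdim mxevN. Qed.

Lemma kdim_coprime n (A : 'M_n) p q :
  mxev A q = 0 -> coprimep p q -> kdim A p = 0%N.
Proof.
move=> qA0 /Bezout_eq1_coprimepP [[u v] /= uv1].
have /mulmx1_unit [_ up] : mxev A u *m mxev A p = 1%:M.
  rewrite -mxevM; have -> : u * p = 1 - v * q by rewrite -uv1 addrK.
  by rewrite mxevB [X in X - _]mxevC mxevM qA0 mulmx0 subr0.
by rewrite /kdim mxrank_unit // subnn.
Qed.

(** Each multiplication by [p(A)] lowers the rank by at most [h], and [m.+1] of
    them lower it from [h * m.+1] to zero: hence each lowers it by exactly [h]. *)
Lemma rank_nilpotent_exp n (A : 'M_n) p h m j :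
  n = (h * m.+1)%N -> mxev A (p ^+ m.+1) = 0 -> (h * m <= \rank (mxev A p))%N ->
  kdim A (p ^+ j) = (h * minn j m.+1)%N.
Proof.
move=> def_n nilp rk.
have step i : (\rank (mxev A (p ^+ i)) <= \rank (mxev A (p ^+ i.+1)) + h)%N.
  rewrite exprSr mxevM; have := mxrank_mul_min (mxev A (p ^+ i)) (mxev A p).
  by rewrite [X in (_ - X)%N]def_n mulnS; lia.
have steps i k : (\rank (mxev A (p ^+ i)) <= \rank (mxev A (p ^+ (i + k))) + h * k)%N.
  elim: k => [|k IH]; first by rewrite addn0 muln0 addn0.
  by have := step (i + k)%N; rewrite addnS mulnS; lia.
have rk0 i : (m < i)%N -> \rank (mxev A (p ^+ i)) = 0%N.
  by move=> lt_mi; rewrite -(subnK lt_mi) exprD mxevM nilp mulmx0 mxrank0.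
rewrite /kdim; case: (leqP j m.+1) => [le_jm|lt_mj]; last first.
  by rewrite rk0 1?ltnW // subn0 def_n; congr (_ * _)%N; lia.
have := steps j (m.+1 - j)%N; rewrite subnKC // (rk0 m.+1) //.
have := steps 0%N j; rewrite expr0 [mxev A 1]mxevC mxrank1 add0n.
rewrite mulnBr => le1 le2.
by have : (h * j <= h * m.+1)%N; [rewrite leq_mul2l le_jm orbT | lia].
Qed.

End PolyEval.

Arguments mxev {F n} A p : simpl never.

(** * Jordan blocks *)

Section JordanBlocks.
Variable F : fieldType.
Implicit Types (a b : F) (m : nat).

Lemma jordan_blockD m a b : jordan_block m (a + b) = a%:M + jordan_block m b.
Proof. by apply/matrixP => i j; rewrite !mxE mulrnDl addrA. Qed.

Lemma jordan_block0E m a : jordan_block m a = a%:M + jordan_block m 0.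
Proof. by rewrite -jordan_blockD addr0. Qed.

(** Cayley-Hamilton for the transpose, which is lower triangular. *)
Lemma jordan_block_annihilated m a :
  mxev (jordan_block m a) (('X - a%:P) ^+ m.+1) = 0.
Proof.
rewrite -[jordan_block m a]trmxK mxev_tr.
have /char_poly_trig chiE : is_trig_mx (jordan_block m a)^T.
  apply/is_trig_mxP => i j lt_ij; rewrite !mxE -val_eqE /=.
  by rewrite gtn_eqF // ltn_eqF ?addr0 // ltnS ltnW.
suff <- : char_poly (jordan_block m a)^T = ('X - a%:P) ^+ m.+1.
  by rewrite mxev_char trmx0.
rewrite chiE (eq_bigr (fun=> 'X - a%:P)); last first.
  by move=> i _; rewrite !mxE eqxx ltn_eqF // addr0.
by rewrite prodr_const card_ord.
Qed.

Lemma jordan_block_rank m : (m <= \rank (jordan_block m (0 : F)))%N.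
Proof.
set N := jordan_block _ _.
rewrite -[X in (X <= _)%N](mxrank1 F m).
have -> : 1%:M = rowsub (widen_ord (leqnSn m)) (colsub (lift ord0) N).
  apply/matrixP=> i j; rewrite !mxE -!val_eqE /= /bump /= add1n.
  by rewrite mul0rn add0r eqSS eq_sym.
rewrite rowsubE; apply: leq_trans (mxrankM_maxr _ _) _.
have -> : colsub (lift ord0) N = N *m colsub (lift ord0) 1%:M.
  by rewrite mulmx_colsub mulmx1.
exact: mxrankM_maxl.
Qed.

Lemma kdim_jordan_block m a j :
  kdim (jordan_block m a) (('X - a%:P) ^+ j) = minn j m.+1.
Proof.
rewrite (@rank_nilpotent_exp _ _ _ _ 1 m) ?mul1n ?jordan_block_annihilated //.
by rewrite mxevB mxevX mxevC jordan_block0E addrC addKr jordan_block_rank.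
Qed.

Lemma kdim_jordan_block_neq m a b j : a != b ->
  kdim (jordan_block m a) (('X - b%:P) ^+ j) = 0%N.
Proof.
move=> ab; apply: kdim_coprime (jordan_block_annihilated m a) _.
by rewrite coprimep_expl // coprimep_expr // coprimep_XsubC2 // subr_eq0.
Qed.

(** The alternating antidiagonal matrix, which anticommutes with the nilpotent
    Jordan block in the sense [N^T H = - H N]. *)
Definition altmx m : 'M[F]_m.+1 :=
  \matrix_(i, j) ((-1) ^+ i *+ (j == rev_ord i)).

Lemma mul_altmx m n (A : 'M[F]_(m.+1, n)) i j :
  (altmx m *m A) i j = (-1) ^+ i * A (rev_ord i) j.
Proof.
rewrite mxE (bigD1 (rev_ord i)) //= mxE eqxx big1 ?addr0 // => k neq_k.
by rewrite mxE (negPf neq_k) mul0r.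
Qed.

Lemma mul_mx_altmx m n (A : 'M[F]_(n, m.+1)) i j :
  (A *m altmx m) i j = A i (rev_ord j) * (-1) ^+ (rev_ord j).
Proof.
rewrite mxE (bigD1 (rev_ord j)) //= mxE rev_ordK eqxx big1 ?addr0 // => k neq_k.
by rewrite mxE -(can_eq (@rev_ordK _)) rev_ordK eq_sym (negPf neq_k) mulr0.
Qed.

Lemma altmx_tr m : (altmx m)^T = (-1) ^+ m *: altmx m.
Proof.
apply/matrixP => i j; rewrite !mxE.
have -> : (i == rev_ord j) = (j == rev_ord i).
  by rewrite -(can_eq (@rev_ordK _)) rev_ordK eq_sym.
case: eqP => [->|_]; last by rewrite mulr0.
rewrite /= subSS mulr1n -[in (-1) ^+ m](subnK (leq_ord i)) exprD.
by rewrite -mulrA -expr2 sqrr_sign mulr1.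
Qed.

Lemma altmx_unit m : altmx m \in unitmx.
Proof.
suff /mulmx1_unit [] : altmx m *m ((-1) ^+ m *: altmx m) = 1%:M by [].
apply/matrixP => i j; rewrite mul_altmx !mxE rev_ordK eq_sym.
case: eqP => [->|_]; last by rewrite !mulr0.
rewrite /= subSS mulr1n -[in (-1) ^+ m](subnK (leq_ord j)) exprD.
by rewrite mulrAC -expr2 sqrr_sign mul1r -expr2 sqrr_sign.
Qed.

Lemma altmx_jordan_block m :
  (jordan_block m 0)^T *m altmx m = - (altmx m *m jordan_block m 0).
Proof.
apply/matrixP => i j; rewrite [RHS]mxE mul_altmx mul_mx_altmx !mxE /=.
rewrite !mul0rn !add0r !subSS.
have le_im := leq_ord i; have le_jm := leq_ord j.
case: (eqVneq (i + j)%N m.+1) => [def_m|neq_m].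
  have -> : (nat_of_ord i == (m - j).+1)%N by apply/eqP; lia.
  have -> : (nat_of_ord j == (m - i).+1)%N by apply/eqP; lia.
  have -> : nat_of_ord i = (m - j).+1 by lia.
  by rewrite mul1r mulr1 exprS mulN1r opprK.
have /negPf -> : (nat_of_ord i != (m - j).+1)%N by apply/eqP; lia.
have /negPf -> : (nat_of_ord j != (m - i).+1)%N by apply/eqP; lia.
by rewrite mul0r mulr0 oppr0.
Qed.

Lemma altmx_jordan_blockN m a :
  (jordan_block m a)^T *m altmx m = - (altmx m *m jordan_block m (- a)).
Proof.
rewrite [jordan_block m a]jordan_block0E [jordan_block m (- a)]jordan_block0E.
rewrite [(_ + _)^T]linearD /= tr_scalar_mx mulmxDl mulmxDr altmx_jordan_block.
by rewrite opprD raddfN /= mulmxN opprK scalar_mxC.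
Qed.

Lemma simmx_jordan_blockN m a :
  simmx (jordan_block m (- a)) (- (jordan_block m a)^T).
Proof.
have uH := altmx_unit m; set H := altmx m in uH *.
exists (invmx H), H; rewrite mulVmx // mulmxV //; split=> //.
suff -> : H *m jordan_block m (- a) = - (jordan_block m a)^T *m H.
  by rewrite mulmxK.
by rewrite mulNmx altmx_jordan_blockN opprK.
Qed.

End JordanBlocks.

(** * Complex matrices as real matrices *)

Section Realify.
Local Open Scope complex_scope.
Variable R : rcfType.
Local Notation C := R[i].
Implicit Types (z w : C) (x : R).

Local Notation Re := (@complex.Re R).
Local Notation Im := (@complex.Im R).

Lemma ReD z w : Re (z + w) = Re z + Re w. Proof. by case: z; case: w. Qed.
Lemma ImD z w : Im (z + w) = Im z + Im w. Proof. by case: z; case: w. Qed.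
Lemma ReM z w : Re (z * w) = Re z * Re w - Im z * Im w.
Proof. by case: z; case: w. Qed.
Lemma ImM z w : Im (z * w) = Im z * Re w + Re z * Im w.
Proof. by case: z => a b; case: w => c d /=; rewrite addrC. Qed.

Lemma map_ReM m n p (A : 'M[C]_(m, n)) (B : 'M[C]_(n, p)) :
  map_mx Re (A *m B) = map_mx Re A *m map_mx Re B - map_mx Im A *m map_mx Im B.
Proof.
apply/matrixP => i j; rewrite !mxE (big_morph _ ReD (erefl (Re 0))) -sumrB.
by apply: eq_bigr => k _; rewrite !mxE ReM.
Qed.

Lemma map_ImM m n p (A : 'M[C]_(m, n)) (B : 'M[C]_(n, p)) :
  map_mx Im (A *m B) = map_mx Im A *m map_mx Re B + map_mx Re A *m map_mx Im B.
Proof.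
apply/matrixP => i j; rewrite !mxE (big_morph _ ImD (erefl (Im 0))) -big_split.
by apply: eq_bigr => k _; rewrite !mxE ImM.
Qed.

Lemma realifyM n (A B : 'M[C]_n) : realify (A *m B) = realify A *m realify B.
Proof.
rewrite /realify mulmx_block map_ReM map_ImM !mulNmx !mulmxN opprD.
by congr block_mx; rewrite addrC.
Qed.

Lemma realifyD n (A B : 'M[C]_n) : realify (A + B) = realify A + realify B.
Proof.
rewrite /realify add_block_mx -opprD.
have -> : map_mx Re (A + B) = map_mx Re A + map_mx Re B.
  by apply/matrixP => i j; rewrite !mxE ReD.
by have -> : map_mx Im (A + B) = map_mx Im A + map_mx Im B;
  first by apply/matrixP => i j; rewrite !mxE ImD.
Qed.

Lemma realifyN n (A : 'M[C]_n) : realify (- A) = - realify A.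
Proof.
rewrite /realify opp_block_mx; congr block_mx; apply/matrixP => i j; rewrite !mxE;
  by case: (A i j).
Qed.

Lemma realify_scalar n x : realify (x%:C%:M : 'M[C]_n) = x%:M.
Proof.
rewrite /realify scalar_mx_block; congr block_mx; apply/matrixP => i j;
  by rewrite !mxE; case: eqP => //= _; rewrite ?oppr0.
Qed.

Lemma realify1 n : realify (1%:M : 'M[C]_n) = 1%:M.
Proof. exact: realify_scalar. Qed.

Lemma realify0 n : realify (0 : 'M[C]_n) = 0.
Proof. by rewrite -(subrr (0 : 'M[C]_n)) realifyD realifyN subrr. Qed.

Lemma realify_map_tr n (A : 'M[C]_n) :
  realify (map_mx conjc A)^T = (realify A)^T.
Proof.
rewrite /realify tr_block_mx; congr block_mx; apply/matrixP => i j; rewrite !mxE;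
  by case: (A j i) => a b //=; rewrite opprK.
Qed.

Lemma simmx_realify n (A B : 'M[C]_n) :
  simmx A B -> simmx (realify A) (realify B).
Proof.
move=> [P [Q [PQ QP <-]]]; exists (realify P), (realify Q).
by rewrite -!realifyM PQ QP realify1.
Qed.

Lemma realify_unit n (A : 'M[C]_n) : A \in unitmx -> realify A \in unitmx.
Proof.
move=> uA; suff /mulmx1_unit [] : realify A *m realify (invmx A) = 1%:M by [].
by rewrite -realifyM mulmxV // realify1.
Qed.

Lemma mxev_realify n (A : 'M[C]_n) (p : {poly R}) :
  mxev (realify A) p = realify (mxev A (map_poly (real_complex R) p)).
Proof.
elim/poly_ind: p => [|p c IH]; first by rewrite rmorph0 !mxev0 realify0.
rewrite rmorphD rmorphM /= map_polyX map_polyC !mxevD !mxevM !mxevX !mxevC.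
by rewrite realifyD realifyM IH realify_scalar.
Qed.

(** The real polynomial with roots [z] and its conjugate. *)
Definition quadp z : {poly R} :=
  'X^2 - (Re z + Re z) *: 'X + (Re z ^+ 2 + Im z ^+ 2)%:P.

Lemma map_quadp z :
  map_poly (real_complex R) (quadp z) = ('X - z%:P) * ('X - (conjc z)%:P).
Proof.
rewrite /quadp rmorphD rmorphB /= map_polyXn map_polyZ /= map_polyX map_polyC /=.
have -> : (Re z + Re z)%:C = z + conjc z by case: z => a b; simpc.
have -> : (Re z ^+ 2 + Im z ^+ 2)%:C = z * conjc z.
  by case: z => a b; simpc; rewrite -!expr2; congr (_ +i* _); ring.
rewrite polyCM -mul_polyC polyCD; ring.
Qed.

Lemma quadp_comp_oppX z : quadp z \Po (- 'X) = quadp (- (conjc z)).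
Proof.
rewrite /quadp comp_polyD comp_polyB comp_polyZ expr2 comp_polyM comp_polyX comp_polyC.
case: z => a b; rewrite /= mulrNN sqrrN opprK -opprD scaleNr scalerN !opprK.
by congr (_ + _); rewrite addrC.
Qed.

Lemma quadp_root z x : Im z != 0 -> ~~ root (quadp z) x.
Proof.
move=> z_n0; rewrite /root.
have -> : (quadp z).[x] = (x - Re z) ^+ 2 + Im z ^+ 2.
  by rewrite /quadp !hornerE /=; ring.
by rewrite gt_eqF // ltr_wpDl ?sqr_ge0 // lt_neqAle sqr_ge0 eq_sym expf_neq0.
Qed.

Lemma coprime_quadp_XsubC z x : Im z != 0 -> coprimep (quadp z) ('X - x%:P).
Proof. by move=> z_n0; rewrite coprimep_XsubC quadp_root. Qed.

Lemma coprime_quadp z w :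
  0 < Im z -> 0 < Im w -> z != w -> coprimep (quadp z) (quadp w).
Proof.
move=> z_gt0 w_gt0 neq_zw; rewrite -(coprimep_map (real_complex R)) !map_quadp.
rewrite !coprimepMl !coprimepMr !coprimep_XsubC !root_XsubC.
have neqJ u v : 0 < Im u -> 0 < Im v -> u != conjc v.
  case: u v => [a b] [c d] /= b_gt0 d_gt0; rewrite eq_complex negb_and /=.
  by rewrite [b == _]gt_eqF ?orbT // (lt_trans _ b_gt0) // oppr_lt0.
rewrite neqJ // [conjc w == z]eq_sym neqJ // [w == z]eq_sym neq_zw.
by rewrite (can_eq (@conjcK R)) eq_sym neq_zw.
Qed.

Lemma realify_jordan_block_annihilated m z :
  mxev (realify (jordan_block m z)) (quadp z ^+ m.+1) = 0.
Proof.
rewrite mxev_realify rmorphXn /= map_quadp exprMn. 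
rewrite mxevM.
by rewrite jordan_block_annihilated mul0mx realify0.
Qed.

Lemma realify_real n (A : 'M[C]_n) :
  map_mx Im A = 0 -> realify A = dsum (map_mx Re A) (map_mx Re A).
Proof. by rewrite /realify => ->; rewrite oppr0. Qed.

Lemma map_Re_jordan_block m z : map_mx Re (jordan_block m z) = jordan_block m (Re z).
Proof.
apply/matrixP => i j; rewrite !mxE; case: z => a b.
by case: (i == j); case: (nat_of_ord j == _); rewrite ?mulr1n ?mulr0n ?addr0 ?add0r.
Qed.

Lemma realify_jordan_block_real m x :
  realify (jordan_block m x%:C) = dsum (jordan_block m x) (jordan_block m x).
Proof.
rewrite realify_real ?map_Re_jordan_block //.
apply/matrixP => i j; rewrite !mxE.
by case: (i == j); case: (nat_of_ord j == _); rewrite ?mulr1n ?mulr0n /= ?addr0.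
Qed.

Lemma map_conj_jordan_block m z :
  map_mx conjc (jordan_block m z) = jordan_block m (conjc z).
Proof.
apply/matrixP => i j; rewrite !mxE rmorphD /= rmorphMn /=.
by congr (_ + _); case: (_ == _); rewrite ?conjc1 ?conjc0.
Qed.

Lemma conj_neq z : Im z != 0 -> conjc z != z.
Proof.
case: z => a b /= b_n0; rewrite eq_complex /= eqxx /= eq_sym -subr_eq0 opprK.
by rewrite -mulr2n mulrn_eq0.
Qed.

(** The factor of [quadp z] at the conjugate root is invertible on the complex
    block, so that [quadp z] has the rank of two copies of the nilpotent real
    block. *)
Lemma kdim_realify_jordan_block m z j : Im z != 0 ->
  kdim (realify (jordan_block m z)) (quadp z ^+ j) = (2 * minn j m.+1)%N.
Proof.
move=> z_n0; apply: (@rank_nilpotent_exp _ _ _ _ _ m).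
- by rewrite mul2n addnn.
- exact: realify_jordan_block_annihilated.
rewrite mxev_realify map_quadp mulrC mxevM realifyM.
have unitJ : mxev (jordan_block m z) ('X - (conjc z)%:P) \in unitmx.
  rewrite -row_free_unit -row_leq_rank -subn_eq0.
  have := @kdim_jordan_block_neq _ m z (conjc z) 1; rewrite /kdim expr1 => -> //.
  by rewrite eq_sym conj_neq.
have fuJ : row_full (realify (mxev (jordan_block m z) ('X - (conjc z)%:P))).
  by rewrite row_full_unit realify_unit.
rewrite (eqmxMfull _ fuJ) mxevB mxevX mxevC jordan_block0E addrC addKr.
rewrite -[0 : C]/((0 : R)%:C) realify_jordan_block_real rank_diag_block_mx.
by rewrite mul2n -addnn leq_add // jordan_block_rank.
Qed.

Lemma simmx_realify_jordan_blockN m z :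
  simmx (- (realify (jordan_block m z))^T) (realify (jordan_block m (- (conjc z)))).
Proof.
rewrite -realify_map_tr.
rewrite map_conj_jordan_block.
by rewrite -realifyN; apply/simmx_realify/simmx_sym/simmx_jordan_blockN.
Qed.

End Realify.

Section KernelOfJordanType.
Local Open Scope complex_scope.
Variable R : rcfType.
Implicit Types (s : jsymbol R) (t : seq (jsymbol R)) (x : R)
  (z : {z : R[i] | 0 < complex.Im z}).

(** The contribution of one block to the dimension of the kernel of
    [(D - x)^j], and below to that of the [j]-th power of [quadp z] at [D]. *)
Definition rkdim s x j : nat :=
  match s with inl (m, a) => ((a == x) * minn j m.+1)%N | inr _ => 0%N end.
Definition ckdim s z j : nat :=
  match s with inl _ => 0%N | inr (m, w) => ((w == z) * (2 * minn j m.+1))%N end.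

Lemma kdim_jordan_mx t p :
  kdim (jordan_mx t) p = (\sum_(s <- t) kdim (jsymbol_mx s) p)%N.
Proof.
elim: t => [|s t IH].
  rewrite big_nil /kdim; set M := mxev _ _; have := rank_leq_row M.
  by rewrite [X in (_ <= X)%N]big_ord0 [X in (X - _)%N]big_ord0.
by rewrite big_cons (kdim_sim _ (jordan_mx_cons _ _)) kdim_dsum IH.
Qed.

Lemma rkdimE s x j : kdim (jsymbol_mx s) (('X - x%:P) ^+ j) = rkdim s x j.
Proof.
case: s => [[m a]|[m z]] /=.
  case: eqP => [->|/eqP neq_ax]; rewrite ?mul1n ?mul0n ?kdim_jordan_block //.
  exact: kdim_jordan_block_neq.
apply: kdim_coprime (realify_jordan_block_annihilated m (val z)) _.
rewrite coprimep_expl // coprimep_expr // coprimep_sym coprime_quadp_XsubC //.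
by rewrite gt_eqF // (valP z).
Qed.

Lemma ckdimE s z j : kdim (jsymbol_mx s) (quadp (val z) ^+ j) = ckdim s z j.
Proof.
have z_n0 : complex.Im (val z) != 0 by rewrite gt_eqF // (valP z).
case: s => [[m a]|[m w]] /=.
  apply: kdim_coprime (jordan_block_annihilated m a) _.
  by rewrite coprimep_expl // coprimep_expr // coprime_quadp_XsubC.
case: eqP => [->|/eqP neq_wz]; rewrite ?mul1n ?mul0n ?kdim_realify_jordan_block //.
apply: kdim_coprime (realify_jordan_block_annihilated m (val w)) _.
rewrite coprimep_expl // coprimep_expr // coprime_quadp ?(valP z) ?(valP w) //.
by rewrite eq_sym.
Qed.

End KernelOfJordanType.

(** * Existence of the real Jordan form *)

Section Splitting.
Local Open Scope complex_scope.
Variable F : fieldType.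

(** The kernel of [Q] is an invariant complement to the image of [P]. *)
Lemma split_invariant n s (D : 'M[F]_n) (P : 'M[F]_(n, s)) (Q : 'M[F]_(s, n))
    (A A' : 'M[F]_s) :
  D *m P = P *m A -> Q *m D = A' *m Q -> Q *m P \in unitmx ->
  exists r (D' : 'M[F]_r), simmx D (dsum A D').
Proof.
move=> DP QD uG; set G := Q *m P in uG; pose E := P *m invmx G *m Q.
have QE : Q *m (1%:M - E) = 0.
  by rewrite mulmxBr mulmx1 !mulmxA -/G mulmxV // mul1mx subrr.
have EP : (1%:M - E) *m P = 0.
  by rewrite mulmxBl mul1mx -!mulmxA -/G mulVmx // mulmx1 subrr.
have idem : (1%:M - E) *m (1%:M - E) = 1%:M - E.
  by rewrite {1}mulmxBl mul1mx -(mulmxA _ Q) QE mulmx0 subr0.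
have [r [L [M [LM fuL fM]]]] : exists r (L : 'M_(n, r)) (M : 'M_(r, n)),
    [/\ L *m M = 1%:M - E, row_full L & row_free M].
  exists (\rank (1%:M - E)), (col_base (1%:M - E)), (row_base (1%:M - E)).
  by rewrite mulmx_base col_base_full row_base_free.
have ML : M *m L = 1%:M.
  apply: (row_free_inj fM); rewrite mul1mx; apply: (row_full_inj fuL).
  by rewrite !mulmxA LM -mulmxA LM idem.
have QL : Q *m L = 0.
  by apply: (row_free_inj fM); rewrite mul0mx -mulmxA LM.
have MP : M *m P = 0.
  by apply: (row_full_inj fuL); rewrite mulmx0 mulmxA LM.
exists _, (M *m D *m L), (row_mx P L), (col_mx (invmx G *m Q) M); split.
- by rewrite mul_row_col LM mulmxA addrC subrK.
- rewrite mul_col_row ML MP -!mulmxA QL mulmx0 -/G mulVmx //.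
  by rewrite [RHS]scalar_mx_block.
- rewrite mul_col_mx mul_col_row /dsum; congr block_mx.
  + by rewrite -!mulmxA DP (mulmxA Q) -/G mulmxA mulVmx // mul1mx.
  + by rewrite -!mulmxA (mulmxA Q) QD -mulmxA QL !mulmx0.
  + by rewrite -mulmxA DP mulmxA MP mul0mx.
Qed.

End Splitting.

Section JordanChains.
Local Open Scope complex_scope.
Variable F : fieldType.

Lemma mul_mx_shift m n (A : 'M[F]_(n, m.+1)) i j :
  (A *m jordan_block m 0) i j =
  if nat_of_ord j is j'.+1 then A i (inord j') else 0.
Proof.
rewrite mxE; case def_j: (nat_of_ord j) => [|j'].
  by rewrite big1 // => k _; rewrite !mxE def_j mul0rn add0r mulr0.
have lt_j' : (j' < m.+1)%N by rewrite -ltnS -def_j ltnS ltnW.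
rewrite (bigD1 (inord j')) //= big1 ?addr0 => [|k neq_k].
  by rewrite mxE mul0rn add0r inordK // def_j eqxx mulr1.
rewrite mxE mul0rn add0r def_j eqSS; case: eqP => [ej|]; last by rewrite mulr0.
by case/eqP: neq_k; apply: val_inj; rewrite /= inordK.
Qed.

Lemma mul_shift_mx m n (A : 'M[F]_(m.+1, n)) i j :
  (jordan_block m 0 *m A) i j =
  if (i < m)%N then A (inord i.+1) j else 0.
Proof.
rewrite mxE; case: ltnP => [lt_im|le_mi].
  rewrite (bigD1 (inord i.+1)) //= big1 ?addr0 => [|k neq_k].
    by rewrite mxE mul0rn add0r inordK // eqxx mul1r.
  rewrite mxE mul0rn add0r; case: eqP => [ek|]; last by rewrite mul0r.
  by case/eqP: neq_k; apply: val_inj; rewrite /= inordK.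
rewrite big1 // => k _; rewrite mxE mul0rn add0r ltn_eqF ?mul0r //.
by have := ltn_ord k; lia.
Qed.

Variables (n : nat) (D : 'M[F]_n) (z : F).
Local Notation q := ('X - z%:P).

Definition chain_mx m (v : 'cV[F]_n) : 'M[F]_(n, m.+1) :=
  \matrix_(i, j) (mxev D (q ^+ (m - j)) *m v) i 0.
Definition cochain_mx m (phi : 'rV[F]_n) : 'M[F]_(m.+1, n) :=
  \matrix_(i, j) (phi *m mxev D (q ^+ i)) 0 j.

Lemma chain_mxP m v : mxev D (q ^+ m.+1) *m v = 0 ->
  D *m chain_mx m v = chain_mx m v *m jordan_block m z.
Proof.
move=> v0; suff qP : mxev D q *m chain_mx m v = chain_mx m v *m jordan_block m 0.
  rewrite jordan_block0E mulmxDr -qP mxevB mxevX mxevC mulmxBl scalar_mxC.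
  by rewrite addrCA subrr addr0.
apply/matrixP => i j; rewrite mul_mx_shift.
have -> : (mxev D q *m chain_mx m v) i j = (mxev D (q ^+ (m - j).+1) *m v) i 0.
  rewrite exprS mxevM -mulmxA !mxE; apply: eq_bigr => k _.
  by rewrite mxE.
case def_j: (nat_of_ord j) => [|j']; first by rewrite subn0 v0 mxE.
have lt_j' : (j' < m.+1)%N by rewrite -ltnS -def_j ltnS ltnW.
by rewrite [RHS]mxE inordK // subnSK // -ltnS -def_j.
Qed.

Lemma cochain_mxP m phi : phi *m mxev D (q ^+ m.+1) = 0 ->
  cochain_mx m phi *m D = jordan_block m z *m cochain_mx m phi.
Proof.
move=> phi0.
suff qP : cochain_mx m phi *m mxev D q = jordan_block m 0 *m cochain_mx m phi.
  rewrite jordan_block0E mulmxDl -qP mxevB mxevX mxevC mulmxBr scalar_mxC.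
  by rewrite addrCA subrr addr0.
apply/matrixP => i j; rewrite mul_shift_mx.
have -> : (cochain_mx m phi *m mxev D q) i j = (phi *m mxev D (q ^+ i.+1)) 0 j.
  rewrite exprSr mxevM mulmxA [LHS]mxE [RHS]mxE; apply: eq_bigr => k _.
  by rewrite mxE.
case: ltnP => [lt_im|le_mi]; first by rewrite [RHS]mxE inordK.
have -> : nat_of_ord i = m by have := ltn_ord i; lia.
by rewrite phi0 mxE.
Qed.

Lemma mul_cochain_chain m v phi i j :
  (cochain_mx m phi *m chain_mx m v) i j =
  (phi *m mxev D (q ^+ (i + (m - j))) *m v) 0 0.
Proof.
rewrite exprD mxevM -mulmxA -[in RHS]mulmxA (mulmxA phi) mxE [RHS]mxE.
by apply: eq_bigr => k _; rewrite !mxE.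
Qed.

(** The Gram matrix of the two chains is upper triangular with constant nonzero
    diagonal, because [q(D)^m.+1] kills [v]. *)
Lemma cochain_chain_unit m v phi : mxev D (q ^+ m.+1) *m v = 0 ->
  phi *m mxev D (q ^+ m) *m v != 0 ->
  cochain_mx m phi *m chain_mx m v \in unitmx.
Proof.
move=> v0 nz; rewrite -unitmx_tr unitmxE det_trig; last first.
  apply/is_trig_mxP => i j lt_ij; rewrite mxE mul_cochain_chain.
  have -> : (j + (m - i) = (j - i.+1) + m.+1)%N by have := ltn_ord i; lia.
  by rewrite exprD mxevM -!mulmxA v0 !mulmx0 mxE.
rewrite unitfE prodf_seq_neq0; apply/allP => i _; rewrite /= mxE mul_cochain_chain.
rewrite subnKC ?leq_ord //; apply: contraNneq nz => nz0.
by apply/eqP/matrixP => a b; rewrite !ord1 nz0 mxE.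
Qed.

(** With [m.+1] the multiplicity of [z] in the minimal polynomial
    [q ^+ m.+1 * r], the square of [r] does not make up for a missing factor
    [q], so some entry of [r(D) q(D)^m r(D)] is nonzero; its row and column
    provide [phi] and [v]. *)
Lemma jordan_chain_exists : root (char_poly D) z ->
  exists m (v : 'cV[F]_n) (phi : 'rV[F]_n),
    [/\ mxev D (q ^+ m.+1) *m v = 0, phi *m mxev D (q ^+ m.+1) = 0 &
        phi *m mxev D (q ^+ m) *m v != 0].
Proof.
case: n D => [|n'] A.
  by rewrite /char_poly det_mx00 rootC oner_eq0.
rewrite -root_mxminpoly => rz.
have [k [r]] := multiplicity_XsubC (mxminpoly A) z.
have mp0 := monic_neq0 (mxminpoly_monic A); rewrite mp0 /= => nrz def_mp.
case: k => [|m] in def_mp *.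
  by rewrite def_mp expr0 mulr1 (negPf nrz) in rz.
have r0 : mxev A (r * q ^+ m.+1) = 0 by rewrite -def_mp; apply: mx_root_minpoly.
have nz : mxev A (r * q ^+ m * r) != 0.
  have rn0 : r != 0 by apply: contraNneq nrz => ->; rewrite root0.
  have qn0 : q ^+ m != 0 by rewrite expf_neq0 // polyXsubC_eq0.
  apply/eqP => /mxminpoly_min; rewrite def_mp -mulrA dvdp_mul2l // exprSr.
  by rewrite dvdp_mul2l // dvdp_XsubCl (negPf nrz).
have /matrix0Pn [i [j nz_ij]] := nz.
exists m, (mxev A r *m delta_mx j 0), (delta_mx 0 i *m mxev A r); split.
- by rewrite mulmxA -mxevM mulrC r0 mul0mx.
- by rewrite -mulmxA -mxevM r0 mulmx0.
- apply: contraNneq nz_ij => /matrixP /(_ 0 0).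
  rewrite mulmxA -!(mulmxA (delta_mx 0 i)) -!mxevM -rowE -colE !mxE => ->.
  exact: eqxx.
Qed.
End JordanChains.

Section RealJordanForm.
Local Open Scope complex_scope.
Variable R : rcfType.
Local Notation C := R[i].
Local Notation Re := (@complex.Re R).
Local Notation Im := (@complex.Im R).
Local Notation toC := (map_mx (real_complex R)).

Lemma kdim0_unit (F : fieldType) n (A : 'M[F]_n) p :
  kdim A p = 0%N -> mxev A p \in unitmx.
Proof.
move=> /eqP; rewrite subn_eq0 -row_free_unit => le_n.
by rewrite /row_free eqn_leq rank_leq_row le_n.
Qed.

Lemma map_conj_toC m n (A : 'M[R]_(m, n)) : map_mx conjc (toC A) = toC A.
Proof. by apply/matrixP => i j; rewrite !mxE conjc_real. Qed.

Lemma map_Re_toC m n (A : 'M[R]_(m, n)) : map_mx Re (toC A) = A.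
Proof. by apply/matrixP => i j; rewrite !mxE. Qed.

Lemma map_Im_toC m n (A : 'M[R]_(m, n)) : map_mx Im (toC A) = 0.
Proof. by apply/matrixP => i j; rewrite !mxE. Qed.

Lemma map_Re0 m n : map_mx Re (0 : 'M[C]_(m, n)) = 0.
Proof. by apply/matrixP => i j; rewrite !mxE. Qed.

Lemma map_Im0 m n : map_mx Im (0 : 'M[C]_(m, n)) = 0.
Proof. by apply/matrixP => i j; rewrite !mxE. Qed.

Lemma map_Re_conj m n (A : 'M[C]_(m, n)) : map_mx Re (map_mx conjc A) = map_mx Re A.
Proof. by apply/matrixP => i j; rewrite !mxE; case: (A i j). Qed.

Lemma map_Im_conj m n (A : 'M[C]_(m, n)) : map_mx Im (map_mx conjc A) = - map_mx Im A.
Proof. by apply/matrixP => i j; rewrite !mxE; case: (A i j). Qed.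

(** A complex Jordan chain of the real matrix [D] and its conjugate together
    span the complexification of a real invariant subspace. The pairing between
    the cochain and the conjugate chain vanishes, because [p] separates [J] from
    its conjugate; so the real Gram matrix is half the realification of the
    complex one. *)
Lemma split_complex_chain n s (D : 'M[R]_n) (J : 'M[C]_s) (p : {poly C})
    (P : 'M[C]_(n, s)) (Q : 'M[C]_(s, n)) :
  toC D *m P = P *m J -> Q *m toC D = J *m Q -> Q *m P \in unitmx ->
  mxev J p = 0 -> mxev (map_mx conjc J) p \in unitmx ->
  exists r (D' : 'M[R]_r), simmx D (dsum (realify J) D').
Proof.
move=> DP QD uG pJ0 upJ.
(* The product intertwines [J] with its conjugate; [p] kills the former and is
   invertible on the latter. *)
have QPc : Q *m map_mx conjc P = 0.
  have /mxev_inter - /(_ p) : J *m (Q *m map_mx conjc P) =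
      (Q *m map_mx conjc P) *m map_mx conjc J.
    rewrite mulmxA -QD -!mulmxA; congr (_ *m _).
    by rewrite -map_mxM -DP map_mxM map_conj_toC.
  by rewrite pJ0 mul0mx => /esym /(canRL (mulmxK upJ)); rewrite mul0mx.
have := congr1 (map_mx Re) QPc; have := congr1 (map_mx Im) QPc.
rewrite map_ReM map_ImM map_Re_conj map_Im_conj !mulmxN opprK.
rewrite map_Re0 map_Im0.
move=> ImQPc ReQPc.
apply: (@split_invariant _ _ _ D (row_mx (map_mx Re P) (- map_mx Im P))
  (col_mx (map_mx Re Q) (map_mx Im Q)) (realify J) (realify J)).
- have := congr1 (map_mx Re) DP; have := congr1 (map_mx Im) DP.
  rewrite !map_ReM !map_ImM map_Re_toC map_Im_toC !mul0mx subr0 add0r => eI eR.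
  rewrite mul_mx_row /realify mul_row_block mulmxN eI eR.
  by rewrite !mulNmx !mulmxN opprD [X in row_mx _ X]addrC.
- have := congr1 (map_mx Re) QD; have := congr1 (map_mx Im) QD.
  rewrite !map_ReM !map_ImM map_Re_toC map_Im_toC !mulmx0 subr0 addr0 => eI eR.
  rewrite mul_col_mx /realify mul_block_col eI eR mulNmx.
  by congr col_mx; rewrite addrC.
- suff -> : col_mx (map_mx Re Q) (map_mx Im Q) *m
      row_mx (map_mx Re P) (- map_mx Im P) = 2^-1 *: realify (Q *m P).
    by rewrite unitmxZ ?realify_unit // unitfE invr_eq0 pnatr_eq0.
  rewrite mul_col_row /realify scale_block_mx map_ReM map_ImM !mulmxN.
  move: ImQPc ReQPc.
  move: (map_mx Re Q *m _) (map_mx Im Q *m map_mx Im P) (map_mx Re Q *m map_mx Im P)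
    (map_mx Im Q *m map_mx Re P) => a b c d /eqP; rewrite subr_eq0 => /eqP ->.
  move=> /eqP; rewrite addr_eq0 => /eqP ->.
  have half (u : 'M[R]_s) : 2^-1 *: (u + u) = u.
    by rewrite -mulr2n -scaler_nat scalerA mulVf ?pnatr_eq0 // scale1r.
  by rewrite -opprD !scalerN !half.
Qed.

Lemma split_jordan_block n (D : 'M[R]_n) : (0 < n)%N ->
  exists (s : jsymbol R) r (D' : 'M[R]_r), simmx D (dsum (jsymbol_mx s) D').
Proof.
move=> n_gt0.
have /closed_rootP [z rz] : size (char_poly (toC D)) != 1%N.
  by rewrite size_char_poly; case: (n) n_gt0.
rewrite -map_char_poly in rz.
have {z rz} [z z_ge0 rz] : exists2 z, 0 <= Im z &
    root (map_poly (real_complex R) (char_poly D)) z.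
  have [le0|lt0] := leP 0 (Im z); first by exists z.
  (* The characteristic polynomial is real, so its roots come in conjugate pairs. *)
  exists (conjc z); first by case: z lt0 {rz} => a b /=; rewrite oppr_ge0 => /ltW.
  rewrite -complex_root_conj; congr (root _ z): rz.
  by rewrite -map_poly_comp; apply: eq_map_poly => x; rewrite -[LHS]conjc_real.
have [z_real|z_n0] := eqVneq (Im z) 0.
  have def_z : z = (Re z)%:C by case: z z_real {z_ge0 rz} => a b /= ->.
  rewrite def_z fmorph_root in rz.
  have [m [v [phi [v0 phi0 nz]]]] := jordan_chain_exists rz.
  exists (Jsym m (Re z)); apply: split_invariant (chain_mxP v0) (cochain_mxP phi0) _.
  exact: cochain_chain_unit.
have z_gt0 : 0 < Im z by rewrite lt_def z_n0.
rewrite map_char_poly in rz.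
have [m [v [phi [v0 phi0 nz]]]] := jordan_chain_exists rz.
exists (inr (m, exist _ z z_gt0)).
apply: split_complex_chain (chain_mxP v0) (cochain_mxP phi0) _
  (jordan_block_annihilated m z) _; first exact: cochain_chain_unit.
apply: kdim0_unit; rewrite map_conj_jordan_block kdim_jordan_block_neq //.
by rewrite conj_neq.
Qed.

(** The complement of a block is smaller, so blocks can be split off until
    nothing is left. *)
Lemma real_jordan_form n (D : 'M[R]_n) :
  exists t : seq (jsymbol R), simmx D (jordan_mx t).
Proof.
have [k] := ubnP n; elim: k n D => // k IH n D lt_nk.
case: (posnP n) => [n0|n_gt0].
  by subst n; exists [::]; apply: jordan_mx_nil.
have [s [r [D' sD]]] := split_jordan_block D n_gt0.
have [|t st] := IH r D'.
  have def_n := simmx_size sD; apply: leq_trans (lt_nk : (n <= k)%N).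
  by rewrite def_n -add1n leq_add2r; case: (s) => - [].
exists (s :: t); apply: simmx_trans sD _.
apply: simmx_trans (simmx_sym (jordan_mx_cons _ _)).
by apply: simmx_dsum st; apply: simmx_refl.
Qed.

End RealJordanForm.

Local Open Scope mset_scope.

(** * Multisets of Jordan blocks *)

Section JordanMultisets.
Variable R : rcfType.
Local Notation upper := {z : R[i] | 0 < complex.Im z}.
Implicit Types (T q : {mset jsymbol R}) (t : seq (jsymbol R)) (x : R) (z : upper).

Definition Usym m z : jsymbol R := inr (m, z).

Fact oppconj_upper z : 0 < complex.Im (- conjc (val z)).
Proof. by case: z => - [a b] /= hb; rewrite opprK. Qed.

(** Reflection in the imaginary axis, which preserves the upper half-plane. *)
Definition oppconj z : upper := exist _ (- conjc (val z)) (oppconj_upper z).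

Lemma oppconjK : involutive oppconj.
Proof. by move=> z; apply: val_inj; rewrite /= rmorphN /= opprK conjcK. Qed.

Lemma oppconj_fix z : complex.Re (val z) = 0 -> oppconj z = z.
Proof.
move=> z0; apply/val_inj/eqP; case: z z0 => - [a b] hb /= a0.
by rewrite eq_complex /= a0 oppr0 opprK !eqxx.
Qed.

Lemma Im_upper_neq0 z : complex.Im (val z) != 0.
Proof. by rewrite gt_eqF // (valP z). Qed.

Lemma Csym_upper m (w : R[i]) (hw : complex.Im w != 0) z :
  complex.Re w = complex.Re (val z) -> `|complex.Im w| = complex.Im (val z) ->
  Csym m hw = Usym m z.
Proof.
move=> eR eI; congr (inr (_, _)); apply: val_inj.
by case: z eR eI => - [a b] hb /= -> ->.
Qed.

Lemma Csym_val m z : Csym m (Im_upper_neq0 z) = Usym m z.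
Proof. by apply: Csym_upper => //; rewrite gtr0_norm // (valP z). Qed.

Lemma Csym_oppconj m z : Csym m (oppconj_nonreal (Im_upper_neq0 z)) = Usym m (oppconj z).
Proof. by apply: Csym_upper => //; rewrite gtr0_norm // oppconj_upper. Qed.

Lemma eq_Jsym m n x y : (Jsym m x == Jsym n y) = (m == n) && (x == y).
Proof. by []. Qed.

Lemma eq_Usym m n z w : (Usym m z == Usym n w) = (m == n) && (z == w).
Proof. by []. Qed.

Lemma eq_JUsym m n x z : ((Jsym m x == Usym n z) = false) * ((Usym n z == Jsym m x) = false).
Proof. by []. Qed.

Lemma seq_mset_cat t1 t2 : seq_mset (t1 ++ t2) = seq_mset t1 `+` seq_mset t2.
Proof. by apply/msetP => s; rewrite msetE2 !mset_seqE count_cat. Qed.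

Lemma size_msetD T1 T2 : size (T1 `+` T2) = (size T1 + size T2)%N.
Proof.
rewrite -{1}(seq_mset_id T1) -{1}(seq_mset_id T2) -seq_mset_cat.
by rewrite (perm_size (perm_eq_seq_mset _)) size_cat.
Qed.

(** Conditions on the multiplicities that ensure [in_Q], see [in_Q_symmetric]. *)
Record Q_symmetric T : Prop := QSymmetric {
  Q_even : forall m x, ~~ odd (T (Jsym m x));
  Q_opp : forall m x, T (Jsym m (- x)) = T (Jsym m x);
  Q_oppconj : forall m z, T (Usym m (oppconj z)) = T (Usym m z)
}.

Lemma Q_symmetricB T q : q `<=` T -> Q_symmetric T -> Q_symmetric q ->
  Q_symmetric (T `\` q).
Proof.
move=> /msubsetP le_qT [Te To Tc] [qe qo qc]; split=> [m x|m x|m z].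
- by rewrite msetE2 oddB // negb_add (negPf (Te m x)) (negPf (qe m x)).
- by rewrite !msetE2 To qo.
- by rewrite !msetE2 Tc qc.
Qed.

(** Peel off the generator through any symbol of the multiset. *)
Lemma in_Q_symmetric T : Q_symmetric T -> in_Q T.
Proof.
have [k] := ubnP (size T); elim: k T => // k IH T lt_Tk symT.
have [->|T0] := eqVneq T mset0; first exact: Q_0.
suff [q [q_gen q_gt0 symq le_qT]] :
    exists q, [/\ Q_generator q, (0 < size q)%N, Q_symmetric q & q `<=` T].
  rewrite -(msetBDKC le_qT); apply: Q_add (Q_gen q_gen) (IH _ _ _).
    by rewrite -(msetBDKC le_qT) size_msetD in lt_Tk; lia.
  exact: Q_symmetricB.
have [s s_in] : exists s, s \in T.
  by move: T0; rewrite -size_mset_eq0; case def_T: (enum_mset T) => [|s u] // _;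
    exists s; rewrite in_mset -count_mem_mset def_T /= eqxx.
have sizen n s' : size (msetn n s' : {mset jsymbol R}) = n.
  by rewrite enum_msetn size_nseq.
have {s_in} Ts_gt0 : (0 < T s)%N by rewrite -in_mset.
case: symT => Te To Tc; case: s Ts_gt0 => [[m x]|[m z]].
  rewrite -[inl _]/(Jsym m x) => Ts_gt0.
  have Ts_gt1 : (1 < T (Jsym m x))%N by have := Te m x; case: (T _) Ts_gt0 => [|[]].
  have [x0|x0] := eqVneq x 0.
    exists (msetn 2 (Jsym m 0)); rewrite sizen; split=> //; first exact: Qgen_zero.
      split=> [n y|n y|n z]; rewrite !msetnE ?eq_JUsym //; first by case: ifP.
      by rewrite !eq_Jsym oppr_eq0.
    apply/msubsetP => s; rewrite msetnE; case: eqP => // ->.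
    by rewrite -x0.
  exists (msetn 2 (Jsym m x) `+` msetn 2 (Jsym m (- x))).
  rewrite size_msetD !sizen; split=> //; first exact: Qgen_real.
    split=> [n y|n y|n z]; rewrite !msetE2 !msetnE ?eq_JUsym //.
      by do 2!case: ifP.
    by rewrite !eq_Jsym eqr_opp eqr_oppLR addnC.
  apply/msubsetP => s; rewrite msetE2 !msetnE.
  have neq : Jsym m x == Jsym m (- x) = false.
    by rewrite eq_Jsym eqxx -subr_eq0 opprK -mulr2n mulrn_eq0 (negPf x0).
  case: eqP => [->|_]; first by rewrite neq addn0.
  by rewrite add0n; case: eqP => // ->; rewrite To.
rewrite -[inr _]/(Usym m z) => Ts_gt0.
have [z0|z0] := eqVneq (complex.Re (val z)) 0.
  exists [mset Usym m z]; rewrite sizen; split=> //.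
  - by rewrite -Csym_val; apply: Qgen_imag.
  - split=> [n y|n y|n w]; rewrite !msetnE ?eq_JUsym //.
    by rewrite !eq_Usym -(inj_eq (can_inj oppconjK)) oppconjK (oppconj_fix z0).
  - by apply/msubsetP => s; rewrite msetnE; case: eqP => // ->.
exists ([mset Usym m z] `+` [mset Usym m (oppconj z)]).
rewrite size_msetD !sizen; split=> //.
- by rewrite -Csym_val -Csym_oppconj; apply: Qgen_cplx.
- split=> [n y|n y|n w]; rewrite !msetE2 !msetnE ?eq_JUsym //.
  by rewrite !eq_Usym -(inj_eq (can_inj oppconjK)) oppconjK
    (inj_eq (can_inj oppconjK)) addnC.
apply/msubsetP => s; rewrite msetE2 !msetnE.
have neq : Usym m z == Usym m (oppconj z) = false.
  rewrite eq_Usym eqxx /= -val_eqE /=; case: (z) z0 => - [a b] hb /= a0.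
  by rewrite eq_complex /= -addr_eq0 -mulr2n mulrn_eq0 (negPf a0).
case: eqP => [->|_]; first by rewrite neq addn0.
by rewrite add0n; case: eqP => // ->; rewrite Tc.
Qed.

Definition rk t x j := (\sum_(s <- t) rkdim s x j)%N.
Definition ck t z j := (\sum_(s <- t) ckdim s z j)%N.

Lemma kdim_rk t n (D : 'M[R]_n) x j : simmx D (jordan_mx t) ->
  kdim D (('X - x%:P) ^+ j) = rk t x j.
Proof.
move=> /kdim_sim ->; rewrite kdim_jordan_mx.
by apply: eq_bigr => s _; rewrite rkdimE.
Qed.

Lemma kdim_ck t n (D : 'M[R]_n) z j : simmx D (jordan_mx t) ->
  kdim D (quadp (val z) ^+ j) = ck t z j.
Proof.
move=> /kdim_sim ->; rewrite kdim_jordan_mx.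
by apply: eq_bigr => s _; rewrite ckdimE.
Qed.

(** The number of blocks of a given size is minus the second difference of the
    kernel dimensions. *)
Lemma mult_Jsym t m x :
  (seq_mset t (Jsym m x) + rk t x m + rk t x m.+2 = 2 * rk t x m.+1)%N.
Proof.
rewrite mset_seqE /rk; elim: t => [|s t IH]; first by rewrite !big_nil.
rewrite !big_cons -[count_mem _ _]/((s == Jsym m x) + count_mem _ t)%N.
suff : ((s == Jsym m x) + rkdim s x m + rkdim s x m.+2 = 2 * rkdim s x m.+1)%N by lia.
case: s => [[n y]|[n w]] //=; rewrite -[inl _]/(Jsym n y) eq_Jsym.
by case: (y == x); rewrite ?andbT ?andbF; lia.
Qed.

Lemma mult_Usym t m z :
  (2 * seq_mset t (Usym m z) + ck t z m + ck t z m.+2 = 2 * ck t z m.+1)%N.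
Proof.
rewrite mset_seqE /ck; elim: t => [|s t IH]; first by rewrite !big_nil.
rewrite !big_cons -[count_mem _ _]/((s == Usym m z) + count_mem _ t)%N.
suff : (2 * (s == Usym m z) + ckdim s z m + ckdim s z m.+2 = 2 * ckdim s z m.+1)%N.
  by lia.
case: s => [[n y]|[n w]] //=; rewrite -[inr _]/(Usym n w) eq_Usym.
by case: (w == z); rewrite ?andbT ?andbF; lia.
Qed.

Lemma rk_perm t1 t2 x j : seq_mset t1 = seq_mset t2 -> rk t1 x j = rk t2 x j.
Proof. by move=> /eq_seq_msetP p12; apply: perm_big. Qed.

Lemma in_Q_rk q t : in_Q q -> seq_mset t = q ->
  forall x j, ~~ odd (rk t x j) /\ rk t (- x) j = rk t x j.
Proof.
move=> Qq; elim: Qq t => {q} [|q Qg|q1 q2 _ IH1 _ IH2] t def_q x j.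
- have def_t : seq_mset t = seq_mset [::].
    by apply/msetP => s; rewrite def_q mset0E mset_seqE.
  by rewrite !(rk_perm _ _ def_t) /rk !big_nil.
- case: Qg def_q => [m|m y y0|m w hw w0|m w hw w0] def_q.
  + have def_t : seq_mset t = seq_mset [:: Jsym m 0; Jsym m 0].
      apply/msetP => s; rewrite def_q msetnE mset_seqE /= [_ == s]eq_sym.
      by case: eqP.
    rewrite !(rk_perm _ _ def_t) /rk !big_cons !big_nil /=.
    by rewrite ![0 == _]eq_sym oppr_eq0; split=> //; lia.
  + have def_t : seq_mset t =
        seq_mset [:: Jsym m y; Jsym m y; Jsym m (- y); Jsym m (- y)].
      apply/msetP => s; rewrite def_q msetE2 !msetnE mset_seqE /= ![_ == s]eq_sym.
      by do 2!case: eqP.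
    rewrite !(rk_perm _ _ def_t) /rk !big_cons !big_nil /=.
    by rewrite eqr_opp eqr_oppLR; case: (y == x); case: (y == - x);
      rewrite ?mul1n ?mul0n; split; lia.
  + have def_t : seq_mset t = seq_mset [:: Csym m hw].
      apply/msetP => s; rewrite def_q msetnE mset_seqE /= [_ == s]eq_sym.
      by case: eqP.
    by rewrite !(rk_perm _ _ def_t) /rk !big_cons !big_nil.
  + have def_t : seq_mset t = seq_mset [:: Csym m hw; Csym m (oppconj_nonreal hw)].
      apply/msetP => s; rewrite def_q msetE2 !msetnE mset_seqE /= ![_ == s]eq_sym.
      by do 2!case: eqP.
    by rewrite !(rk_perm _ _ def_t) /rk !big_cons !big_nil.
- have [e1 s1] := IH1 _ (seq_mset_id q1) x j; have [e2 s2] := IH2 _ (seq_mset_id q2) x j.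
  have def_t : seq_mset t = seq_mset (q1 ++ q2) by rewrite seq_mset_cat !seq_mset_id.
  rewrite !(rk_perm _ _ def_t) {1 2 3}/rk !big_cat /= oddD.
  by rewrite -/(rk q1 x j) -/(rk q2 x j) -/(rk q1 (- x) j) -/(rk q2 (- x) j)
     s1 s2 (negPf e1) (negPf e2).
Qed.

End JordanMultisets.

Section Classification.
Variable R : rcfType.
Local Notation upper := {z : R[i] | 0 < complex.Im z}.
Implicit Types (T q sp : {mset jsymbol R}) (t : seq (jsymbol R)) (x a b : R)
  (z : upper) (k m j : nat).

(** Blocks of the adjacent sizes [k] and [k.+1] with eigenvalue [a], the block
    of size zero being void. *)
Definition steps k a : {mset jsymbol R} :=
  if k is m.+1 then [mset Jsym m a] `+` [mset Jsym m.+1 a] else [mset Jsym 0 a].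

Lemma stepsE k a m x :
  steps k a (Jsym m x) = ((x == a) * ((m.+1 == k) + (m == k)))%N.
Proof.
case: k => [|k]; rewrite /steps ?msetE2 !msetnE !eq_Jsym ?eqSS;
  by case: (x == a); rewrite ?andbT ?andbF; do ?case: eqP.
Qed.

Lemma stepsU k a m z : steps k a (Usym m z) = 0%N.
Proof. by case: k => [|k]; rewrite /steps ?msetE2 !msetnE !eq_JUsym. Qed.

Lemma in_Q_remainder T sp :
  (forall m z, sp (Usym m z) = 0%N) ->
  (forall m z, T (Usym m (oppconj z)) = T (Usym m z)) ->
  (forall m x, [/\ odd (T (Jsym m x)) = odd (sp (Jsym m x)),
    (sp (Jsym m x) <= T (Jsym m x))%N &
    (T (Jsym m (- x)) + sp (Jsym m x) = T (Jsym m x) + sp (Jsym m (- x)))%N]) ->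
  exists2 q, in_Q q & T = sp `+` q.
Proof.
move=> spU TU TJ; have le_spT : sp `<=` T.
  apply/msubsetP => - [[m x]|[m z]]; last by rewrite -[inr _]/(Usym m z) spU.
  by have [] := TJ m x.
exists (T `\` sp); last by rewrite msetBDKC.
apply: in_Q_symmetric; split=> [m x|m x|m z]; rewrite !msetE2.
- by have [o le _] := TJ m x; rewrite oddB // o addbb.
- have [_ l e] := TJ m x; have [_ l' _] := TJ m (- x); lia.
- by rewrite !spU !subn0 TU.
Qed.

(** The shape forced on a Jordan type by the parities coming from a complex
    structure and the inequalities coming from a symplectic structure. Even
    numbers that differ by at most one are equal, so the kernel dimensions are
    symmetric except between [a] and [- a]. If [a != 0], there they differ by
    exactly one beyond [k], and [b] is whichever of the two has the larger
    dimension. Taking second differences, [b] has one more block of size [k.+1]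
    and one fewer of size [k] than [- b]. *)
Lemma jordan_type_classification t a b k :
  (forall x j, odd (rk t x j) = (x == a) && (k < j)%N) ->
  (forall x j, rk t x j <= rk t (- x) j + (x == b))%N ->
  (forall z j, ck t (oppconj z) j = ck t z j) ->
  exists2 q, in_Q q &
    [\/ (a = 0 \/ k = 0%N) /\ seq_mset t = steps k a `+` q,
        seq_mset t = msetn 2 (Jsym k (- a)) `+` steps k a `+` q |
        a != 0 /\ exists m, seq_mset t =
          msetn 2 (Jsym m (- a)) `+` [mset Jsym m a] `+` [mset Jsym m.+1 a] `+` q].
Proof.
move=> par ineq csym; set T := seq_mset t.
have TU m z : T (Usym m (oppconj z)) = T (Usym m z).
  have := mult_Usym t m z; have := mult_Usym t m (oppconj z).
  by rewrite !csym -/T; lia.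
have oddT m x : odd (T (Jsym m x)) = (x == a) && ((m.+1 == k) || (m == k)).
  have /(congr1 odd) := mult_Jsym t m x.
  rewrite -/T mul2n odd_double !oddD !par.
  by case: (x == a) => /=; case: (odd (T _)) => /=; lia.
have rk_sym x j : x != a -> x != - a -> rk t (- x) j = rk t x j.
  move=> xa xNa; have := par x j; have := par (- x) j.
  rewrite eqr_oppLR (negPf xa) (negPf xNa) /=.
  have := ineq x j; have := ineq (- x) j; rewrite opprK.
  by case: (x == b); case: (- x == b); lia.
have T_sym m x : x != a -> x != - a -> T (Jsym m (- x)) = T (Jsym m x).
  move=> xa xNa; have := mult_Jsym t m x; have := mult_Jsym t m (- x).
  by rewrite !rk_sym // -/T; lia.
have [a0|a0] := eqVneq a 0.
  have [||q Qq def_T] := @in_Q_remainder T (steps k a) _ TU.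
  - exact: stepsU.
  - move=> m x; have := oddT m x; rewrite !stepsE a0 oppr_eq0.
    have [->|x0] := eqVneq x 0.
      by rewrite oppr0 mul1n /= => oT; split=> //; lia.
    by move=> oT; rewrite T_sym ?a0 ?oppr0 // leq0n.
  by exists q => //; constructor 1; split=> //; left.
have aNa : (a == - a) = false.
  by rewrite -addr_eq0 -mulr2n mulrn_eq0 (negPf a0).
have Naa : (- a == a) = false by rewrite eq_sym.
(* Parity turns the inequality for [a] and [- a] into an equality. *)
have jump j : (if b == a then rk t a j = rk t (- a) j + (k < j)
               else rk t a j + (k < j) = rk t (- a) j)%N.
  have := par a j; have := par (- a) j; rewrite Naa eqxx /=.
  have := ineq a j; have := ineq (- a) j; rewrite opprK ![_ == b]eq_sym.
  have [->|_] := eqVneq b a; rewrite ?aNa; first by lia.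
  by case: (b == - a); lia.
case: (b == a) jump => jump.
  have Ta m : (T (Jsym m a) + (m.+1 == k) = T (Jsym m (- a)) + (m == k))%N.
    have := mult_Jsym t m a; have := mult_Jsym t m (- a); rewrite -/T !jump.
    by lia.
  case: k => [|k] in par oddT jump Ta *.
    have [||q Qq def_T] := @in_Q_remainder T (steps 0 a) _ TU.
    - exact: stepsU.
    - move=> m x; have := oddT m x; rewrite !stepsE.
      have [->|xa] := eqVneq x a; first by rewrite Naa; have := Ta m; split; lia.
      have [->|xNa] := eqVneq x (- a).
        by rewrite opprK eqxx; have := Ta m; split; lia.
      by move=> oT; rewrite T_sym // eqr_oppLR (negPf xNa).
    by exists q => //; constructor 1; split=> //; right.
  pose sp := msetn 2 (Jsym k (- a)) `+` [mset Jsym k a] `+` [mset Jsym k.+1 a].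
  have spE m x : sp (Jsym m x) =
      ((x == - a) * (2 * (m == k)) + (x == a) * ((m == k) + (m == k.+1)))%N.
    rewrite !msetE2 !msetnE !eq_Jsym; case: (x == a); case: (x == - a);
      by rewrite ?andbT ?andbF; do ?case: eqP.
  have [||q Qq def_T] := @in_Q_remainder T sp _ TU.
  - by move=> m z; rewrite !msetE2 !msetnE !eq_JUsym.
  - move=> m x; have := oddT m x; rewrite !spE eqr_opp.
    have [->|xa] := eqVneq x a.
      by rewrite aNa Naa; have := Ta m; split; lia.
    have [->|xNa] := eqVneq x (- a).
      by rewrite opprK eqxx; have := Ta m; split; lia.
    by move=> oT; rewrite T_sym // eqr_oppLR (negPf xNa).
  by exists q => //; constructor 3; split=> //; exists k.
have Ta m : (T (Jsym m (- a)) + (m.+1 == k) = T (Jsym m a) + (m == k))%N.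
  have := mult_Jsym t m a; have := mult_Jsym t m (- a); rewrite -/T -!jump.
  by lia.
pose sp := msetn 2 (Jsym k (- a)) `+` steps k a.
have spE m x : sp (Jsym m x) =
    ((x == - a) * (2 * (m == k)) + (x == a) * ((m.+1 == k) + (m == k)))%N.
  rewrite msetE2 stepsE msetnE !eq_Jsym; case: (x == a); case: (x == - a);
    by rewrite ?andbT ?andbF; do ?case: eqP.
have [||q Qq def_T] := @in_Q_remainder T sp _ TU.
- by move=> m z; rewrite msetE2 stepsU msetnE !eq_JUsym.
- move=> m x; have := oddT m x; rewrite !spE eqr_opp.
  have [->|xa] := eqVneq x a.
    by rewrite aNa Naa; have := Ta m; split; lia.
  have [->|xNa] := eqVneq x (- a).
    by rewrite opprK eqxx; have := Ta m; split; lia.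
  by move=> oT; rewrite T_sym // eqr_oppLR (negPf xNa).
by exists q => //; constructor 2.
Qed.

End Classification.

(** * Structures on the abelian ideal *)

Section Structures.
Variable R : rcfType.
Implicit Types (n : nat).

(** [f] is the equation of an invariant hyperplane, and [J] stands for a complex
    structure on that hyperplane, extended arbitrarily to a square matrix. *)
Definition complex_hyperplane n (D : 'M[R]_n) (f : 'rV[R]_n) (J : 'M[R]_n) : Prop :=
  f != 0 /\ forall x : 'cV[R]_n, f *m x = 0 ->
    [/\ f *m (J *m x) = 0, f *m (D *m x) = 0, J *m (J *m x) = - x &
        D *m (J *m x) = J *m (D *m x)].

(** The restriction to the ideal of a closed nondegenerate form: the ideal has
    odd dimension, so the restriction has a kernel, spanned by [z]. *)
Definition corank1_invariant_form n (D B : 'M[R]_n) (z : 'cV[R]_n) : Prop :=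
  [/\ B^T = - B, D^T *m B = - (B *m D), z != 0, B *m z = 0 &
      forall x : 'cV[R]_n, B *m x = 0 -> exists s, x = s *: z].

Definition J_invariant_on n (f : 'rV[R]_n) (J B : 'M[R]_n) : Prop :=
  forall x y : 'cV[R]_n, f *m x = 0 -> f *m y = 0 ->
    (J *m x)^T *m B *m (J *m y) = x^T *m B *m y.

Definition has_complex n (D : 'M[R]_n) : Prop :=
  exists f J, complex_hyperplane D f J.
Definition has_symplectic n (D : 'M[R]_n) : Prop :=
  exists B z, corank1_invariant_form D B z.
Definition has_pseudo_Kahler n (D : 'M[R]_n) : Prop :=
  exists f J B z, [/\ complex_hyperplane D f J, corank1_invariant_form D B z &
    J_invariant_on f J B].

(** [A] lies in the Lie algebra of the unitary group of the pseudo-Hermitian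
    metric with real part [S] on the complex vector space given by [J]. *)
Definition unitary n (A : 'M[R]_n) : Prop :=
  exists J S : 'M[R]_n, [/\ J *m J = - 1%:M, A *m J = J *m A &
    [/\ S \in unitmx, S^T = S, J^T *m S = - (S *m J) & A^T *m S = - (S *m A)]].

(** ** Invariance under similarity *)

Section Transport.
Variables (m n : nat) (D : 'M[R]_m) (D' : 'M[R]_n).
Variables (P : 'M[R]_(m, n)) (Q : 'M[R]_(n, m)).
Hypotheses (PQ : P *m Q = 1%:M) (QP : Q *m P = 1%:M) (DD' : Q *m D *m P = D').

Let QD : Q *m D = D' *m Q.
Proof. by rewrite -DD' -mulmxA PQ mulmx1. Qed.
Let DP : D *m P = P *m D'.
Proof. by rewrite -DD' !mulmxA PQ mul1mx. Qed.

Lemma complex_hyperplane_transport f J : complex_hyperplane D' f J ->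
  complex_hyperplane D (f *m Q) (P *m J *m Q).
Proof.
move=> [f0 HJ]; split=> [|x fx0].
  apply: contraNneq f0 => fQ0; apply/eqP.
  by rewrite -[f]mulmx1 -QP mulmxA fQ0 mul0mx.
have /HJ [fJ fD JJ DJ] : f *m (Q *m x) = 0 by rewrite mulmxA.
split.
- by rewrite -!mulmxA (mulmxA Q) QP mul1mx -fJ.
- by rewrite -!mulmxA (mulmxA Q) QD -!mulmxA fD.
- by rewrite -!mulmxA (mulmxA Q P) QP mul1mx JJ mulmxN mulmxA PQ mul1mx.
- by rewrite -!mulmxA (mulmxA D) DP (mulmxA Q D) QD -!mulmxA DJ.
Qed.

Lemma corank1_transport B z : corank1_invariant_form D' B z ->
  corank1_invariant_form D (Q^T *m B *m Q) (P *m z).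
Proof.
move=> [Bt DB z0 Bz kerB]; split.
- by rewrite !trmx_mul trmxK Bt mulNmx mulmxN mulmxA.
- by rewrite !mulmxA -trmx_mul QD trmx_mul -!mulmxA QD (mulmxA _ B) DB
    mulNmx mulmxN !mulmxA.
- by apply: contraNneq z0 => Pz0; rewrite -[z]mul1mx -QP -mulmxA Pz0 mulmx0.
- by rewrite -!mulmxA (mulmxA Q) QP mul1mx Bz mulmx0.
- move=> x; rewrite -!mulmxA => /(congr1 (mulmx P^T)).
  rewrite mulmxA -trmx_mul QP trmx1 mul1mx mulmx0 => /kerB [s Qx].
  by exists s; rewrite -[x]mul1mx -PQ -mulmxA Qx scalemxAr.
Qed.

Lemma J_invariant_transport f J B : J_invariant_on f J B ->
  J_invariant_on (f *m Q) (P *m J *m Q) (Q^T *m B *m Q).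
Proof.
move=> HJ x y fx fy.
have eQ u v : u^T *m (Q^T *m B *m Q) *m v = (Q *m u)^T *m B *m (Q *m v).
  by rewrite trmx_mul !mulmxA.
rewrite !eQ -!mulmxA !(mulmxA Q P) QP !mul1mx !(mulmxA _ B).
by rewrite HJ // mulmxA.
Qed.

Lemma unitary_transport : unitary D' -> unitary D.
Proof.
move=> [J [S [JJ DJ [uS St JS DS]]]].
exists (P *m J *m Q), (Q^T *m S *m Q); split; last split.
- by rewrite !mulmxA -(mulmxA _ Q) QP mulmx1 -(mulmxA P) JJ mulmxN mulmx1 mulNmx PQ.
- by rewrite !mulmxA DP -!mulmxA QD (mulmxA D') DJ !mulmxA.
- suff /mulmx1_unit [] : (Q^T *m S *m Q) *m (P *m invmx S *m P^T) = 1%:M by [].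
  rewrite !mulmxA -(mulmxA _ Q) QP mulmx1 -(mulmxA _ S) mulmxV // mulmx1.
  by rewrite -trmx_mul PQ trmx1.
- by rewrite !trmx_mul trmxK St mulmxA.
- rewrite !trmx_mul !mulmxA -(mulmxA _ P^T) -(trmx_mul Q P) QP trmx1 mulmx1.
  by rewrite -(mulmxA _ J^T) JS -(mulmxA _ Q P) QP mulmx1 mulmxN mulNmx !mulmxA.
- by rewrite !mulmxA -trmx_mul QD trmx_mul -!mulmxA QD (mulmxA _ S) DS
    mulNmx mulmxN !mulmxA.
Qed.

End Transport.

Lemma has_complex_sim m n (D : 'M[R]_m) (D' : 'M[R]_n) :
  simmx D D' -> has_complex D' -> has_complex D.
Proof.
move=> [P [Q [PQ QP DD']]] [f [J HJ]].
by exists (f *m Q), (P *m J *m Q); apply: complex_hyperplane_transport DD' _ _ HJ.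
Qed.

Lemma has_symplectic_sim m n (D : 'M[R]_m) (D' : 'M[R]_n) :
  simmx D D' -> has_symplectic D' -> has_symplectic D.
Proof.
move=> [P [Q [PQ QP DD']]] [B [z HB]].
by exists (Q^T *m B *m Q), (P *m z); apply: corank1_transport DD' _ _ HB.
Qed.

Lemma has_pseudo_Kahler_sim m n (D : 'M[R]_m) (D' : 'M[R]_n) :
  simmx D D' -> has_pseudo_Kahler D' -> has_pseudo_Kahler D.
Proof.
move=> [P [Q [PQ QP DD']]] [f [J [B [z [HJ HB HJB]]]]].
exists (f *m Q), (P *m J *m Q), (Q^T *m B *m Q), (P *m z); split.
- exact: complex_hyperplane_transport DD' _ _ HJ.
- exact: corank1_transport DD' _ _ HB.
- exact: J_invariant_transport.
Qed.

Lemma unitary_sim m n (D : 'M[R]_m) (D' : 'M[R]_n) :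
  simmx D D' -> unitary D' -> unitary D.
Proof. by move=> [P [Q [PQ QP DD']]]; apply: unitary_transport DD'. Qed.

(** ** Adding a unitary summand *)

Lemma mul_dsum_col m n (A : 'M[R]_m) (B : 'M[R]_n) (x : 'cV_m) (y : 'cV_n) :
  dsum A B *m col_mx x y = col_mx (A *m x) (B *m y).
Proof. by rewrite mul_block_col !mul0mx addr0 add0r. Qed.

Lemma mul_dsum m n (A A' : 'M[R]_m) (B B' : 'M[R]_n) :
  dsum A B *m dsum A' B' = dsum (A *m A') (B *m B').
Proof. by rewrite mulmx_block !(mulmx0, mul0mx) addr0 !add0r. Qed.

Lemma tr_dsum m n (A : 'M[R]_m) (B : 'M[R]_n) : (dsum A B)^T = dsum A^T B^T.
Proof. by rewrite /dsum tr_block_mx !trmx0. Qed.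

Lemma opp_dsum m n (A : 'M[R]_m) (B : 'M[R]_n) : - dsum A B = dsum (- A) (- B).
Proof. by rewrite /dsum opp_block_mx !oppr0. Qed.

Lemma dsum_unit m n (A : 'M[R]_m) (B : 'M[R]_n) :
  A \in unitmx -> B \in unitmx -> dsum A B \in unitmx.
Proof.
move=> uA uB.
suff /mulmx1_unit [] : dsum A B *m dsum (invmx A) (invmx B) = 1%:M by [].
by rewrite mul_dsum !mulmxV // [RHS]scalar_mx_block.
Qed.

Lemma unitary_dsum m n (A : 'M[R]_m) (B : 'M[R]_n) :
  unitary A -> unitary B -> unitary (dsum A B).
Proof.
move=> [J [S [JJ DJ [uS St JS DS]]]] [J' [S' [JJ' DJ' [uS' St' JS' DS']]]].
exists (dsum J J'), (dsum S S'); rewrite !tr_dsum !mul_dsum !opp_dsum; split; last split.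
- by rewrite JJ JJ' -opp_dsum [in RHS]scalar_mx_block.
- by rewrite DJ DJ'.
- exact: dsum_unit.
- by rewrite St St'.
- by rewrite JS JS'.
- by rewrite DS DS'.
Qed.

Lemma complex_hyperplane_dsum m n (D : 'M[R]_m) f J (A : 'M[R]_n) J' :
  complex_hyperplane D f J -> J' *m J' = - 1%:M -> A *m J' = J' *m A ->
  complex_hyperplane (dsum D A) (row_mx f 0) (dsum J J').
Proof.
move=> [f0 HJ] JJ' AJ'; split=> [|x].
  by apply: contraNneq f0 => /eqP; rewrite -row_mx0 => /eqP /eq_row_mx [->].
rewrite -[x]vsubmxK !mul_dsum_col !mul_row_col !mul0mx !addr0.
move=> /HJ [-> -> -> ->]; split=> //; rewrite ?mulmxA ?AJ' //.
by rewrite JJ' mulNmx mul1mx opp_col_mx.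
Qed.

Lemma corank1_dsum m n (D : 'M[R]_m) B z (A S : 'M[R]_n) :
  corank1_invariant_form D B z ->
  S \in unitmx -> S^T = - S -> A^T *m S = - (S *m A) ->
  corank1_invariant_form (dsum D A) (dsum B S) (col_mx z 0).
Proof.
move=> [Bt DB z0 Bz kerB] uS St AS; split.
- by rewrite tr_dsum opp_dsum Bt St.
- by rewrite tr_dsum !mul_dsum opp_dsum DB AS.
- by apply: contraNneq z0 => /eqP; rewrite -col_mx0 => /eqP /eq_col_mx [->].
- by rewrite mul_dsum_col Bz mulmx0 col_mx0.
move=> x; rewrite -[x]vsubmxK mul_dsum_col -col_mx0 => /eq_col_mx [/kerB [s ->]].
move=> /(canRL (mulKmx uS)); rewrite mulmx0 => ->.
by exists s; rewrite scale_col_mx scaler0.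
Qed.

Lemma J_invariant_dsum m n (f : 'rV[R]_m) J B (J' S : 'M[R]_n) :
  J_invariant_on f J B -> J'^T *m S *m J' = S ->
  J_invariant_on (row_mx f 0) (dsum J J') (dsum B S).
Proof.
move=> HJ HS x y; rewrite -[x]vsubmxK -[y]vsubmxK !mul_row_col !mul0mx !addr0.
move=> fx fy; rewrite !mul_dsum_col !tr_col_mx -!mulmxA !mul_dsum_col !mul_row_col.
congr (_ + _); first by have := HJ _ _ fx fy; rewrite !mulmxA.
by rewrite trmx_mul !mulmxA -!(mulmxA _ J'^T) -(mulmxA _ (_ *m S)) HS.
Qed.

Lemma unitary_symplectic_part n (J S A : 'M[R]_n) :
  J *m J = - 1%:M -> A *m J = J *m A -> S \in unitmx ->
  S^T = S -> J^T *m S = - (S *m J) -> A^T *m S = - (S *m A) ->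
  [/\ S *m J \in unitmx, (S *m J)^T = - (S *m J), A^T *m (S *m J) = - (S *m J *m A) &
      J^T *m (S *m J) *m J = S *m J].
Proof.
move=> JJ AJ uS St JS AS; split.
- rewrite unitmx_mul uS; suff /mulmx1_unit [] : J *m - J = 1%:M by [].
  by rewrite mulmxN JJ opprK.
- by rewrite trmx_mul St.
- by rewrite mulmxA AS mulNmx -(mulmxA S A) AJ mulmxA.
- by rewrite mulmxA JS mulNmx mulNmx -!mulmxA (mulmxA J) JJ mulNmx mul1mx mulmxN opprK.
Qed.

Lemma has_complex_dsum m n (D : 'M[R]_m) (A : 'M[R]_n) :
  has_complex D -> unitary A -> has_complex (dsum D A).
Proof.
move=> [f [J HJ]] [J' [S [JJ' AJ' _]]].
by exists (row_mx f 0), (dsum J J'); apply: complex_hyperplane_dsum.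
Qed.

Lemma has_symplectic_dsum m n (D : 'M[R]_m) (A : 'M[R]_n) :
  has_symplectic D -> unitary A -> has_symplectic (dsum D A).
Proof.
move=> [B [z HB]] [J' [S [JJ' AJ' [uS St JS AS]]]].
have [] := unitary_symplectic_part JJ' AJ' uS St JS AS.
by exists (dsum B (S *m J')), (col_mx z 0); apply: corank1_dsum.
Qed.

Lemma has_pseudo_Kahler_dsum m n (D : 'M[R]_m) (A : 'M[R]_n) :
  has_pseudo_Kahler D -> unitary A -> has_pseudo_Kahler (dsum D A).
Proof.
move=> [f [J [B [z [HJ HB HJB]]]]] [J' [S [JJ' AJ' [uS St JS AS]]]].
have [? ? ? ?] := unitary_symplectic_part JJ' AJ' uS St JS AS.
exists (row_mx f 0), (dsum J J'), (dsum B (S *m J')), (col_mx z 0); split.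
- exact: complex_hyperplane_dsum.
- exact: corank1_dsum.
- exact: J_invariant_dsum.
Qed.

(** ** Matrices with Jordan type in [Q] are unitary *)

(** The canonical pairing of a space with its dual is preserved by [A] together
    with minus its transpose. *)
Lemma unitary_double n (A J : 'M[R]_n) :
  J *m J = - 1%:M -> A *m J = J *m A -> unitary (dsum A (- A^T)).
Proof.
move=> JJ AJ; exists (dsum J (- J^T)), (block_mx 0 1%:M 1%:M 0); split; last split.
- rewrite mul_dsum JJ mulNmx mulmxN opprK -trmx_mul JJ linearN /= trmx1.
  by rewrite -opp_dsum [in RHS]scalar_mx_block.
- by rewrite !mul_dsum AJ mulNmx mulmxN opprK mulNmx mulmxN opprK -!trmx_mul AJ.
- suff /mulmx1_unit [] : block_mx 0 1%:M 1%:M 0 *m block_mx 0 1%:M 1%:M 0 =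
    1%:M :> 'M[R]_(n + n) by [].
  by rewrite mulmx_block !(mul0mx, mulmx0, mul1mx, add0r, addr0) -scalar_mx_block.
- by rewrite tr_block_mx !trmx0 !trmx1.
- rewrite tr_dsum linearN /= trmxK /dsum !mulmx_block opp_block_mx.
  by rewrite !(mul0mx, mulmx0, mul1mx, mulmx1, add0r, addr0, oppr0) opprK.
- rewrite tr_dsum linearN /= trmxK /dsum !mulmx_block opp_block_mx.
  by rewrite !(mul0mx, mulmx0, mul1mx, mulmx1, add0r, addr0, oppr0) opprK.
Qed.

Lemma scalar_mxN (V : pzRingType) n (a : V) : (- a)%:M = - a%:M :> 'M_n.
Proof. exact: raddfN. Qed.

Lemma conj_i : conjc 'i%C = - 'i%C :> R[i].
Proof. by apply/eqP; rewrite eq_complex /= oppr0 !eqxx. Qed.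

Lemma conj_sign k : conjc ((-1) ^+ k) = (-1) ^+ k :> R[i].
Proof. exact: rmorph_sign. Qed.

Lemma realify_i_sqr n :
  realify ('i%C%:M : 'M[R[i]]_n) *m realify 'i%C%:M = - 1%:M.
Proof.
by rewrite -realifyM -scalar_mxM -expr2 sqr_i scalar_mxN realifyN realify1.
Qed.

Lemma realify_i_comm n (A : 'M[R[i]]_n) :
  realify A *m realify 'i%C%:M = realify 'i%C%:M *m realify A.
Proof. by rewrite -!realifyM scalar_mxC. Qed.

(** The Hermitian form is the alternating antidiagonal one, times the power of
    the imaginary unit that makes it Hermitian. *)
Lemma unitary_realify_jordan_block m (z : R[i]) : complex.Re z = 0 ->
  unitary (realify (jordan_block m z)).
Proof.
move=> z0; pose K : 'M[R[i]]_m.+1 := 'i%C ^+ m *: altmx _ m.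
have i_n0 : 'i%C != 0 :> R[i] by rewrite eq_complex /= oner_eq0 andbF.
have conjK : (map_mx conjc K)^T = K.
  have -> : map_mx conjc K = (- 'i%C) ^+ m *: altmx _ m.
    rewrite map_mxZ rmorphXn; congr (_ ^+ _ *: _); first exact: conj_i.
    apply/matrixP => i j; rewrite !mxE.
    by case: (j == _); [exact: conj_sign | exact: conjc0].
  rewrite linearZ /= altmx_tr scalerA; congr (_ *: _).
  by rewrite -exprMn mulrN1 opprK.
exists (realify 'i%C%:M), (realify K); split; last split.
- exact: realify_i_sqr.
- exact: realify_i_comm.
- by rewrite realify_unit // unitmxZ ?altmx_unit // unitfE expf_neq0.
- by rewrite -realify_map_tr conjK.
- rewrite -realify_map_tr -!realifyM -realifyN; congr realify.
  have -> : map_mx conjc ('i%C%:M : 'M[R[i]]_m.+1) = (- 'i%C)%:M.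
    by rewrite map_scalar_mx; congr (_%:M); exact: conj_i.
  by rewrite tr_scalar_mx scalar_mxN mulNmx scalar_mxC.
- rewrite -realify_map_tr map_conj_jordan_block -!realifyM -realifyN.
  have -> : conjc z = - z.
    by case: z z0 => a b /= ->; apply/eqP; rewrite eq_complex /= oppr0 !eqxx.
  by rewrite -scalemxAr altmx_jordan_blockN opprK scalerN scalemxAl.
Qed.

(** Up to similarity, minus the adjoint turns the eigenvalue [z] into
    [- conjc z]. *)
Lemma unitary_realify_double m (z : R[i]) :
  unitary (dsum (realify (jordan_block m z)) (realify (jordan_block m (- conjc z)))).
Proof.
apply: unitary_sim (unitary_double (realify_i_sqr _) (realify_i_comm _)).
apply: simmx_dsum; first exact: simmx_refl.
exact/simmx_sym/simmx_realify_jordan_blockN.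
Qed.

(** A generator of [Q] is the realification of a single complex block with
    imaginary eigenvalue, or of a complex block and minus its adjoint. For real
    eigenvalues this holds because the realification of a real block is twice
    that block, whence the factors two in the definition of [Q]. *)
Lemma unitary_jordan_mx (q : {mset jsymbol R}) (t : seq (jsymbol R)) :
  in_Q q -> seq_mset t = q -> unitary (jordan_mx t).
Proof.
have perm_unitary (t1 t2 : seq (jsymbol R)) : seq_mset t1 = seq_mset t2 ->
    unitary (jordan_mx t2) -> unitary (jordan_mx t1).
  by move=> /eq_seq_msetP p12; apply/unitary_sim/perm_jordan_mx.
have cat_unitary (t1 t2 : seq (jsymbol R)) : unitary (jordan_mx t1) ->
    unitary (jordan_mx t2) -> unitary (jordan_mx (t1 ++ t2)).
  by move=> u1 u2; apply: unitary_sim (jordan_mx_cat _ _) (unitary_dsum u1 u2).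
have pair_unitary (s1 s2 : jsymbol R) :
    unitary (dsum (jsymbol_mx s1) (jsymbol_mx s2)) -> unitary (jordan_mx [:: s1; s2]).
  move=> u12; apply: unitary_sim (jordan_mx_cons _ _) _.
  apply: unitary_sim u12; apply: simmx_dsum; first exact: simmx_refl.
  exact: jordan_mx1.
move=> Qq; elim: Qq t => {q} [|q Qg|q1 q2 _ IH1 _ IH2] t def_q.
- apply: (perm_unitary _ [::]).
    by apply/msetP => s; rewrite def_q mset0E mset_seqE.
  apply: unitary_sim (simmx_sym (jordan_mx_nil 0)) _.
  by exists 0, 0; split; last split; rewrite ?unitmxE ?det_mx00 ?unitr1 //;
    apply/matrixP => - [].
- case: Qg def_q => [m|m x x0|m w hw w0|m w hw w0] def_q.
  + apply: (perm_unitary _ [:: Jsym m 0; Jsym m 0]).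
      apply/msetP => s; rewrite def_q msetnE mset_seqE /= [_ == s]eq_sym.
      by case: eqP.
    apply: pair_unitary; rewrite /= -realify_jordan_block_real.
    exact: unitary_realify_jordan_block.
  + apply: (perm_unitary _ ([:: Jsym m x; Jsym m x] ++ [:: Jsym m (- x); Jsym m (- x)])).
      apply/msetP => s; rewrite def_q msetE2 !msetnE mset_seqE /= ![_ == s]eq_sym.
      by do 2!case: eqP.
    apply: unitary_sim (jordan_mx_cat _ _) _.
    have := unitary_realify_double m (real_complex R x).
    have -> : - conjc (real_complex R x) = real_complex R (- x).
      by rewrite conjc_real rmorphN.
    rewrite !realify_jordan_block_real; apply: unitary_sim.
    by apply: simmx_dsum; apply: simmx_trans (jordan_mx_cons _ _) _;
      apply: simmx_dsum; (exact: simmx_refl || exact: jordan_mx1).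
  + apply: (perm_unitary _ [:: Csym m hw]).
      apply/msetP => s; rewrite def_q msetnE mset_seqE /= [_ == s]eq_sym.
      by case: eqP.
    apply: unitary_sim (jordan_mx1 _) _.
    exact: unitary_realify_jordan_block.
  + apply: (perm_unitary _ [:: Csym m hw; Csym m (oppconj_nonreal hw)]).
      apply/msetP => s; rewrite def_q msetE2 !msetnE mset_seqE /= ![_ == s]eq_sym.
      by do 2!case: eqP.
    apply: pair_unitary.
    have := unitary_realify_double m (complex.Complex (complex.Re w) `|complex.Im w|).
    congr (unitary (dsum _ (realify (jordan_block m _)))).
    apply/eqP; rewrite eq_complex /=; case: (w) => a b /=.
    by rewrite !opprK !eqxx.
- apply: (perm_unitary _ (q1 ++ q2)).
    by rewrite seq_mset_cat !seq_mset_id.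
  by apply: cat_unitary; [apply: IH1 | apply: IH2]; rewrite seq_mset_id.
Qed.

End Structures.

(** * Structures on the exceptional blocks *)

Section ExceptionalBlocks.
Variable R : rcfType.

(** [A'] is the restriction of [A] to the invariant hyperplane [eps = 0],
    through the inclusion [iota] with retraction [lam]. *)
Definition hyperplane_inclusion p q (A : 'M[R]_q) (A' : 'M[R]_p)
    (iota : 'M[R]_(q, p)) (lam : 'M[R]_(p, q)) (eps : 'rV[R]_q) (eta : 'cV[R]_q) :=
  [/\ A *m iota = iota *m A', lam *m iota = 1%:M, eps *m iota = 0,
      eps *m eta = 1%:M & iota *m lam + eta *m eps = 1%:M].

(** [A'] is the quotient of [A] by the invariant line spanned by [kap]. *)
Definition line_quotient p q (A : 'M[R]_q) (A' : 'M[R]_p)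
    (rho : 'M[R]_(p, q)) (sig : 'M[R]_(q, p)) (tau : 'rV[R]_q) (kap : 'cV[R]_q) :=
  [/\ rho *m A = A' *m rho, rho *m sig = 1%:M, rho *m kap = 0,
      tau *m kap = 1%:M & sig *m rho + kap *m tau = 1%:M].

Lemma trmxN m n (A : 'M[R]_(m, n)) : (- A)^T = - A^T.
Proof. exact: linearN. Qed.

(** [J] exchanges the smaller block with the hyperplane of the larger one: it
    maps [(iota f, 0)] to [(0, f)]. *)
Lemma inclusion_hyperplane p q (A : 'M[R]_q) (A' : 'M[R]_p) iota lam eps eta :
  hyperplane_inclusion A A' iota lam eps eta ->
  complex_hyperplane (dsum A A') (row_mx eps 0) (block_mx 0 (- iota) lam 0).
Proof.
move=> [Ai li ei ee dec]; split=> [|x].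
  apply/eqP; rewrite -row_mx0 => /eq_row_mx [e0 _].
  by move: ee; rewrite e0 mul0mx => /matrixP /(_ 0 0); rewrite !mxE => /eqP;
    rewrite eq_sym oner_eq0.
rewrite -[x]vsubmxK; move: (usubmx x) (dsubmx x) => e f {x}.
rewrite mul_row_col mul0mx addr0 => e0.
have eE : iota *m lam *m e = e.
  by have := congr1 (mulmx^~ e) dec; rewrite mulmxDl mul1mx -[_ *m e in X in X + _]mulmxA
    -(mulmxA eta) e0 mulmx0 addr0 mulmxA.
rewrite !mul_dsum_col !mul_block_col !mul0mx !add0r !addr0 !mul_row_col !mul0mx !addr0.
split.
- by rewrite mulNmx mulmxN mulmxA ei mul0mx oppr0.
- by rewrite -eE -!mulmxA (mulmxA A) Ai -!mulmxA (mulmxA eps) ei mul0mx.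
- by rewrite !mulNmx mulmxN !mulmxA li mul1mx eE opp_col_mx.
- rewrite !mulNmx mulmxN !mulmxA Ai; congr col_mx.
  by rewrite -[in RHS]eE -!mulmxA (mulmxA A) Ai -!mulmxA (mulmxA lam) li mul1mx.
Qed.

(** An alternating form on a direct sum obtained from a pairing of the summands:
    its kernel is the sum of the left and right kernels of the pairing. *)
Lemma corank1_pairing p q (D1 : 'M[R]_p) (D2 : 'M[R]_q) (M : 'M[R]_(p, q))
    (x0 : 'cV[R]_p) (y0 : 'cV[R]_q) :
  D1^T *m M = - (M *m D2) -> col_mx x0 y0 != 0 -> M *m y0 = 0 -> M^T *m x0 = 0 ->
  (forall x y, M *m y = 0 -> M^T *m x = 0 ->
     exists s, x = s *: x0 /\ y = s *: y0) ->
  corank1_invariant_form (dsum D1 D2) (block_mx 0 M (- M^T) 0) (col_mx x0 y0).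
Proof.
move=> DM nz My0 Mx0 kerM; split=> //.
- by rewrite tr_block_mx opp_block_mx !trmx0 trmxN trmxK opprK !oppr0.
- rewrite tr_dsum /dsum !mulmx_block !(mul0mx, mulmx0, addr0, add0r).
  rewrite opp_block_mx !oppr0 DM mulmxN mulNmx opprK; congr block_mx.
  by rewrite -trmx_mul -trmxN -DM trmx_mul trmxK.
- by rewrite mul_block_col !mul0mx add0r addr0 My0 mulNmx Mx0 oppr0 col_mx0.
move=> x; rewrite -[x]vsubmxK; move: (usubmx x) (dsubmx x) => u v {x}.
rewrite mul_block_col !mul0mx add0r addr0 -col_mx0 => /eq_col_mx [Mv].
rewrite mulNmx => /eqP; rewrite oppr_eq0 => /eqP Mu.
by have [s [-> ->]] := kerM _ _ Mv Mu; exists s; rewrite scale_col_mx.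
Qed.

Lemma pairingE p q (M : 'M[R]_(p, q)) (x x' : 'cV[R]_p) (y y' : 'cV[R]_q) :
  (col_mx x y)^T *m block_mx 0 M (- M^T) 0 *m col_mx x' y' =
  x^T *m M *m y' - (x'^T *m M *m y)^T.
Proof.
rewrite tr_col_mx mul_row_block mul_row_col !mulmx0 add0r addr0 mulmxN mulNmx.
by rewrite addrC !trmx_mul trmxK mulmxA.
Qed.

(** Write [(e, f, g, h)] for the four components. With [J] exchanging [f] with
    [iota f] and [g] with [h], the canonical pairing of [e] with [g] forces that
    of [iota f] with [h]. The latter degenerates along the [h] that vanish on the
    hyperplane. *)
Lemma pseudo_Kahler_big_dual p q (A : 'M[R]_q) (A' : 'M[R]_p) iota lam eps eta :
  hyperplane_inclusion A A' iota lam eps eta ->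
  has_pseudo_Kahler (dsum (dsum A A') (dsum (- A^T) (- A^T))).
Proof.
move=> inc; have HJ := inclusion_hyperplane inc.
have [Ai li ei ee dec] := inc.
pose J' : 'M[R]_(q + q) := block_mx 0 (- 1%:M) 1%:M 0.
pose M : 'M[R]_(q + p, q + q) := block_mx 1%:M 0 0 iota^T.
exists (row_mx (row_mx eps 0) 0), (dsum (block_mx 0 (- iota) lam 0) J').
exists (block_mx 0 M (- M^T) 0), (col_mx 0 (col_mx 0 eps^T)); split.
- apply: complex_hyperplane_dsum HJ _ _.
    rewrite /J' mulmx_block !(mul0mx, mulmx0, mul1mx, mulmx1, addr0, add0r).
    by rewrite [in RHS]scalar_mx_block opp_block_mx !oppr0.
  rewrite /J' /dsum !mulmx_block !(mul0mx, mulmx0, mul1mx, mulmx1, addr0, add0r).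
  by congr block_mx; rewrite mulmxN mulmx1 mulNmx mul1mx.
- apply: corank1_pairing.
  + rewrite tr_dsum /dsum /M !mulmx_block.
    rewrite !(mul0mx, mulmx0, mul1mx, mulmx1, addr0, add0r) opp_block_mx !oppr0 opprK.
    by congr block_mx; rewrite mulmxN opprK -!trmx_mul Ai.
  + apply/eqP; rewrite -!col_mx0 => /eq_col_mx [_ /eq_col_mx [_ e0]].
    move: ee; rewrite -[eps]trmxK e0 trmx0 mul0mx => /matrixP /(_ 0 0).
    by rewrite !mxE => /eqP; rewrite eq_sym oner_eq0.
  + by rewrite mul_block_col !(mul0mx, mulmx0, addr0, add0r) -trmx_mul ei trmx0 col_mx0.
  + by rewrite mulmx0.
  + move=> x y; rewrite -[x]vsubmxK -[y]vsubmxK.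
    move: (usubmx x) (dsubmx x) (usubmx y) (dsubmx y) => e f g h {x y}.
    rewrite /M tr_block_mx !trmx0 trmx1 trmxK !mul_block_col !mul0mx !mul1mx.
    rewrite !addr0 !add0r -!col_mx0 => /eq_col_mx [-> ih] /eq_col_mx [-> if0].
    have -> : f = 0 by rewrite -[f]mul1mx -li -mulmxA if0 mulmx0.
    have : h^T = h^T *m eta *m eps.
      rewrite -[LHS]mulmx1 -dec mulmxDr !mulmxA.
      by rewrite -[h^T *m iota]trmxK trmx_mul trmxK ih trmx0 mul0mx add0r.
    rewrite [h^T *m eta]mx11_scalar => /(congr1 trmx); rewrite trmxK => ->.
    exists ((h^T *m eta) 0 0); rewrite !scale_col_mx !scaler0; split=> //.
    by rewrite mul_scalar_mx linearZ.
- move=> x y; rewrite -[x]vsubmxK -[y]vsubmxK !mul_row_col !mul0mx !addr0.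
  rewrite !mul_dsum_col !pairingE.
  suff JM (u : 'cV[R]_(q + p)) (v : 'cV[R]_(q + q)) : row_mx eps 0 *m u = 0 ->
      (block_mx 0 (- iota) lam 0 *m u)^T *m M *m (J' *m v) = u^T *m M *m v.
    by move=> xE yE; rewrite !JM.
  rewrite -[u]vsubmxK -[v]vsubmxK.
  move: (usubmx u) (dsubmx u) (usubmx v) (dsubmx v) => e f g h {x y u v}.
  rewrite mul_row_col mul0mx addr0 => e0.
  have eE : iota *m (lam *m e) = e.
    have := congr1 (mulmx^~ e) dec.
    by rewrite mulmxDl mul1mx -!mulmxA e0 mulmx0 addr0.
  rewrite /J' /M !mul_block_col !tr_col_mx !mul_row_block !mul_row_col.
  rewrite !(mul0mx, mulmx0, mulmx1, mul1mx, addr0, add0r) !mulNmx !mulmxN mul1mx.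
  rewrite trmxN mulNmx opprK addrC; congr (_ + _).
    by rewrite -trmx_mul eE.
  by rewrite trmx_mul.
Qed.

Lemma row1_neq0 q (v : 'rV[R]_q) (w : 'cV[R]_q) : v *m w = 1%:M -> v != 0.
Proof.
move=> vw; apply/eqP => v0; move: vw; rewrite v0 mul0mx => /matrixP /(_ 0 0).
by rewrite !mxE => /eqP; rewrite eq_sym oner_eq0.
Qed.

Lemma skew_form_self n (B : 'M[R]_n) (x : 'cV[R]_n) :
  B^T = - B -> x^T *m B *m x = 0.
Proof.
move=> Bt; set c := _ *m x; have : c^T = - c.
  by rewrite /c !trmx_mul trmxK Bt mulNmx mulmxN mulmxA.
rewrite [c]mx11_scalar tr_scalar_mx -raddfN => /matrixP /(_ 0 0).
rewrite !mxE !mulr1n => /eqP; rewrite -addr_eq0 -mulr2n mulrn_eq0 /= => /eqP ->.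
by rewrite raddf0.
Qed.

(** If the larger block preserves a symplectic form [H], the smaller one gets
    its restriction, whose kernel is the line orthogonal to the hyperplane. *)
Lemma pseudo_Kahler_skew p q (A : 'M[R]_q) (A' : 'M[R]_p) iota lam eps eta H :
  hyperplane_inclusion A A' iota lam eps eta ->
  H \in unitmx -> H^T = - H -> A^T *m H = - (H *m A) ->
  has_pseudo_Kahler (dsum A A').
Proof.
move=> inc uH Ht AH; have HJ := inclusion_hyperplane inc.
have [Ai li ei ee dec] := inc.
pose w := invmx H *m eps^T; have Hw : H *m w = eps^T by rewrite mulmxA mulmxV // mul1mx.
(* The orthogonal of the hyperplane is spanned by [w], and lies inside it
   because [H] is alternating. *)
have epsE : eps = - (w^T *m H) by rewrite -[eps]trmxK -Hw trmx_mul Ht mulmxN.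
have ilw : iota *m (lam *m w) = w.
  have := congr1 (mulmx^~ w) dec; rewrite mulmxDl mul1mx -!mulmxA.
  by rewrite [X in eta *m (X *m w)]epsE mulNmx skew_form_self // oppr0 mulmx0 addr0.
have eps_n0 := row1_neq0 ee.
exists (row_mx eps 0), (block_mx 0 (- iota) lam 0).
exists (dsum H (iota^T *m H *m iota)), (col_mx 0 (lam *m w)); split=> //.
- split.
  + by rewrite tr_dsum opp_dsum Ht !trmx_mul trmxK Ht mulNmx mulmxN mulmxA.
  + rewrite tr_dsum !mul_dsum opp_dsum AH; congr dsum.
    by rewrite !mulmxA -trmx_mul -Ai trmx_mul -!mulmxA (mulmxA A^T) AH mulNmx mulmxN
      -(mulmxA H A) Ai !mulmxA.
  + apply: contraNneq eps_n0 => /eqP; rewrite -col_mx0 => /eqP /eq_col_mx [_ lw0].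
    by rewrite epsE -ilw lw0 mulmx0 trmx0 mul0mx oppr0.
  + by rewrite mul_dsum_col mulmx0 -!mulmxA ilw Hw -trmx_mul ei trmx0 col_mx0.
  move=> x; rewrite -[x]vsubmxK; move: (usubmx x) (dsubmx x) => e f {x}.
  rewrite mul_dsum_col -col_mx0 => /eq_col_mx [He Hf].
  have -> : e = 0 by rewrite -(mulKmx uH e) He mulmx0.
  pose v := H *m (iota *m f).
  have vi : v^T *m iota = 0.
    by rewrite -[iota]trmxK -trmx_mul /v !mulmxA Hf trmx0.
  have [c vE] : exists c, v = c *: eps^T.
    exists ((v^T *m eta) 0 0); rewrite -[LHS]trmxK -linearZ /=; congr (_^T).
    rewrite -[LHS]mulmx1 -dec mulmxDr !mulmxA vi mul0mx add0r.
    by rewrite {1}[v^T *m eta]mx11_scalar mul_scalar_mx.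
  exists c; rewrite scale_col_mx scaler0; congr col_mx.
  rewrite -[f]mul1mx -li -mulmxA -(mulKmx uH (iota *m f)) -/v vE.
  by rewrite -!scalemxAr.
- move=> x y; rewrite -[x]vsubmxK -[y]vsubmxK !mul_row_col !mul0mx !addr0.
  move: (usubmx x) (dsubmx x) (usubmx y) (dsubmx y) => e f e' f' {x y} e0 e0'.
  have eE (u : 'cV_q) : eps *m u = 0 -> iota *m (lam *m u) = u.
    move=> u0; have := congr1 (mulmx^~ u) dec.
    by rewrite mulmxDl mul1mx -!mulmxA u0 mulmx0 addr0.
  rewrite !mul_block_col !tr_col_mx /dsum !mul_row_block !mul_row_col.
  rewrite !(mul0mx, mulmx0, addr0, add0r) !mulNmx !mulmxN trmxN !mulNmx opprK.
  rewrite addrC; congr (_ + _); last by rewrite !trmx_mul !mulmxA.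
  by rewrite !mulmxA -trmx_mul -!mulmxA !eE ?mulmxA //.
Qed.

(** If instead the smaller block preserves a symplectic form [H], pair it with
    its image as a quotient of the larger block. *)
Lemma pseudo_Kahler_proj p q (A : 'M[R]_q) (A' : 'M[R]_p)
    iota lam eps eta rho sig tau kap H :
  hyperplane_inclusion A A' iota lam eps eta ->
  line_quotient A A' rho sig tau kap -> rho *m iota = A' ->
  H \in unitmx -> H^T = - H -> A'^T *m H = - (H *m A') ->
  has_pseudo_Kahler (dsum A A').
Proof.
move=> inc [rA rs rk tk dec'] ri uH Ht AH; have HJ := inclusion_hyperplane inc.
have [Ai li ei ee dec] := inc.
have kerr e : rho *m e = 0 -> e = (tau *m e) 0 0 *: kap.
  move=> re; rewrite -[LHS]mul1mx -dec' mulmxDl -!mulmxA re mulmx0 add0r.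
  by rewrite {1}[tau *m e]mx11_scalar mul_mx_scalar.
pose M := rho^T *m H.
exists (row_mx eps 0), (block_mx 0 (- iota) lam 0).
exists (block_mx 0 M (- M^T) 0), (col_mx kap 0); split=> //.
- apply: corank1_pairing.
  + by rewrite /M mulmxA -trmx_mul rA trmx_mul -(mulmxA _ A'^T) AH mulmxN mulmxA.
  + have /eqP t0 := row1_neq0 tk; apply: contra_not_neq t0 => /eqP.
    rewrite -col_mx0 => /eqP /eq_col_mx [k0 _].
    by move/eqP: (row1_neq0 tk); move: tk; rewrite k0 mulmx0 => /matrixP /(_ 0 0);
      rewrite !mxE => /eqP; rewrite eq_sym oner_eq0.
  + by rewrite mulmx0.
  + by rewrite /M trmx_mul trmxK -mulmxA rk mulmx0.
  move=> e f; rewrite /M -mulmxA => Mf; rewrite trmx_mul trmxK -mulmxA => Me.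
  have uHt : H^T \in unitmx by rewrite unitmx_tr.
  have /kerr -> : rho *m e = 0 by rewrite -(mulKmx uHt (rho *m e)) Me mulmx0.
  have -> : f = 0.
    rewrite -(mulKmx uH f) -[H *m f]mul1mx -[1%:M]trmx1 -rs trmx_mul.
    by rewrite -!mulmxA Mf !mulmx0.
  by exists ((tau *m e) 0 0); rewrite scaler0.
- move=> x y; rewrite -[x]vsubmxK -[y]vsubmxK !mul_row_col !mul0mx !addr0.
  move: (usubmx x) (dsubmx x) (usubmx y) (dsubmx y) => e f e' f' {x y} e0 e0'.
  have eE (u : 'cV_q) : eps *m u = 0 -> iota *m (lam *m u) = u.
    move=> u0; have := congr1 (mulmx^~ u) dec.
    by rewrite mulmxDl mul1mx -!mulmxA u0 mulmx0 addr0.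
  rewrite !mul_block_col !(mul0mx, mulmx0, addr0, add0r) !pairingE.
  rewrite -{2}(eE e) // -{2}(eE e') //.
  move: (lam *m e) (lam *m e') => u u'.
  have eM v g : (iota *m v)^T *m M *m g = v^T *m (A'^T *m H) *m g.
    by rewrite /M trmx_mul -ri trmx_mul !mulmxA.
  have Kt : (A'^T *m H)^T = A'^T *m H by rewrite trmx_mul trmxK Ht mulNmx AH.
  move: (A'^T *m H) Kt eM => K Kt eM; rewrite !(trmxN, mulNmx) opprK !eM.
  by rewrite !trmx_mul !trmxK Kt addrC !mulmxA.
Qed.

(** The smaller block pairs with one copy of its dual, the larger one with the
    other copy through the quotient map; the kernel is the line divided out. *)
Lemma symplectic_small_dual p q (A : 'M[R]_q) (A' : 'M[R]_p) rho sig tau kap :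
  line_quotient A A' rho sig tau kap ->
  has_symplectic (dsum (dsum A A') (dsum (- A'^T) (- A'^T))).
Proof.
move=> [rA rs rk tk dec'].
pose M : 'M[R]_(q + p, p + p) := block_mx 0 rho^T 1%:M 0.
exists (block_mx 0 M (- M^T) 0), (col_mx (col_mx kap 0) 0).
apply: corank1_pairing.
- rewrite tr_dsum /dsum /M !mulmx_block.
  rewrite !(mul0mx, mulmx0, mul1mx, mulmx1, addr0, add0r) opp_block_mx !oppr0 opprK.
  by congr block_mx; rewrite mulmxN opprK -!trmx_mul rA.
- apply/eqP; rewrite -!col_mx0 => /eq_col_mx [/eq_col_mx [k0 _] _].
  by move: tk; rewrite k0 mulmx0 => /matrixP /(_ 0 0);
    rewrite !mxE => /eqP; rewrite eq_sym oner_eq0.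
- by rewrite mulmx0.
- by rewrite /M tr_block_mx mul_block_col !trmx0 trmx1 trmxK
    !(mul0mx, mulmx0, addr0, add0r) rk col_mx0.
move=> x y; rewrite -[x]vsubmxK -[y]vsubmxK.
move: (usubmx x) (dsubmx x) (usubmx y) (dsubmx y) => e f g h {x y}.
rewrite /M tr_block_mx !trmx0 trmx1 trmxK !mul_block_col !mul0mx !mul1mx.
rewrite !addr0 !add0r -!col_mx0 => /eq_col_mx [rh ->] /eq_col_mx [-> re].
have -> : h = 0.
  by rewrite -[h]mul1mx -[1%:M]trmx1 -rs trmx_mul -mulmxA rh mulmx0.
exists ((tau *m e) 0 0); rewrite !scale_col_mx !scaler0; split=> //; congr col_mx.
rewrite -[LHS]mul1mx -dec' mulmxDl -!mulmxA re mulmx0 add0r.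
by rewrite {1}[tau *m e]mx11_scalar mul_mx_scalar.
Qed.

Definition lift_mx q (i0 : 'I_q.+1) : 'M[R]_(q.+1, q) := colsub (lift i0) 1%:M.
Definition unlift_mx q (i0 : 'I_q.+1) : 'M[R]_(q, q.+1) := rowsub (lift i0) 1%:M.

Lemma unlift_lift_mx q (i0 : 'I_q.+1) : unlift_mx i0 *m lift_mx i0 = 1%:M.
Proof.
rewrite /unlift_mx mul_rowsub_mx mul1mx; apply/matrixP => i j.
by rewrite !mxE (inj_eq (@lift_inj _ i0)).
Qed.

Lemma delta_lift_mx q (i0 : 'I_q.+1) : delta_mx (0 : 'I_1) i0 *m lift_mx i0 = 0.
Proof.
rewrite /lift_mx mulmx_colsub mulmx1; apply/matrixP => i j.
by rewrite !mxE andbC eq_sym (negPf (neq_lift i0 j)).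
Qed.

Lemma unlift_delta_mx q (i0 : 'I_q.+1) : unlift_mx i0 *m delta_mx i0 (0 : 'I_1) = 0.
Proof.
rewrite /unlift_mx mul_rowsub_mx mul1mx; apply/matrixP => i j.
by rewrite !mxE eq_sym (negPf (neq_lift i0 i)).
Qed.

Lemma delta_delta_mx q (i0 : 'I_q) :
  delta_mx (0 : 'I_1) i0 *m delta_mx i0 (0 : 'I_1) = 1%:M :> 'M[R]_1.
Proof. by rewrite mul_delta_mx; apply/matrixP => i j; rewrite !ord1 !mxE. Qed.

Lemma lift_decomposition q (i0 : 'I_q.+1) :
  lift_mx i0 *m unlift_mx i0 + delta_mx i0 (0 : 'I_1) *m delta_mx 0 i0 = 1%:M.
Proof.
rewrite mul_delta_mx; apply/matrixP => i j; rewrite !mxE.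
have [k ->|->] := unliftP i0 i.
  rewrite eq_sym (negPf (neq_lift i0 k)) addr0 (bigD1 k) //= !mxE eqxx mul1r.
  rewrite big1 ?addr0 // => k' neq_k.
  by rewrite !mxE (inj_eq (@lift_inj _ i0)) eq_sym (negPf neq_k) mul0r.
rewrite big1 ?add0r => [|k _]; first by rewrite eqxx eq_sym.
by rewrite !mxE (negPf (neq_lift i0 k)) mul0r.
Qed.

Lemma jordan_block_inter m n (X : 'M[R]_(m.+1, n.+1)) a :
  jordan_block m 0 *m X = X *m jordan_block n 0 ->
  jordan_block m a *m X = X *m jordan_block n a.
Proof.
move=> NX; rewrite ![jordan_block _ a]jordan_block0E mulmxDl mulmxDr NX.
by rewrite scalar_mxC.
Qed.

Lemma lift_maxE q i j : lift_mx (ord_max : 'I_q.+1) i j = (i == j :> nat)%:R.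
Proof. by rewrite !mxE -val_eqE /= /bump leqNgt ltn_ord. Qed.

Lemma unlift0E q i j : unlift_mx (ord0 : 'I_q.+1) i j = (j == i.+1 :> nat)%:R.
Proof. by rewrite !mxE -val_eqE /= eq_sym. Qed.

Lemma jordan_block_lift m a :
  jordan_block m.+1 a *m lift_mx ord_max = lift_mx ord_max *m jordan_block m a.
Proof.
apply: jordan_block_inter; apply/matrixP => i j.
have lt_j := ltn_ord j; rewrite mul_shift_mx mul_mx_shift.
case def_j: (nat_of_ord j) => [|j']; case: ltnP => // le_mi;
  rewrite !lift_maxE ?inordK ?def_j //; try lia.
by rewrite gtn_eqF //; lia.
Qed.

Lemma jordan_block_unlift m a :
  unlift_mx ord0 *m jordan_block m.+1 a = jordan_block m a *m unlift_mx ord0.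
Proof.
apply/esym/jordan_block_inter/matrixP => i j.
have lt_j := ltn_ord j; rewrite mul_shift_mx mul_mx_shift.
case def_j: (nat_of_ord j) => [|j']; case: ltnP => // le_mi;
  rewrite !unlift0E ?inordK ?def_j //; try lia.
by rewrite ltn_eqF //; lia.
Qed.

(** Including a nilpotent block as the hyperplane of the next one, then dividing
    by the line of the latter, shifts the basis by one step. *)
Lemma unlift_lift_jordan_block m :
  unlift_mx ord0 *m lift_mx ord_max = jordan_block m 0.
Proof.
rewrite /unlift_mx mul_rowsub_mx mul1mx; apply/matrixP => i j.
by rewrite mxE lift_maxE mxE mul0rn add0r eq_sym.
Qed.

Lemma jordan_block_inclusion m a :
  hyperplane_inclusion (jordan_block m.+1 a) (jordan_block m a)
    (lift_mx ord_max) (unlift_mx ord_max) (delta_mx 0 ord_max) (delta_mx ord_max 0).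
Proof.
split; [exact: jordan_block_lift | exact: unlift_lift_mx | exact: delta_lift_mx |
  exact: delta_delta_mx | exact: lift_decomposition].
Qed.

Lemma jordan_block_inclusion0 a :
  hyperplane_inclusion (jordan_block 0 a) (0 : 'M[R]_0)
    (lift_mx ord0) (unlift_mx ord0) (delta_mx 0 ord0) (delta_mx ord0 0).
Proof.
split; [ | exact: unlift_lift_mx | exact: delta_lift_mx |
  exact: delta_delta_mx | exact: lift_decomposition].
by apply/matrixP => i - [].
Qed.

Lemma jordan_block_quotient m a :
  line_quotient (jordan_block m.+1 a) (jordan_block m a)
    (unlift_mx ord0) (lift_mx ord0) (delta_mx 0 ord0) (delta_mx ord0 0).
Proof.
split; [exact: jordan_block_unlift | exact: unlift_lift_mx | exact: unlift_delta_mx |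
  exact: delta_delta_mx | exact: lift_decomposition].
Qed.

(** ** From blocks to Jordan types *)

Lemma jordan_mx2 (s1 s2 : jsymbol R) :
  simmx (jordan_mx [:: s1; s2]) (dsum (jsymbol_mx s1) (jsymbol_mx s2)).
Proof.
apply: simmx_trans (jordan_mx_cons _ _) _.
by apply: simmx_dsum; [apply: simmx_refl | apply: jordan_mx1].
Qed.

Lemma jordan_mx_pairs (s1 s2 s3 s4 : jsymbol R) :
  simmx (jordan_mx [:: s1; s2; s3; s4])
    (dsum (dsum (jsymbol_mx s1) (jsymbol_mx s2))
          (dsum (jsymbol_mx s3) (jsymbol_mx s4))).
Proof.
apply: simmx_trans (jordan_mx_cat [:: s1; s2] [:: s3; s4]) _.
by apply: simmx_dsum; apply: jordan_mx2.
Qed.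

Lemma complex_exceptional m (c : R) :
  has_complex (jordan_mx [:: Jsym m.+1 c; Jsym m c; Jsym m (- c); Jsym m (- c)]).
Proof.
apply: has_complex_sim (jordan_mx_pairs _ _ _ _) _.
exists (row_mx (row_mx (delta_mx 0 ord_max) 0) 0).
exists (dsum (block_mx 0 (- lift_mx ord_max) (unlift_mx ord_max) 0)
             (block_mx 0 (- 1%:M) 1%:M 0)).
apply: complex_hyperplane_dsum (inclusion_hyperplane (jordan_block_inclusion _ _)) _ _.
  rewrite mulmx_block !(mul0mx, mulmx0, mul1mx, mulmx1, addr0, add0r).
  by rewrite [in RHS]scalar_mx_block opp_block_mx !oppr0.
rewrite /dsum !mulmx_block !(mul0mx, mulmx0, mul1mx, mulmx1, addr0, add0r).
by congr block_mx; rewrite mulmxN mulmx1 mulNmx mul1mx.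
Qed.

Lemma symplectic_exceptional m (c : R) :
  has_symplectic (jordan_mx [:: Jsym m.+1 c; Jsym m c; Jsym m (- c); Jsym m (- c)]).
Proof.
apply: has_symplectic_sim (jordan_mx_pairs _ _ _ _) _.
apply: has_symplectic_sim (symplectic_small_dual (jordan_block_quotient m c)).
apply: simmx_dsum; first exact: simmx_refl.
by apply: simmx_dsum; apply: simmx_jordan_blockN.
Qed.

Lemma pseudo_Kahler_steps_dual k (a : R) (t : seq (jsymbol R)) :
  seq_mset t = msetn 2 (Jsym k (- a)) `+` steps k a ->
  has_pseudo_Kahler (jordan_mx t).
Proof.
case: k => [|m] def_t.
  have p_t : perm_eq t ([:: Jsym 0 a] ++ [:: Jsym 0 (- a); Jsym 0 (- a)]).
    apply/eq_seq_msetP/msetP => s; rewrite def_t msetE2 !msetnE mset_seqE /=.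
    by rewrite ![_ == s]eq_sym; do 2!case: eqP.
  apply: has_pseudo_Kahler_sim (perm_jordan_mx p_t) _.
  apply: has_pseudo_Kahler_sim (jordan_mx_cat _ _) _.
  apply: has_pseudo_Kahler_sim (pseudo_Kahler_big_dual (jordan_block_inclusion0 a)).
  apply: simmx_dsum.
    apply: simmx_trans (jordan_mx1 _) _.
    by apply: simmx_trans (simmx_dsumC _ _); apply/simmx_sym/simmx_dsum0.
  apply: simmx_trans (jordan_mx2 _ _) _.
  by apply: simmx_dsum; apply: simmx_jordan_blockN.
have p_t : perm_eq t [:: Jsym m.+1 a; Jsym m a; Jsym m.+1 (- a); Jsym m.+1 (- a)].
  apply/eq_seq_msetP/msetP => s; rewrite def_t !msetE2 !msetnE mset_seqE /=.
  by rewrite ![_ == s]eq_sym; do 3!case: eqP.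
apply: has_pseudo_Kahler_sim (perm_jordan_mx p_t) _.
apply: has_pseudo_Kahler_sim (jordan_mx_pairs _ _ _ _) _.
apply: has_pseudo_Kahler_sim (pseudo_Kahler_big_dual (jordan_block_inclusion m a)).
apply: simmx_dsum; first exact: simmx_refl.
by apply: simmx_dsum; apply: simmx_jordan_blockN.
Qed.

Lemma pseudo_Kahler_line (a : R) : has_pseudo_Kahler (jordan_block 0 a).
Proof.
exists 1%:M, 0, 0, 1%:M; split.
- split=> [|x]; first exact: oner_neq0.
  by rewrite mul1mx => ->; rewrite !mulmx0 oppr0.
- split; rewrite ?trmx0 ?oppr0 ?mulmx0 ?mul0mx ?oppr0 ?oner_neq0 //.
  by move=> x _; exists (x 0 0); rewrite {1}[x]mx11_scalar scalemx1.
- by move=> x y _ _; rewrite !(mul0mx, mulmx0, trmx0).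
Qed.

(** For a nilpotent pair of blocks, one of the two sizes is even, and the
    alternating antidiagonal form is skew exactly in even size. *)
Lemma pseudo_Kahler_steps k (a : R) (t : seq (jsymbol R)) :
  a = 0 \/ k = 0%N -> seq_mset t = steps k a -> has_pseudo_Kahler (jordan_mx t).
Proof.
case: k => [|m] a0 def_t.
  have p_t : perm_eq t [:: Jsym 0 a].
    apply/eq_seq_msetP/msetP => s; rewrite def_t !msetnE mset_seqE /=.
    by rewrite [_ == s]eq_sym; case: eqP.
  apply: has_pseudo_Kahler_sim (perm_jordan_mx p_t) _.
  exact: has_pseudo_Kahler_sim (jordan_mx1 (Jsym 0 a)) (pseudo_Kahler_line a).
have {}a0 : a = 0 by case: a0.
rewrite {}a0 in def_t.
have p_t : perm_eq t [:: Jsym m.+1 0; Jsym m 0].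
  apply/eq_seq_msetP/msetP => s; rewrite def_t !msetE2 !msetnE mset_seqE /=.
  by rewrite ![_ == s]eq_sym; do 2!case: eqP.
apply: has_pseudo_Kahler_sim (perm_jordan_mx p_t) _.
apply: has_pseudo_Kahler_sim (jordan_mx2 _ _) _.
have skew n : odd n -> (altmx R n)^T = - altmx R n.
  by move=> n_odd; rewrite altmx_tr -signr_odd n_odd scaleN1r.
(* The smaller block has size [m.+1], the larger one [m.+2]. *)
have [m_odd|m_even] := boolP (odd m).
  apply: pseudo_Kahler_proj (jordan_block_inclusion _ _) (jordan_block_quotient _ _)
    (unlift_lift_jordan_block m) (altmx_unit R m) (skew _ m_odd) _.
  exact: altmx_jordan_block.
apply: pseudo_Kahler_skew (jordan_block_inclusion _ _) (altmx_unit R m.+1) _ _.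
  exact: skew.
exact: altmx_jordan_block.
Qed.

End ExceptionalBlocks.

(** * Constraints on the kernel dimensions *)

Section Constraints.
Variable R : rcfType.

Lemma col_matrixP m n (A B : 'M[R]_(m, n)) :
  (forall j, col j A = col j B) -> A = B.
Proof.
by move=> AB; apply/matrixP => i j; have /matrixP /(_ i 0) := AB j; rewrite !mxE.
Qed.

Lemma col_mul m n p (A : 'M[R]_(m, n)) (B : 'M[R]_(n, p)) j :
  col j (A *m B) = A *m col j B.
Proof. by rewrite !colE mulmxA. Qed.

Lemma row_dual n (f : 'rV[R]_n) : f != 0 -> exists eta : 'cV_n, f *m eta = 1%:M.
Proof.
move=> /matrix0Pn [i [j]]; rewrite ord1 => fj0.
exists ((f 0 j)^-1 *: delta_mx j 0); rewrite -scalemxAr -colE.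
by apply/matrixP => u v; rewrite !ord1 !mxE mulVf.
Qed.

Lemma row_vanishing n (f g : 'rV[R]_n) : f != 0 ->
  (forall x : 'cV_n, f *m x = 0 -> g *m x = 0) -> exists a, g = a *: f.
Proof.
move=> /row_dual [eta fe] gf; exists ((g *m eta) 0 0).
have g0 : g *m (1%:M - eta *m f) = 0.
  apply: col_matrixP => j; rewrite col_mul raddf0 gf //.
  by rewrite -col_mul mulmxBr mulmx1 mulmxA fe mul1mx subrr raddf0.
move/eqP: g0; rewrite mulmxBr mulmx1 subr_eq0 mulmxA => /eqP gE.
by rewrite {1}gE {1}[g *m eta]mx11_scalar mul_scalar_mx.
Qed.

Lemma complex_matrix_even r (X : 'M[R]_r) : X *m X = - 1%:M -> ~~ odd r.
Proof.
move=> /(congr1 determinant); rewrite det_mulmx -scaleN1r detZ det1 mulr1.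
move=> dX; apply/negP => r_odd; have := sqr_ge0 (\det X).
by rewrite expr2 dX -signr_odd r_odd oppr_ge0 ler10.
Qed.

Lemma mxev_eigen_row n (D : 'M[R]_n) f a p :
  f *m D = a *: f -> f *m mxev D p = p.[a] *: f :> 'rV_n.
Proof.
move=> fD; elim/poly_ind: p => [|p c IH].
  by rewrite mxev0 mulmx0 horner0 scale0r.
rewrite mxevD mxevM mxevX mxevC mulmxDr mulmxA IH -scalemxAl fD mul_mx_scalar.
by rewrite scalerA -scalerDl !hornerE.
Qed.

Lemma mxev_eigen_col n (D : 'M[R]_n) z b p :
  D *m z = b *: z -> mxev D p *m z = p.[b] *: z :> 'cV_n.
Proof.
move=> Dz; have := @mxev_eigen_row _ D^T z^T b p.
rewrite mxev_tr -!trmx_mul Dz linearZ /= => /(_ erefl) /(congr1 trmx).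
by rewrite !trmxK linearZ /= trmxK.
Qed.

Section Parity.
Variables (n : nat) (D : 'M[R]_n) (f : 'rV[R]_n) (J : 'M[R]_n).
Hypothesis HJ : complex_hyperplane D f J.
Local Notation ker p := (kermx (mxev D p)^T).

Lemma complex_hyperplane_mx k (C : 'M[R]_(n, k)) : f *m C = 0 ->
  [/\ f *m (J *m C) = 0, f *m (D *m C) = 0, J *m (J *m C) = - C &
      D *m (J *m C) = J *m (D *m C)].
Proof.
move=> fC0; have fc j : f *m col j C = 0 by rewrite -col_mul fC0 raddf0.
split; apply: col_matrixP => j; have [e1 e2 e3 e4] := HJ.2 _ (fc j).
- by rewrite !col_mul e1 raddf0.
- by rewrite !col_mul e2 raddf0.
- by rewrite !col_mul e3 linearN.
- by rewrite !col_mul e4.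
Qed.

Lemma complex_hyperplane_eigen : exists a, f *m D = a *: f.
Proof.
apply: row_vanishing HJ.1 _ => x fx0.
by rewrite -mulmxA; have [] := HJ.2 x fx0.
Qed.

Lemma complex_hyperplane_mxev p k (C : 'M[R]_(n, k)) : f *m C = 0 ->
  f *m (mxev D p *m C) = 0 /\ mxev D p *m (J *m C) = J *m (mxev D p *m C).
Proof.
elim/poly_ind: p k C => [|p c IH] k C fC0.
  by rewrite mxev0 !mul0mx !mulmx0.
rewrite mxevD mxevM mxevX mxevC !mulmxDl !mulmxDr -!mulmxA !mul_scalar_mx.
have [fJ fD JJ DJ] := complex_hyperplane_mx fC0.
have [fp pJ] := IH _ _ fD; rewrite fp -scalemxAr fC0 scaler0 addr0; split=> //.
by rewrite DJ pJ -scalemxAr.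
Qed.

(** The complex structure acts on the part of the kernel inside the
    hyperplane, which therefore has even dimension. *)
Lemma kdim_parity p : odd (kdim D p) = (ker p *m f^T != 0).
Proof.
rewrite kdimE -(mxrank_mul_ker _ f^T) oddD.
set I := (_ :&: _)%MS.
have [r [L [-> eqL freeL]]] : exists r (L : 'M_(r, n)),
    [/\ \rank I = r, (L :=: I)%MS & row_free L].
  by exists (\rank I), (row_base I); rewrite row_base_free; split=> //;
    apply: eq_row_base.
have [fL ML] : f *m L^T = 0 /\ mxev D p *m L^T = 0.
  have : (L <= ker p :&: kermx f^T)%MS by rewrite eqL.
  rewrite sub_capmx => /andP[/sub_kermxP LM /sub_kermxP Lf].
  by split; apply: trmx_inj; rewrite trmx_mul trmxK ?LM ?Lf trmx0.
have [fJ _ JJ _] := complex_hyperplane_mx fL.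
have [_ pJ] := complex_hyperplane_mxev p fL.
have /submxP [X LX] : (L *m J^T <= L)%MS.
  rewrite eqL sub_capmx; apply/andP; split; apply/sub_kermxP.
    by apply: trmx_inj; rewrite !trmx_mul !trmxK pJ ML mulmx0 trmx0.
  by apply: trmx_inj; rewrite !trmx_mul !trmxK fJ trmx0.
have XX : X *m X = - 1%:M.
  apply: (row_free_inj freeL); rewrite -mulmxA -LX mulmxA -LX.
  rewrite mulNmx mul1mx; apply: trmx_inj.
  by rewrite !trmx_mul trmxK JJ [RHS]linearN.
rewrite (negPf (complex_matrix_even XX)) addbF -mxrank_eq0.
by have := rank_leq_col (ker p *m f^T); case: (\rank _) => [|[]].
Qed.

Lemma kdim_even p a : f *m D = a *: f -> ~~ root p a -> ~~ odd (kdim D p).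
Proof.
move=> fD pa; rewrite kdim_parity negbK; have := mulmx_ker (mxev D p)^T.
move=> /(congr1 (mulmx^~ f^T)); rewrite mul0mx -mulmxA -trmx_mul.
rewrite (mxev_eigen_row p fD) linearZ /= -scalemxAr => /eqP.
by rewrite scaler_eq0 -rootE (negPf pa).
Qed.

Lemma kdim_odd p (x : 'cV_n) : mxev D p *m x = 0 -> f *m x != 0 -> odd (kdim D p).
Proof.
move=> px; rewrite kdim_parity; apply: contraNneq => Kf.
have /submxP [Y xE] : (x^T <= ker p)%MS.
  by apply/sub_kermxP; rewrite -trmx_mul px trmx0.
by rewrite -[x]trmxK xE -[f]trmxK -trmx_mul -mulmxA Kf mulmx0 trmx0.
Qed.

Lemma kdim_odd_witness p : odd (kdim D p) ->
  exists x : 'cV_n, mxev D p *m x = 0 /\ f *m x != 0.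
Proof.
rewrite kdim_parity => /matrix0Pn [i [j nz]].
exists (row i (ker p))^T; split.
  by apply: trmx_inj; rewrite trmx_mul trmxK trmx0 -row_mul mulmx_ker row0.
apply: contraNneq nz => /(congr1 trmx); rewrite trmx_mul trmxK trmx0 -row_mul.
by move=> /matrixP /(_ 0 j); rewrite !mxE => ->.
Qed.

(** Once a kernel of a power of [D - a] leaves the hyperplane, all larger ones
    do, which gives the threshold [k]. One of them does leave it: it contains the
    image of [r(D)], where [r] is the cofactor in the characteristic polynomial,
    and [f r(D)] is the nonzero multiple [r(a) f] of [f]. *)
Lemma complex_parity : exists a k, f *m D = a *: f /\
  forall x j, odd (kdim D (('X - x%:P) ^+ j)) = (x == a) && (k < j)%N.
Proof.
have [a fD] := complex_hyperplane_eigen.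
have [j0 [r]] := multiplicity_XsubC (char_poly D) a.
rewrite (monic_neq0 (char_poly_monic D)) /= => ra chiE.
have [x frx] : exists x : 'cV_n, f *m (mxev D r *m x) != 0.
  have [eta fe] := row_dual HJ.1; exists eta.
  rewrite mulmxA (mxev_eigen_row r fD) -scalemxAl fe scaler_eq0 -rootE negb_or ra.
  exact: oner_neq0.
have ex_odd : exists j, odd (kdim D (('X - a%:P) ^+ j)).
  exists j0; apply: kdim_odd frx.
  by rewrite mulmxA -mxevM mulrC -chiE mxev_char mul0mx.
have odd_mono j : odd (kdim D (('X - a%:P) ^+ j)) ->
    odd (kdim D (('X - a%:P) ^+ j.+1)).
  move=> /kdim_odd_witness [y [py fy]]; apply: kdim_odd fy.
  by rewrite exprS mxevM -mulmxA py mulmx0.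
have [k' k'_odd k'_min] := ex_minnP ex_odd.
have k'_gt0 : (0 < k')%N.
  by case: k' k'_odd {k'_min} => //; rewrite /kdim expr0 mxevC mxrank1 subnn.
exists a, k'.-1; split=> // y j; have [->|neq_ya] := eqVneq y a.
  rewrite /= prednK //; apply/idP/idP => [/k'_min //|/subnK <-].
  by elim: (j - k')%N => // i IH; rewrite addSn odd_mono.
apply: negbTE; apply: kdim_even fD _.
rewrite /root horner_exp !hornerE expf_eq0 negb_and subr_eq0 eq_sym neq_ya.
by rewrite orbT.
Qed.

End Parity.

Lemma kdim_XsubC_opp n (D : 'M[R]_n) x j :
  kdim D ((('X - x%:P) ^+ j) \Po (- 'X)) = kdim D (('X - (- x)%:P) ^+ j).
Proof.
have -> : ((('X - x%:P) ^+ j) \Po (- 'X)) = ((-1) ^+ j)%:P * ('X - (- x)%:P) ^+ j.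
  rewrite rmorphXn /= comp_polyB comp_polyX comp_polyC polyCN opprK -opprD.
  by rewrite -[- (_ + _)]mulN1r exprMn polyC_exp polyCN.
rewrite /kdim mxevM mxevC mul_scalar_mx mxrank_scale_nz // expf_neq0 //.
by rewrite oppr_eq0 oner_eq0.
Qed.

Section Symplectic.
Variables (n : nat) (D B : 'M[R]_n) (z : 'cV[R]_n).
Hypothesis HB : corank1_invariant_form D B z.

Lemma corank1_eigen : exists b, D *m z = b *: z.
Proof.
have [_ DB _ Bz kerB] := HB; apply: kerB; apply/eqP.
by rewrite mulmxA -eqr_opp oppr0 -mulNmx -DB -mulmxA Bz mulmx0.
Qed.

(** [B] maps the kernel of [p(D)] to that of [p(- D^T)], which has the dimension
    of the kernel of [p(- D)], and only kills the multiples of [z]. *)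
Lemma symplectic_inequality b p : D *m z = b *: z ->
  (kdim D p <= kdim D (p \Po (- 'X)) + root p b)%N.
Proof.
have [Bt DB z0 Bz kerB] := HB; move=> Dz.
rewrite -kdimN -[kdim (- D) p]kdim_tr !kdimE [(- D)^T]linearN /=.
set K := kermx _; set K' := kermx _.
have KB : (K *m B^T <= K')%MS.
  apply/sub_kermxP; rewrite -mulmxA -trmx_mul.
  have -> : mxev (- D^T) p *m B = B *m mxev D p.
    by apply: mxev_inter; rewrite mulNmx DB opprK.
  by rewrite trmx_mul mulmxA mulmx_ker mul0mx.
have := mxrankS KB; rewrite -(mxrank_mul_ker K B^T); set I := (K :&: _)%MS.
suff : (\rank I <= root p b)%N by lia.
have Iz : (I <= z^T)%MS.
  apply/row_subP => i; have : (row i I <= kermx B^T)%MS.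
    by apply: submx_trans (row_sub _ _) (capmxSr _ _).
  move=> /sub_kermxP /(congr1 trmx); rewrite trmx_mul trmxK trmx0 => /kerB [s E].
  by rewrite -[row i I]trmxK E linearZ /= scalemx_sub.
have [pb|pb] := boolP (root p b).
  by apply: leq_trans (mxrankS Iz) (rank_leq_row _).
have /submxP [Y IY] := Iz.
have /sub_kermxP IM : (I <= K)%MS by apply: capmxSl.
suff -> : I = 0 by rewrite mxrank0.
apply/eqP; move/eqP: IM; rewrite {1}IY -mulmxA -trmx_mul (mxev_eigen_col p Dz).
by rewrite linearZ /= -scalemxAr -IY scaler_eq0 -rootE (negPf pb).
Qed.

End Symplectic.

(** If the kernel [z] of a compatible form lies in the hyperplane, then [J z] is
    orthogonal to the whole hyperplane. *)
Lemma compatible_kernel n (D : 'M[R]_n) f J B z :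
  complex_hyperplane D f J -> corank1_invariant_form D B z ->
  J_invariant_on f J B -> f *m z = 0 ->
  exists2 l, l != 0 & (J *m z)^T *m B = l *: f.
Proof.
move=> HJ HB HJB fz.
have [Bt DB z0 Bz kerB] := HB; have [fJz _ JJz _] := HJ.2 z fz.
have zB : z^T *m B = 0.
  by apply: trmx_inj; rewrite trmx_mul trmxK Bt mulNmx Bz oppr0 trmx0.
have [l gE] : exists l, (J *m z)^T *m B = l *: f.
  apply: row_vanishing HJ.1 _ => x fx; have [fJx _ JJx _] := HJ.2 x fx.
  have -> : x = J *m (- (J *m x)) by rewrite mulmxN JJx opprK.
  by rewrite HJB ?mulmxN ?fJx ?oppr0 // zB mul0mx oppr0.
exists l => //; apply: contraNneq z0 => l0; rewrite l0 scale0r in gE.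
have /kerB [s Js] : B *m (J *m z) = 0.
  by apply: trmx_inj; rewrite trmx_mul Bt mulmxN gE oppr0 trmx0.
move: JJz; rewrite Js -scalemxAr Js scalerA => /eqP.
rewrite -addr_eq0 -[X in _ + X]scale1r -scalerDl scaler_eq0 => /orP[|//].
by rewrite paddr_eq0 ?sqr_ge0 ?ler01 // -?expr2 ?sqr_ge0 // oner_eq0 andbF.
Qed.

(** Here [J z] has the same eigenvalue as [z], and the form, for which [D] is
    skew, turns it into a multiple of [f]. *)
Lemma pseudo_Kahler_eigenvalues n (D : 'M[R]_n) f J B z a b :
  complex_hyperplane D f J -> corank1_invariant_form D B z ->
  J_invariant_on f J B -> f *m D = a *: f -> D *m z = b *: z ->
  f *m z = 0 -> a = - b.
Proof.
move=> HJ HB HJB fD Dz fz.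
have [l l0 gE] := compatible_kernel HJ HB HJB fz.
have [_ DB _ _ _] := HB; have [_ _ _ DJz] := HJ.2 z fz.
have := congr1 (mulmx (J *m z)^T) DB.
rewrite mulmxA -trmx_mul DJz Dz -scalemxAr linearZ /= -scalemxAl gE.
rewrite mulmxN mulmxA gE -scalemxAl fD !scalerA -scaleNr => /eqP.
rewrite -subr_eq0 -scalerBl scaler_eq0 (negPf HJ.1) orbF opprK.
rewrite [b * l]mulrC -mulrDr mulf_eq0 (negPf l0) /= addrC addr_eq0.
by move/eqP.
Qed.

Lemma rk_cat (t1 t2 : seq (jsymbol R)) x j :
  rk (t1 ++ t2) x j = (rk t1 x j + rk t2 x j)%N.
Proof. by rewrite /rk big_cat. Qed.

(** The kernel dimensions determine both eigenvalues: at [c] they are odd beyond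
    [m.+1], and there they exceed those at [- c] by one. *)
Lemma exceptional_not_pseudo_Kahler n (D : 'M[R]_n) m (c : R)
    (tq : seq (jsymbol R)) : c != 0 -> in_Q (seq_mset tq) ->
  simmx D (jordan_mx ([:: Jsym m.+1 c; Jsym m c; Jsym m (- c); Jsym m (- c)] ++ tq)) ->
  ~ has_pseudo_Kahler D.
Proof.
move=> c0 Qq DT [f [J [B [z [HJ HB HJB]]]]].
have [a [k [fD par]]] := complex_parity HJ.
have [b Dz] := corank1_eigen HB.
have kE x j := kdim_rk x j DT.
have qE x j := in_Q_rk Qq erefl x j.
have cNc : (- c == c) = false.
  by rewrite eq_sym -addr_eq0 -mulr2n mulrn_eq0 (negPf c0).
have rc j : rk [:: Jsym m.+1 c; Jsym m c; Jsym m (- c); Jsym m (- c)] c j =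
    (minn j m.+2 + minn j m.+1)%N.
  by rewrite /rk !big_cons big_nil /= eqxx cNc !mul1n !mul0n !addn0.
have rNc j : rk [:: Jsym m.+1 c; Jsym m c; Jsym m (- c); Jsym m (- c)] (- c) j =
    (minn j m.+1 + minn j m.+1)%N.
  by rewrite /rk !big_cons big_nil /= eqxx [c == _]eq_sym cNc !mul1n !mul0n addn0.
have c_odd j : odd (kdim D (('X - c%:P) ^+ j)) = odd (minn j m.+2 + minn j m.+1).
  by rewrite kE rk_cat oddD (negPf (qE c j).1) addbF rc.
have ca : c = a.
  have := c_odd m.+2; rewrite par minnn (minn_idPr (leqnSn _)) oddD /=.
  by case: (odd m) => /= /andP [/eqP].
have cb : c = b.
  have := symplectic_inequality HB (('X - c%:P) ^+ m.+2) Dz.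
  rewrite kdim_XsubC_opp !kE !rk_cat rc rNc (qE c _).2 minnn (minn_idPr (leqnSn _)).
  rewrite /root horner_exp !hornerE expf_eq0 /= subr_eq0 [b == c]eq_sym.
  by case: eqP => // _; lia.
have [fz|fz] := eqVneq (f *m z) 0.
  have := pseudo_Kahler_eigenvalues HJ HB HJB fD Dz fz.
  by rewrite -ca -cb => /esym /eqP; rewrite cNc.
have : odd (kdim D (('X - c%:P) ^+ 1)).
  apply: kdim_odd HJ _ _ _ fz.
  by rewrite expr1 mxevB mxevX mxevC mulmxBl Dz cb mul_scalar_mx subrr.
by rewrite c_odd !(minn_idPl _).
Qed.

End Constraints.

(** * From the Lie algebra to its abelian ideal and back *)

Section Translation.
Variable R : rcfType.

Lemma col_linear_mx m n (F : 'cV[R]_n -> 'cV[R]_m) :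
  (forall a u v, F (a *: u + v) = a *: F u + F v) ->
  exists A : 'M[R]_(m, n), forall v, F v = A *m v.
Proof.
move=> linF; exists (\matrix_(i, j) F (delta_mx j 0) i 0) => v.
have F0 : F 0 = 0.
  have := linF 1 0 0; rewrite !scale1r addr0 => F00.
  by apply: (addrI (F 0)); rewrite -F00 addr0.
have FD u w : F (u + w) = F u + F w by rewrite -{1}[u]scale1r linF scale1r.
have FZ a u : F (a *: u) = a *: F u by rewrite -[a *: u]addr0 linF F0 addr0.
have {1}-> : v = \sum_j v j 0 *: delta_mx j 0.
  apply/matrixP => i j; rewrite ord1 summxE (bigD1 i) //= !mxE !eqxx mulr1.
  by rewrite big1 ?addr0 // => k /negPf neq_k; rewrite !mxE eq_sym neq_k mulr0.
rewrite (big_morph F FD F0); apply/matrixP => i j; rewrite ord1 summxE mxE.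
by apply: eq_bigr => k _; rewrite FZ !mxE mulrC.
Qed.

Variables (n : nat) (D : 'M[R]_n).
Local Notation g := (almost_abelian D).
Local Notation vec x := (x.1 : 'cV[R]_n).
Local Notation sca x := (x.2 : R).

Definition pair_g (v : 'cV[R]_n) (s : R) : g := (v, s).

Lemma pair_gE (x : g) : x = pair_g x.1 x.2. Proof. by case: x. Qed.

Lemma lie_g v s u t : [lie pair_g v s, pair_g u t] =
  pair_g (s *: (D *m u) - t *: (D *m v)) 0.
Proof. by []. Qed.

Lemma addg v s u t : pair_g v s + pair_g u t = pair_g (v + u) (s + t).
Proof. by []. Qed.

Lemma oppg v s : - pair_g v s = pair_g (- v) (- s).
Proof. by []. Qed.

Lemma scaleg a v s : a *: pair_g v s = pair_g (a *: v) (a * s).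
Proof. by []. Qed.

Lemma pair_g0 : 0 = pair_g 0 0.
Proof. by []. Qed.

Lemma pair_g_inj v s u t : pair_g v s = pair_g u t -> v = u /\ s = t.
Proof. by case. Qed.

(** ** Complex structures *)

(** The row [f] reads off the component along [e] of [J v]. Integrability for [v]
    in its kernel and [e] says that [Z = D J v - J D v] satisfies [J Z = r Z] with
    [r] real, which together with [J^2 = -1] leaves only [Z = 0]. *)
Lemma complex_structure_hyperplane (J : 'End(g)) : complex_structure J ->
  exists f J1, complex_hyperplane D f J1 /\
    forall v, J (pair_g v 0) = pair_g (J1 *m v) ((f *m v) 0 0).
Proof.
move=> [JJ Jint].
have lin1 a u v : (J (pair_g (a *: u + v) 0)) =
    a *: J (pair_g u 0) + J (pair_g v 0).
  by rewrite -linearP; congr (J _); rewrite scaleg addg mulr0 addr0.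
have [J1 J1E] : exists J1 : 'M_n, forall v, vec (J (pair_g v 0)) = J1 *m v.
  by apply: col_linear_mx => a u v; rewrite lin1.
have [f fE] : exists f : 'rV_n, forall v, (sca (J (pair_g v 0)))%:M = f *m v.
  apply: (@col_linear_mx 1) => a u v; rewrite lin1 /= raddfD /=.
  by rewrite -scale_scalar_mx.
have Jv v : J (pair_g v 0) = pair_g (J1 *m v) ((f *m v) 0 0).
  by rewrite [LHS]pair_gE J1E -fE !mxE mulr1n.
exists f, J1; split=> //.
pose y : 'cV_n := vec (J (pair_g 0 1)); pose r : R := sca (J (pair_g 0 1)).
have Je s : J (pair_g 0 s) = pair_g (s *: y) (s * r).
  have -> : pair_g 0 s = s *: pair_g 0 1 by rewrite scaleg scaler0 mulr1.
  by rewrite linearZ /= [J (pair_g 0 1)]pair_gE scaleg.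
have Jg v s : J (pair_g v s) = pair_g (J1 *m v + s *: y) ((f *m v) 0 0 + s * r).
  have -> : pair_g v s = pair_g v 0 + pair_g 0 s by rewrite addg addr0 add0r.
  by rewrite linearD /= Jv Je addg.
split.
  apply/eqP => f0; have := JJ (pair_g 0 1).
  rewrite !Jg f0 !mul0mx mxE oppg => /pair_g_inj [_ /eqP].
  rewrite !mul1r !add0r -subr_eq0 opprK -expr2 => /eqP rr.
  by have := sqr_ge0 r; rewrite -[r ^+ 2](addrK 1) rr sub0r oppr_ge0 ler10.
have zE : (0 : 'M[R]_1) 0 0 = 0 by rewrite mxE.
have oppE (M : 'M[R]_1) : (- M) 0 0 = - M 0 0 by rewrite mxE.
have sclE a (M : 'M[R]_1) : (a *: M) 0 0 = a * M 0 0 by rewrite mxE.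
have f00 (v : 'cV_n) : (f *m v) 0 0 = 0 -> f *m v = 0.
  by move=> e; rewrite [f *m v]mx11_scalar e raddf0.
have JW (v : 'cV_n) : f *m v = 0 -> f *m (J1 *m v) = 0 /\ J1 *m (J1 *m v) = - v.
  move=> fv; have := JJ (pair_g v 0); rewrite Jv fv mxE Jv oppg.
  by move=> /pair_g_inj [-> e]; split=> //; apply: f00; rewrite e oppr0.
have N (v : 'cV_n) : f *m v = 0 ->
    [/\ (f *m (D *m (J1 *m v))) 0 0 = - r * (f *m (D *m v)) 0 0 &
        - (D *m v) - J1 *m (D *m (J1 *m v)) - r *: (J1 *m (D *m v))
          + r *: (D *m (J1 *m v)) = 0].
  move=> fv; have := Jint (pair_g v 0) (pair_g 0 1).
  rewrite Jv fv zE Jg !mulmx0 zE scale1r mul1r !add0r !lie_g !mulmx0 !scaler0 !scale0r !scale1r !sub0r.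
  rewrite !Jg !scale0r !mul0r !addr0 oppg !addg pair_g0.
  move=> /pair_g_inj [e1 e2]; split; last first.
    by rewrite -[RHS]e1 !mulmxN !opprK -scalemxAr.
  move: e2; rewrite !mulmxN -!scalemxAr !oppE sclE oppr0 addr0 add0r => /eqP.
  by rewrite subr_eq0 eqr_oppLR mulNr => /eqP.
move=> x fx; have [fJx JJx] := JW x fx.
have [e1 e2] := N x fx; have [e1' _] := N _ fJx.
have fDx : f *m (D *m x) = 0.
  apply: f00; move: e1'; rewrite JJx !mulmxN oppE e1 !mulNr mulrN opprK => e.
  have : (1 + r * r) * (f *m (D *m x)) 0 0 = 0.
    by rewrite mulrDl mul1r -mulrA -e subrr.
  move/eqP; rewrite mulf_eq0 => /orP[/eqP rr|/eqP //].
  by have := sqr_ge0 r; rewrite expr2 -[r * r](addKr 1) rr addr0 oppr_ge0 ler10.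
have fDJx : f *m (D *m (J1 *m x)) = 0 by apply: f00; rewrite e1 fDx mxE mulr0.
split=> //; apply/eqP; rewrite -subr_eq0; apply/eqP.
set Z := _ - _.
have fZ : f *m Z = 0 by rewrite mulmxBr fDJx (JW _ fDx).1 subrr.
have JZ : J1 *m Z = r *: Z.
  apply/eqP; rewrite -subr_eq0 mulmxBr (JW _ fDx).2 opprK.
  rewrite scalerBr; move: e2.
  move: (D *m x) (J1 *m (D *m _)) (r *: _) (r *: _) => u1 u2 u3 u4 /eqP.
  by rewrite -oppr_eq0 !opprD !opprK [u1 + u2]addrC -addrA [- u3 + u4]addrC.
have := (JW _ fZ).2; rewrite JZ -scalemxAr JZ scalerA => /eqP.
rewrite -addr_eq0 -[X in _ + X]scale1r -scalerDl scaler_eq0 => /orP[/eqP rr|/eqP //].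
by have := sqr_ge0 r; rewrite expr2 -[r * r](addrK 1) rr sub0r oppr_ge0 ler10.
Qed.

End Translation.

Section ComplexConverse.
Variables (R : rcfType) (n : nat) (D : 'M[R]_n).
Variables (f : 'rV[R]_n) (J : 'M[R]_n) (eta : 'cV[R]_n).
Local Notation g := (almost_abelian D).

Definition J_proj := J *m (1%:M - eta *m f).

(** On the hyperplane this is [J], and [eta] goes to the generator [e]. *)
Definition J_ext (x : g) : g :=
  pair_g D (J_proj *m x.1 - x.2 *: eta) ((f *m x.1) 0 0).

Fact J_ext_linear : GRing.linear_for *:%R J_ext.
Proof.
move=> a [v s] [u t]; congr (_, _) => /=; last first.
  by rewrite mulmxDr -scalemxAr !mxE.
rewrite mulmxDr -scalemxAr scalerDl scalerBr scalerA opprD addrACA.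
by congr (_ + _).
Qed.

HB.instance Definition _ := GRing.isLinear.Build R g g *:%R J_ext J_ext_linear.

Lemma addg3 v1 v2 v3 :
  pair_g D v1 0 + pair_g D v2 0 - pair_g D v3 0 = pair_g D (v1 + v2 - v3) 0.
Proof. by congr (_, _); rewrite /= subr0 addr0. Qed.

Lemma J_extD (x y : g) : J_ext x + J_ext y = J_ext (x + y).
Proof. exact: esym (linearD _ _ _). Qed.

Hypotheses (HJ : complex_hyperplane D f J) (fe : f *m eta = 1%:M).

Lemma J_proj_hyperplane (v : 'cV[R]_n) a : f *m v = 0 ->
  J_proj *m (v + a *: eta) = J *m v.
Proof.
move=> fv; rewrite /J_proj -mulmxA; congr (_ *m _).
rewrite mulmxBl mul1mx -mulmxA mulmxDr fv add0r -scalemxAr fe.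
by rewrite -scalemxAr mulmx1 addrK.
Qed.

Lemma hyperplane_split (v : 'cV[R]_n) :
  exists p a, f *m p = 0 /\ v = p + a *: eta.
Proof.
exists (v - (f *m v) 0 0 *: eta), ((f *m v) 0 0); rewrite subrK; split=> //.
rewrite mulmxBr -scalemxAr fe scalemx1 -mx11_scalar; exact: subrr.
Qed.

Lemma f_split (v : 'cV[R]_n) a : f *m v = 0 -> (f *m (v + a *: eta)) 0 0 = a.
Proof.
by move=> fv; rewrite mulmxDr fv add0r -scalemxAr fe !mxE mulr1.
Qed.

Lemma J_extE v a s : f *m v = 0 ->
  J_ext (pair_g D (v + a *: eta) s) = pair_g D (J *m v - s *: eta) a.
Proof. by move=> fv; rewrite /J_ext /= J_proj_hyperplane // f_split. Qed.

Lemma J_ext_sqr x : J_ext (J_ext x) = - x.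
Proof.
rewrite [x]pair_gE; move: x.1 x.2 => v s.
have [p [a [fp ->]]] := hyperplane_split v.
have [fJp _ JJp _] := HJ.2 p fp.
by rewrite J_extE // -scaleNr J_extE // JJp oppg opprD.
Qed.

Lemma J_ext_integrable x y :
  [lie x, y] + J_ext [lie J_ext x, y] + J_ext [lie x, J_ext y]
  - [lie J_ext x, J_ext y] = 0.
Proof.
rewrite [x]pair_gE [y]pair_gE; move: x.1 x.2 y.1 y.2 => v s u t {x y}.
have [p [a [fp ->]]] := hyperplane_split v.
have [q [b [fq ->]]] := hyperplane_split u.
have [fJp fDp JJp DJp] := HJ.2 p fp; have [fJq fDq JJq DJq] := HJ.2 q fq.
have [_ fDJp _ DJJp] := HJ.2 _ fJp; have [_ fDJq _ DJJq] := HJ.2 _ fJq.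
rewrite -[X in X - _]addrA J_extD !J_extE // !lie_g [X in J_ext X]addg.
(* The sum of the two brackets under [J], once the multiples of [D eta] cancel. *)
pose w := a *: (D *m q) - t *: (D *m (J *m p)) + (s *: (D *m (J *m q)) - b *: (D *m p)).
have fw : f *m w = 0.
  by rewrite /w !mulmxDr !mulmxN -!scalemxAr fDp fDq fDJp fDJq !scaler0 !subr0 addr0.
have -> : a *: (D *m (q + b *: eta)) - t *: (D *m (J *m p - s *: eta)) +
    (s *: (D *m (J *m q - t *: eta)) - b *: (D *m (p + a *: eta))) = w + 0 *: eta.
  rewrite /w !mulmxDr !mulmxN -!scalemxAr.
  move: (D *m p) (D *m q) (D *m (J *m p)) (D *m (J *m q)) (D *m eta) => A1 A2 A3 A4 A5.
  by apply/matrixP => i j; rewrite !mxE; ring.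
rewrite addr0 J_extE // scale0r subr0 addg3 pair_g0; congr pair_g.
rewrite /w !mulmxDr !mulmxN -!scalemxAr -DJp -DJq -DJJp -DJJq JJp JJq.
rewrite !mulmxN.
move: (D *m p) (D *m q) (D *m (J *m p)) (D *m (J *m q)) (D *m eta) => A1 A2 A3 A4 A5.
by apply/matrixP => i j; rewrite !mxE; ring.
Qed.

Lemma complex_structure_ext : complex_structure (linfun J_ext).
Proof.
split=> [x|x y]; rewrite !lfunE /=; first exact: J_ext_sqr.
exact: J_ext_integrable.
Qed.

End ComplexConverse.

(** ** Symplectic and pseudo-Kahler structures *)

Section Forms.
Variables (R : rcfType) (n : nat) (D : 'M[R]_n).
Local Notation g := (almost_abelian D).
Implicit Types (B : 'M[R]_n) (u v : 'cV[R]_n) (L : 'rV[R]_n).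

Definition bform B u v : R := (u^T *m B *m v) 0 0.
Definition rform L v : R := (L *m v) 0 0.

Lemma bform_linl B a u u' v : bform B (a *: u + u') v = a * bform B u v + bform B u' v.
Proof. by rewrite /bform linearP /= !mulmxDl -!scalemxAl !mxE. Qed.

Lemma bform_linr B a u v v' : bform B u (a *: v + v') = a * bform B u v + bform B u v'.
Proof. by rewrite /bform !mulmxDr -!scalemxAr !mxE. Qed.

Lemma rform_lin L a v v' : rform L (a *: v + v') = a * rform L v + rform L v'.
Proof. by rewrite /rform !mulmxDr -!scalemxAr !mxE. Qed.

Lemma bform_tr B u v : bform B u v = bform B^T v u.
Proof.
rewrite /bform; have -> : v^T *m B^T *m u = (u^T *m B *m v)^T.
  by rewrite !trmx_mul trmxK mulmxA.
by rewrite [RHS]mxE.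
Qed.

Lemma bform_skew B u v : B^T = - B -> bform B u v = - bform B v u.
Proof. by move=> Bt; rewrite bform_tr Bt /bform mulmxN mulNmx mxE. Qed.

Lemma bform_entry B i j : bform B (delta_mx i 0) (delta_mx j 0) = B i j.
Proof. by rewrite /bform trmx_delta -rowE -colE !mxE. Qed.

Lemma bform_mull B (M : 'M[R]_n) u v : bform (M^T *m B) u v = bform B (M *m u) v.
Proof. by rewrite /bform trmx_mul !mulmxA. Qed.

Lemma bform_mulr B (M : 'M[R]_n) u v : bform (B *m M) u v = bform B u (M *m v).
Proof. by rewrite /bform !mulmxA. Qed.

Lemma bformN B u v : bform (- B) u v = - bform B u v.
Proof. by rewrite /bform mulmxN mulNmx mxE. Qed.

Lemma bformNl B u v : bform B (- u) v = - bform B u v.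
Proof. by rewrite /bform linearN /= !mulNmx mxE. Qed.

Lemma bformNr B u v : bform B u (- v) = - bform B u v.
Proof. by rewrite /bform mulmxN mxE. Qed.

Lemma bform0l B u : bform B 0 u = 0.
Proof. by rewrite /bform trmx0 !mul0mx mxE. Qed.

Lemma bform0r B u : bform B u 0 = 0.
Proof. by rewrite /bform mulmx0 mxE. Qed.

Lemma rform0 L : rform L 0 = 0.
Proof. by rewrite /rform mulmx0 mxE. Qed.

Definition form_ext B L (x y : g) : R :=
  bform B x.1 y.1 + y.2 * rform L x.1 - x.2 * rform L y.1.

Lemma form_ext_bilinear B L : bilinear_for *%R *%R (form_ext B L).
Proof.
split=> [[v t] a [u s] [u' s']|[u s] a [v t] [v' t']]; rewrite /form_ext /=.
  by rewrite bform_linl rform_lin -[a *: s + s']/(a * s + s' : R); ring.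
by rewrite bform_linr rform_lin -[a *: t + t']/(a * t + t' : R); ring.
Qed.

Lemma form_ext_alternating B L x : B^T = - B -> form_ext B L x x = 0.
Proof.
move=> Bt; rewrite /form_ext addrK; have /eqP := bform_skew x.1 x.1 Bt.
by rewrite -addr_eq0 -mulr2n mulrn_eq0 => /eqP.
Qed.

(** The functional [L] pairs the ideal with [e]; it has to detect the kernel of
    the form on the ideal. *)
Lemma form_ext_symplectic B z L : corank1_invariant_form D B z ->
  L *m z != 0 -> symplectic_structure (form_ext B L).
Proof.
move=> [Bt DB z0 Bz kerB] Lz; split.
- exact: form_ext_bilinear.
- by move=> x; apply: form_ext_alternating.
- move=> [x s] x_ker.
  have Lx : L *m x = 0.
    have := x_ker (pair_g D 0 1); rewrite /form_ext /= bform0r rform0.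
    rewrite add0r mul1r mulr0 subr0 => Lx; rewrite [LHS]mx11_scalar.
    by rewrite -[X in X%:M]/(rform L x) Lx raddf0.
  have xB : x^T *m B = s *: L.
    apply/rowP => j; have := x_ker (pair_g D (delta_mx j 0) 0).
    rewrite /form_ext /bform /rform /= mul0r addr0 -!colE !mxE => /eqP.
    by rewrite subr_eq0 => /eqP.
  have s0 : s = 0.
    have := congr1 (mulmx^~ z) xB; rewrite -mulmxA Bz mulmx0 -scalemxAl => /esym/eqP.
    by rewrite scaler_eq0 (negPf Lz) orbF => /eqP.
  rewrite s0 scale0r in xB.
  have /kerB [r xE] : B *m x = 0.
    by apply: trmx_inj; rewrite trmx_mul Bt mulmxN xB oppr0 trmx0.
  move/eqP: Lx; rewrite xE -scalemxAr scaler_eq0 (negPf Lz) orbF => /eqP r0.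
  by rewrite s0 r0 scale0r.
- move=> [x s] [y t] [w r]; rewrite /form_ext /= !mul0r !subr0.
  have bD u v : bform B (D *m u) v = - bform B u (D *m v).
    by rewrite -bform_mull DB bformN bform_mulr.
  have rE a u b v : a *: u - b *: v = a *: u + ((- b) *: v + 0).
    by rewrite addr0 scaleNr.
  rewrite !rE !bform_linl !rform_lin !bform0l !rform0 !bD.
  have bS u v : bform B u (D *m v) = bform B v (D *m u).
    by rewrite bform_skew // bD opprK.
  by rewrite ?(bS y x) ?(bS w x) ?(bS w y); ring.
Qed.

(** Any functional not vanishing on the kernel will do. *)
Lemma symplectic_of_corank1 B z : corank1_invariant_form D B z ->
  exists w : g -> g -> R, symplectic_structure w.
Proof.
move=> HB; have [_ _ z0 _ _] := HB.
have zt0 : z^T != 0 by apply: contraNneq z0 => zt; rewrite -[z]trmxK zt trmx0.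
have [e ze] := row_dual zt0; exists (form_ext B e^T).
apply: form_ext_symplectic HB _; rewrite -[_ *m _]trmxK trmx_mul trmxK ze trmx1.
by apply/eqP => /matrixP /(_ 0 0); rewrite !mxE => /eqP; rewrite oner_eq0.
Qed.

Lemma bilinear_form_mx (w : g -> g -> R) : bilinear_for *%R *%R w ->
  exists B, forall u v, w (pair_g D u 0) (pair_g D v 0) = bform B u v.
Proof.
move=> [wl wr]; pose G (u : 'cV[R]_n) : 'cV[R]_n :=
  \col_j w (pair_g D u 0) (pair_g D (delta_mx j 0) 0).
have pair_lin a u v : pair_g D (a *: u + v) 0 = a *: pair_g D u 0 + pair_g D v 0.
  by rewrite scaleg addg mulr0 addr0.
have [A GA] : exists A : 'M_n, forall u, G u = A *m u.
  apply: col_linear_mx => a u v; apply/matrixP => i j.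
  by rewrite !mxE pair_lin wl.
exists A^T => u v.
have [r rE] : exists r : 'rV_n, forall v, (w (pair_g D u 0) (pair_g D v 0))%:M = r *m v.
  apply: (@col_linear_mx _ 1) => a x y; rewrite pair_lin wr raddfD /=.
  by rewrite -scale_scalar_mx.
have -> : w (pair_g D u 0) (pair_g D v 0) = (r *m v) 0 0 by rewrite -rE !mxE mulr1n.
rewrite /bform -trmx_mul -GA; congr ((_ *m _) 0 0).
apply/rowP => j; rewrite !mxE.
have /matrixP /(_ 0 0) := rE (delta_mx j 0); rewrite -colE !mxE => <-.
by rewrite mulr1n.
Qed.

Lemma skew_of_alternating (w : g -> g -> R) : bilinear_for *%R *%R w ->
  (forall x, w x x = 0) -> forall x y, w x y = - w y x.
Proof.
move=> [wl wr] walt x y; have := walt (x + y).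
have wDl (u v t : g) : w (u + v) t = w u t + w v t.
  by have := wl t 1 u v; rewrite scale1r /= mul1r.
have wDr (t u v : g) : w t (u + v) = w t u + w t v.
  by have := wr t 1 u v; rewrite scale1r /= mul1r.
by rewrite wDl !wDr !walt add0r addr0 => /eqP; rewrite addr_eq0 => /eqP.
Qed.

(** An alternating form in odd dimension has a kernel; two independent vectors
    in the kernel would have a combination orthogonal to [e] too, hence to
    everything. *)
Lemma symplectic_corank1 (w : g -> g -> R) : odd n -> symplectic_structure w ->
  exists B z, corank1_invariant_form D B z /\
    forall u v, w (pair_g D u 0) (pair_g D v 0) = bform B u v.
Proof.
move=> n_odd [wb walt wnd wcl]; have [B wB] := bilinear_form_mx wb.
have [wl wr] := wb.
have wskew := skew_of_alternating wb walt.
have wP a (x y u : g) : w (a *: x + y) u = a * w x u + w y u := wl u a x y.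
have Bt : B^T = - B.
  by apply/matrixP => i j; rewrite !mxE -!bform_entry -!wB wskew.
have DB : D^T *m B = - (B *m D).
  apply/matrixP => i j; rewrite -[LHS]bform_entry -[RHS]bform_entry.
  have := wcl (pair_g D 0 1) (pair_g D (delta_mx i 0) 0) (pair_g D (delta_mx j 0) 0).
  rewrite !lie_g !mulmx0 !scaler0 !scale1r !scale0r subrr subr0 sub0r.
  have -> : w (pair_g D 0 0) (pair_g D 0 1) = 0.
    rewrite -pair_g0; apply: (addrI (w 0 (pair_g D 0 1))).
    by rewrite addr0 -{1}[w 0 _]mul1r -wP scale1r addr0.
  rewrite addr0 !wB bformNl => /subr0_eq.
  by rewrite bform_mull bformN bform_mulr => ->; apply: bform_skew.
have [z z0 zB] : exists2 z : 'rV_n, z != 0 & z *m B = 0.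
  apply/det0P; have := det_tr B; rewrite Bt -scaleN1r detZ -signr_odd n_odd mulN1r.
  by move=> /eqP; rewrite eq_sym -addr_eq0 -mulr2n mulrn_eq0.
have Bz : B *m z^T = 0 by apply: trmx_inj; rewrite trmx_mul trmxK Bt mulmxN zB oppr0 trmx0.
have split_e (v : 'cV_n) t : pair_g D v t = t *: pair_g D 0 1 + pair_g D v 0.
  by rewrite scaleg addg scaler0 add0r mulr1 addr0.
have w_ker (u : 'cV_n) (y : g) : B *m u = 0 -> w (pair_g D u 0) y = y.2 * w (pair_g D u 0) (pair_g D 0 1).
  move=> Bu; rewrite {1}[y]pair_gE (split_e y.1) wr wB bform_tr Bt /bform -mulmxA mulNmx Bu.
  by rewrite oppr0 mulmx0 mxE addr0.
have we0 : w (pair_g D z^T 0) (pair_g D 0 1) != 0.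
  apply: contraNneq z0 => wz0; apply/eqP/trmx_inj; rewrite trmx0.
  have /wnd : forall y, w (pair_g D z^T 0) y = 0.
    by move=> y; rewrite w_ker // wz0 mulr0.
  by rewrite pair_g0 => /pair_g_inj [].
exists B, z^T; split=> //; split=> //.
  by apply: contraNneq z0 => zt; rewrite -[z]trmxK zt trmx0.
move=> x Bx.
exists (w (pair_g D x 0) (pair_g D 0 1) / w (pair_g D z^T 0) (pair_g D 0 1)).
set c := _ / _; apply/eqP; rewrite -subr_eq0; apply/eqP.
have /wnd : forall y, w (pair_g D (x - c *: z^T) 0) y = 0.
  move=> y; have -> : pair_g D (x - c *: z^T) 0 = (- c) *: pair_g D z^T 0 + pair_g D x 0.
    by rewrite scaleg addg mulr0 addr0 scaleNr addrC.
  by rewrite wP (w_ker _ _ Bz) (w_ker _ _ Bx) mulNr mulrCA /c divfK // addNr.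
by rewrite pair_g0 => /pair_g_inj [].
Qed.

Lemma pseudo_Kahler_on_ideal (J : 'End(g)) (h : g -> g -> R) : odd n ->
  pseudo_Kahler_structure J h -> has_pseudo_Kahler D.
Proof.
move=> n_odd [[JJ Jint] [hb hs hnd hJ hw]].
have [f [J1 [HJ JE]]] := complex_structure_hyperplane (conj JJ Jint).
have [B [z [HB wB]]] := symplectic_corank1 n_odd hw.
exists f, J1, B, z; split=> // x y fx fy.
have JW v : f *m v = 0 -> J (pair_g D v 0) = pair_g D (J1 *m v) 0.
  by move=> fv; rewrite JE fv mxE.
rewrite [LHS]mx11_scalar [RHS]mx11_scalar; congr (_%:M).
by rewrite -!/(bform B _ _) -!wB -!JW // hJ.
Qed.

(** Invariance under [J] determines the form on the whole algebra from its
    restriction [B] to the ideal, up to the value [sigma] on [(eta, e)], where [J]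
    maps [eta] to [e]. If the kernel [z] of [B] lies in the hyperplane the form
    is nondegenerate anyway, because [B (J z)] does not vanish; otherwise [sigma]
    can be chosen so. *)
Lemma pseudo_Kahler_of_ideal : has_pseudo_Kahler D ->
  exists (J : 'End(g)) (h : g -> g -> R), pseudo_Kahler_structure J h.
Proof.
move=> [f [J [B [z [HJ HB HJB]]]]].
have [Bt DB z0 Bz kerB] := HB.
have [eta fe] := row_dual HJ.1.
pose K := J_proj f J eta.
pose L0 := eta^T *m B *m K.
have [sigma Lz] : exists sigma, (L0 + sigma *: f) *m z != 0.
  have [fz|fz] := eqVneq (f *m z) 0.
    exists 0; rewrite scale0r addr0 /L0 -mulmxA.
    have [l l0 JzB] := compatible_kernel HJ HB HJB fz.
    have -> : K *m z = J *m z.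
      by have := J_proj_hyperplane J fe 0 fz; rewrite scale0r addr0.
    have -> : eta^T *m B *m (J *m z) = - (l%:M).
      apply: trmx_inj; rewrite !trmx_mul !trmxK Bt mulNmx mulmxN mulmxA.
      rewrite -(trmx_mul J z) JzB -scalemxAl fe scalemx1.
      by rewrite [RHS]linearN /= tr_scalar_mx.
    rewrite oppr_eq0; apply: contraNneq l0 => /matrixP /(_ 0 0).
    by rewrite !mxE mulr1n => ->.
  (* This value of [sigma] makes [L] take the value one on [z]. *)
  exists ((1 - (L0 *m z) 0 0) / (f *m z) 0 0).
  have fz00 : (f *m z) 0 0 != 0.
    by apply: contraNneq fz => e; rewrite [f *m z]mx11_scalar e raddf0.
  apply/eqP => /matrixP /(_ 0 0); rewrite mulmxDl -scalemxAl.
  rewrite [LHS]mxE [X in _ + X]mxE divfK // addrC subrK mxE => /eqP.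
  by rewrite oner_eq0.
set L := L0 + sigma *: f in Lz.
have [w w_symp wE] : exists2 w : g -> g -> R, symplectic_structure w &
    forall x y, w x y = form_ext B L x y.
  by exists (form_ext B L); first exact: form_ext_symplectic HB Lz.
pose Jg : g -> g := J_ext f J eta.
have Jsqr x : Jg (Jg x) = - x by apply: J_ext_sqr.
have [wb walt wnd wcl] := w_symp; have wskew := skew_of_alternating wb walt.
have [wl wr] := wb.
have bN u v : bform B u v = - bform B v u by apply: bform_skew.
have bself u : bform B u u = 0.
  by have := bN u u => /eqP; rewrite -addr_eq0 -mulr2n mulrn_eq0 => /eqP.
have wJ x y : w (Jg x) (Jg y) = w x y.
  rewrite [x]pair_gE [y]pair_gE; move: x.1 x.2 y.1 y.2 => v s u t {x y}.
  have [p [a [fp ->]]] := hyperplane_split fe v.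
  have [q [b [fq ->]]] := hyperplane_split fe u.
  have [fJp _ JJp _] := HJ.2 p fp; have [fJq _ JJq _] := HJ.2 q fq.
  rewrite /Jg !J_extE // !wE /form_ext /=.
  have LE r c : f *m r = 0 -> rform L (c *: eta + r) = bform B eta (J *m r) + sigma * c.
    move=> fr; rewrite addrC /rform /L mulmxDl -scalemxAl mxE; congr (_ + _).
      by rewrite /L0 -mulmxA J_proj_hyperplane.
    by rewrite mxE (f_split fe).
  have HB' : bform B (J *m p) (J *m q) = bform B p q by rewrite /bform HJB.
  rewrite -(scaleNr s eta) -(scaleNr t eta) ![_ + _ *: eta]addrC !bform_linl !bform_linr !LE //.
  rewrite JJp JJq HB' bself (bN (J *m p) eta) (bN p eta).
  rewrite !bformNr; ring.
have wP a (x y u : g) : w (a *: x + y) u = a * w x u + w y u := wl u a x y.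
have w0 (y : g) : w 0 y = 0.
  by apply: (addrI (w 0 y)); rewrite addr0 -{1}[w 0 y]mul1r -wP scale1r addr0.
have wNl (x y : g) : w (- x) y = - w x y.
  by have := wP (-1) x 0 y; rewrite scaleN1r !addr0 mulN1r w0 addr0.
have JgP a (u v : g) : Jg (a *: u + v) = a *: Jg u + Jg v by apply: linearP.
have JgE x : linfun (J_ext f J eta) x = Jg x by rewrite lfunE.
exists (linfun (J_ext f J eta)), (fun x y => - w (Jg x) y).
split; first exact: complex_structure_ext.
have symp_eq x y : - w (Jg (Jg x)) y = w x y by rewrite Jsqr wNl opprK.
split.
- split=> [u a v v'|u a v v'] /=; first by rewrite JgP wP opprD mulrN.
  by rewrite wr opprD mulrN.
- move=> x y; rewrite [w (Jg x) y]wskew opprK -wJ Jsqr wskew wNl opprK.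
  exact: wskew.
- move=> x hx; have Jx0 : Jg x = 0.
    by apply: wnd => y; apply/eqP; rewrite -oppr_eq0; apply/eqP.
  have := Jsqr x; rewrite Jx0 /Jg linear0 => /esym /eqP.
  by rewrite oppr_eq0 => /eqP.
- by move=> x y; rewrite !JgE wJ.
- split.
  + by split=> [u a v v'|u a v v'] /=; rewrite !JgE !symp_eq; [exact: wl | exact: wr].
  + by move=> x; rewrite JgE symp_eq.
  + by move=> x wx; apply: wnd => y; have := wx y; rewrite JgE symp_eq.
  + by move=> x y u; rewrite !JgE !symp_eq.
Qed.

End Forms.

(** * The classification *)

Section Classification.
Variables (R : rcfType) (n : nat) (D : 'M[R]_n).

Lemma simmx_mset_sum (t t1 : seq (jsymbol R)) q :
  simmx D (jordan_mx t) -> seq_mset t = seq_mset t1 `+` q ->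
  simmx D (jordan_mx (t1 ++ q)).
Proof.
move=> Dt def_t; apply: simmx_trans Dt (perm_jordan_mx _).
by apply/eq_seq_msetP; rewrite def_t seq_mset_cat seq_mset_id.
Qed.

Lemma pseudo_Kahler_sum (t : seq (jsymbol R)) s q :
  simmx D (jordan_mx t) -> seq_mset t = s `+` q -> in_Q q ->
  (forall t', seq_mset t' = s -> has_pseudo_Kahler (jordan_mx t')) ->
  has_pseudo_Kahler D.
Proof.
move=> Dt def_t Qq pKs; rewrite -(seq_mset_id s) in def_t.
apply: has_pseudo_Kahler_sim (simmx_mset_sum Dt def_t) _.
apply: has_pseudo_Kahler_sim (jordan_mx_cat _ _) _.
apply: has_pseudo_Kahler_dsum; first exact/pKs/seq_mset_id.
exact: unitary_jordan_mx Qq (seq_mset_id q).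
Qed.

(** Given both structures separately, every type other than the exceptional one
    carries a pseudo-Kahler structure. *)
Lemma exceptional_type : has_complex D -> has_symplectic D ->
  ~ has_pseudo_Kahler D ->
  exists (c : R) (m : nat), c != 0 /\ exists2 q : {mset jsymbol R}, in_Q q &
    has_jordan_type D
      (msetn 2%N (Jsym m (- c)) `+` [mset Jsym m c] `+` [mset Jsym m.+1 c] `+` q).
Proof.
move=> [f [J HJ]] [B [z HB]] npK.
have [t Dt] := real_jordan_form D.
have [a [k [fD par]]] := complex_parity HJ.
have [b Dz] := corank1_eigen HB.
have ck_le w j : (ck t w j <= ck t (oppconj w) j)%N.
  rewrite -!(kdim_ck _ _ Dt); have := symplectic_inequality HB (quadp (val w) ^+ j) Dz.
  rewrite rmorphXn /= quadp_comp_oppX => /leq_trans; apply.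
  have -> : root (quadp (val w) ^+ j) b = false; last by rewrite addn0.
  rewrite /root horner_exp expf_eq0; apply/negbTE; rewrite negb_and.
  by rewrite -rootE quadp_root ?orbT // Im_upper_neq0.
have [x j|x j|w j|q Qq] := @jordan_type_classification _ t a b k.
- by rewrite -(kdim_rk _ _ Dt) par.
- rewrite -!(kdim_rk _ _ Dt); apply: leq_trans (symplectic_inequality HB _ Dz) _.
  rewrite kdim_XsubC_opp leq_add2l /root horner_exp !hornerE expf_eq0 subr_eq0.
  by rewrite eq_sym; case: (x == b); rewrite ?andbF // leq_b1.
- by apply/eqP; rewrite eqn_leq ck_le andbT -{2}(oppconjK w) ck_le.
case=> [[a0 def_t]|def_t|[a0 [m def_t]]].
- by case: npK; apply: pseudo_Kahler_sum Dt def_t Qq _ => t'; apply: pseudo_Kahler_steps.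
- by case: npK; apply: pseudo_Kahler_sum Dt def_t Qq _ => t';
    apply: pseudo_Kahler_steps_dual.
- by exists a, m; split=> //; exists q => //; exists t.
Qed.

Lemma exceptional_structures (c : R) m q : c != 0 -> in_Q q ->
  has_jordan_type D
    (msetn 2%N (Jsym m (- c)) `+` [mset Jsym m c] `+` [mset Jsym m.+1 c] `+` q) ->
  [/\ has_complex D, has_symplectic D & ~ has_pseudo_Kahler D].
Proof.
move=> c0 Qq [t def_t Dt].
have {Dt} := simmx_mset_sum
  (t1 := [:: Jsym m.+1 c; Jsym m c; Jsym m (- c); Jsym m (- c)]) (Dt : simmx D _).
move=> /(_ q) [|P [Q DT]].
  rewrite def_t; congr (_ `+` _); apply/msetP => s.
  rewrite !msetE2 !msetnE mset_seqE /= ![_ == s]eq_sym.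
  by do 3!case: eqP.
have {P Q}DT : simmx D (jordan_mx ([:: Jsym m.+1 c; Jsym m c; Jsym m (- c); Jsym m (- c)] ++ q)).
  by exists P, Q.
have Uq := unitary_jordan_mx Qq (seq_mset_id q).
split.
- apply: has_complex_sim DT _; apply: has_complex_sim (jordan_mx_cat _ _) _.
  exact: has_complex_dsum (complex_exceptional _ _) Uq.
- apply: has_symplectic_sim DT _; apply: has_symplectic_sim (jordan_mx_cat _ _) _.
  exact: has_symplectic_dsum (symplectic_exceptional _ _) Uq.
- by apply: exceptional_not_pseudo_Kahler c0 _ DT; rewrite seq_mset_id.
Qed.

End Classification.

Theorem theorem4p9 (R : realType) (n : nat) (n_gt0 : (0 < n)%N)
    (D : 'M[R]_(2 * n - 1)) :
  [/\ exists J : 'End(almost_abelian D), complex_structure J,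
      exists w : almost_abelian D -> almost_abelian D -> R,
        symplectic_structure w &
      ~ exists (J : 'End(almost_abelian D))
               (h : almost_abelian D -> almost_abelian D -> R),
          pseudo_Kahler_structure J h]
  <->
  exists (c : R) (m : nat), c != 0 /\
    exists2 q : {mset jsymbol R}, in_Q q &
      has_jordan_type D
        (msetn 2%N (Jsym m (- c)) `+` [mset Jsym m c] `+` [mset Jsym m.+1 c]
         `+` q).
Proof.
have n_odd : odd (2 * n - 1) by rewrite oddB ?muln_gt0 // mul2n odd_double.
split=> [[[J HJ] [w Hw] npK]|[c [m [c0 [q Qq DT]]]]].
  apply: exceptional_type.
  - by have [f [J1 [HJ1 _]]] := complex_structure_hyperplane HJ; exists f, J1.
  - by have [B [z [HB _]]] := symplectic_corank1 n_odd Hw; exists B, z.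
  - by move=> pK; apply: npK; apply: pseudo_Kahler_of_ideal.
have [[f [J HJ]] [B [z HB]] npK] := exceptional_structures c0 Qq DT.
split.
- have [eta fe] := row_dual HJ.1.
  by exists (linfun (J_ext f J eta)); apply: complex_structure_ext.
- exact: symplectic_of_corank1 HB.
- by move=> [J' [h pK]]; apply: npK; apply: pseudo_Kahler_on_ideal pK.
Qed.
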